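(* Let $\alpha\in(0,2)$, let $(L_t^{\alpha})_{t \geq 0}$ be a locally stable process whose Lévy measure satisfies the condition of the context, and let $(S_t^{\alpha})_{t \geq 0}$ be a symmetric stable process with $\mathbb{E}(e^{izS_1^\alpha})=\exp(-|z|^\alpha)$. (i) There is a constant $C>0$ such that, for all $n\ge2$, $$d_{TV}( n^{1/\alpha} L_{1/n}^{\alpha}, S_1^{\alpha}) \leq \begin{cases} C/n & \text{if } \alpha<1,\\ C\ln(n)/n & \text{if } \alpha=1,\\ C/ n^{1/ \alpha} & \text{if } \alpha >1.\end{cases}$$ (ii) Let $p>0$ and let $(g_n)_{n \geq 1}$ be a sequence of real (Borel) functions for which there exist $\varepsilon \in (0,1/4)$ and $C>0$ such that for all $z \in \mathbb{R}$ and all $n$, $|g_n(z)| \leq C \ln(n)^p(1+ |z|^{\varepsilon \alpha})$. Then for any bounded sequence $(c_n)$ of real numbers there is a constant $C>0$ such that, for all $n\ge2$, $$|\mathbb{E}\, g_n( B_1+ c_n n^{1/\alpha} L_{1/n}^{\alpha})-\mathbb{E}\, g_n( B_1+ c_n S_1^{\alpha})| \leq C \max\left(\frac{1}{n^{1-2\varepsilon}},\frac{1}{n^{1/ \alpha - 2\varepsilon}}\right),$$ where $B_1$ is a standard Gaussian variable independent of $L_{1/n}^{\alpha}$ and $S_1^{\alpha}$.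
   Context: $d_{TV}(X,Y)$ denotes the total variation distance between the distributions of $X$ and $Y$ ($\frac12\int|p_X-p_Y|$ when densities exist). Locally stable process: $L^\alpha$ is a pure-jump Lévy process (no drift, no Gaussian part; the Lévy measure is symmetric) with Lévy measure $F^{\alpha,\tau}(dz)=\frac{c_\alpha\tau(z)}{|z|^{\alpha+1}}1_{\mathbb{R}\setminus\{0\}}(z)dz$, where $c_1=1/\pi$, $c_{\alpha}= -\frac{\alpha(\alpha-1)}{2\Gamma(2-\alpha) \cos(\pi \alpha/2)}$ for $\alpha\ne1$ ($\Gamma$ the Gamma function), and $\tau$ is a real non-negative bounded even function with $\tau(z)=1+O(|z|)$ on $\{0<|z|\le\eta\}$ for some $\eta>0$. Thus $\mathbb{E}(e^{iuL_t^\alpha})=\exp\big(t\int(e^{iuz}-1-iuz1_{\{|z|\le1\}})F^{\alpha,\tau}(dz)\big)$. The Lévy measure of $S^\alpha$ corresponds to $\tau\equiv1$. *)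

(* Defs.v *)
From HB Require Import structures.
From mathcomp Require Import all_boot all_order all_algebra.
From mathcomp Require Import complex.
From mathcomp Require Import all_classical all_reals all_analysis.
Set Implicit Arguments.
Unset Strict Implicit.
Unset Printing Implicit Defensive.
Import Order.TTheory GRing.Theory Num.Theory.
Import numFieldNormedType.Exports.
Local Open Scope classical_set_scope.
Local Open Scope ring_scope.
Local Open Scope complex_scope.

Section ComplexValued.
Context {R : realType}.

Definition cexp (z : R[i]) : R[i] :=
  (expR (complex.Re z) * cos (complex.Im z))
    +i* (expR (complex.Re z) * sin (complex.Im z)).

Definition cintegral d (T : measurableType d) (mu : {measure set T -> \bar R})
    (f : T -> R[i]) : R[i] :=
  (\int[mu]_(x in setT) complex.Re (f x))
    +i* (\int[mu]_(x in setT) complex.Im (f x)).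

Definition charfun d (T : measurableType d) (P : probability T R)
    (X : T -> R) (u : R) : R[i] :=
  cintegral P (fun w => cexp (0 +i* (u * X w))).

End ComplexValued.

Section RandomVariables.
Context {R : realType} d {T : measurableType d} (P : probability T R).

(* sup_A |P(X in A) - P(Y in A)| over Borel sets A; this is the normalization
   for which densities p, q give (1/2) \int |p - q|. *)
Definition dTV (X Y : T -> R) : \bar R :=
  ereal_sup [set `|P (X @^-1` A) - P (Y @^-1` A)|%E | A in measurable].

Definition indep (X Y : T -> R) : Prop :=
  forall A B : set R, measurable A -> measurable B ->
    P (X @^-1` A `&` Y @^-1` B) = (P (X @^-1` A) * P (Y @^-1` B))%E.

(* Taking A i := setT for some i gives the product rule for subfamilies. *)
Definition mutual_indep m (X : 'I_m -> T -> R) : Prop :=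
  forall A : 'I_m -> set R, (forall i, measurable (A i)) ->
    fine (P [set w | forall i, A i (X i w)]) =
    \prod_(i < m) fine (P (X i @^-1` A i)).

Definition standard_gaussian (B : T -> R) : Prop :=
  forall A : set R, measurable A -> P (B @^-1` A) = normal_prob 0 1 A.

End RandomVariables.

Section Levy.
Context {R : realType} d {T : measurableType d} (P : probability T R).

(* Processes are indexed by R; only their values at times t >= 0 matter. *)

Definition independent_increments (X : R -> {RV P >-> R}) : Prop :=
  forall m (t : nat -> R), 0 <= t 0%N -> (forall k, t k <= t k.+1) ->
    mutual_indep P (fun (i : 'I_m) w => X (t i.+1) w - X (t i) w).

Definition stationary_increments (X : R -> {RV P >-> R}) : Prop :=
  forall s h : R, 0 <= s -> 0 <= h -> forall A : set R, measurable A ->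
    P ((fun w => X (s + h) w - X s w) @^-1` A) = P (X h @^-1` A).

Definition stochastically_continuous (X : R -> {RV P >-> R}) : Prop :=
  forall t e : R, 0 <= t -> 0 < e ->
    (fun s => P [set w | e < `|X s w - X t w|])
      @ within [set s | 0 <= s] (nbhs t) --> 0%E.

Definition levy_process (X : R -> {RV P >-> R}) : Prop :=
  [/\ {ae P, forall w, X 0 w = 0},
      independent_increments X,
      stationary_increments X &
      stochastically_continuous X].

Definition levy_measure (F : {measure set R -> \bar R}) : Prop :=
  F [set 0] = 0%E /\
  (\int[F]_(z in setT) (Num.min 1 (z ^+ 2))%:E < +oo)%E.

Definition levy_khintchine_exponent (F : {measure set R -> \bar R})
    (u : R) : R[i] :=
  cintegral F (fun z => cexp (0 +i* (u * z)) - 1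
    - (0 +i* (u * z * \1_([set y : R | `|y| <= 1]) z))).

Definition pure_jump_levy_process (F : {measure set R -> \bar R})
    (X : R -> {RV P >-> R}) : Prop :=
  [/\ levy_measure F, levy_process X &
      forall t u : R, 0 <= t ->
        charfun P (X t) u = cexp (t%:C * levy_khintchine_exponent F u)].

Definition symmetric_stable_process (alpha : R) (X : R -> {RV P >-> R}) : Prop :=
  levy_process X /\
  forall u : R, charfun P (X 1) u = (expR (- (`|u| `^ alpha)))%:C.

End Levy.

Section LocallyStable.
Context {R : realType}.

Definition Gamma (a : R) : R :=
  \int[lebesgue_measure]_(x in `]0, +oo[) (x `^ (a - 1) * expR (- x)).

Definition stable_const (alpha : R) : R :=
  if alpha == 1 then pi^-1
  else - (alpha * (alpha - 1) /
          (2 * Gamma (2 - alpha) * cos (pi * alpha / 2))).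

Definition levy_density (alpha : R) (tau : R -> R) (z : R) : R :=
  stable_const alpha * tau z / `|z| `^ (alpha + 1) * \1_([set~ 0]) z.

Definition tau_condition (tau : R -> R) : Prop :=
  [/\ measurable_fun setT tau,
      forall z, 0 <= tau z,
      exists M : R, forall z, tau z <= M,
      forall z, tau (- z) = tau z &
      exists eta K : R, 0 < eta /\
        forall z, 0 < `|z| <= eta -> `|tau z - 1| <= K * `|z|].

Definition locally_stable_process d {T : measurableType d}
    (P : probability T R) (alpha : R) (tau : R -> R)
    (X : R -> {RV P >-> R}) : Prop :=
  exists F : {measure set R -> \bar R},
    (forall A : set R, measurable A ->
       F A = \int[lebesgue_measure]_(z in A) (levy_density alpha tau z)%:E)%E
    /\ pure_jump_levy_process F X.

Definition tv_rate (alpha : R) (n : nat) : R :=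
  if alpha < 1 then n%:R^-1
  else if alpha == 1 then ln n%:R / n%:R
  else (n%:R `^ alpha^-1)^-1.

End LocallyStable.

(* Main.v *)
Require Import Defs.
From HB Require Import structures.
From mathcomp Require Import all_boot all_order all_algebra.
From mathcomp Require Import complex.
From mathcomp Require Import all_classical all_reals all_analysis.
From mathcomp Require Import measurable_realfun ring lra.
Set Implicit Arguments.
Unset Strict Implicit.
Unset Printing Implicit Defensive.
Import Order.TTheory GRing.Theory Num.Theory.
Import numFieldNormedType.Exports.
Local Open Scope classical_set_scope.
Local Open Scope ring_scope.

(** The law of X_n = n^(1/alpha) L_(1/n) is symmetric, and for u > 0 its
characteristic function is exp (- psi_n u), where psi_n u is twice the integral over
z > 0 of (1 - cos (u z)) c_alpha tau (z / n^(1/alpha)) z^(-1-alpha).  With tau = 1 the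
same integral is u^alpha, the exponent of S_1 (levy_integralE; this is the only place
where the value of c_alpha matters).  Both characteristic functions phi_n and phi are
integrable on the half-line, so both laws have densities, given by the cosine
transforms of phi_n and phi (density_of_charfun), and everything reduces to a bound on
the L1 distance of these two densities.

The difference of the two jump densities is cut at a fixed threshold r, and
psi_n u = u^alpha + D1 u + D2 u, where D1 collects the jumps below r and D2 those above.
- Above r the difference is integrable, and its L1 norm eps has the size of the claimed
  rate (levy_excess_rate).  Multiplying a characteristic function by D2 amounts to
  applying to the density A the operator that averages 2 A y - A (y + z) - A (y - z)
  over the jumps z, which has norm at most 4 eps on L1; summing the exponential series,
  multiplication by e^D2 moves the density by at most e^(4 eps) - 1
  (integral_norm_cosine_transform_expR).
- Below r the difference need not be integrable, but it has a second moment kappa of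
  order n^(-1/alpha).  Here w = e^(-u^alpha) (e^(- D1) - 1) has two derivatives on the
  open half-line, and w and w'' are bounded by kappa times a fixed integrable weight.
  Two integrations by parts show that y^2 times the transform of w is minus the
  transform of w'', so that the transform of w is bounded by a multiple of
  kappa / (1 + y^2) (integral_norm_cosine_transform_small_jumps).
Since phi_n - phi = w - phi_n (e^D2 - 1), the two estimates add up to levy_L1_rate,
hence to part (i), and to a bound on the difference of the expectations of any bounded
function of X_n and of S_1.

For part (ii) the function g_n is truncated at |z| <= n^(1/alpha).  The truncated
function is of size ln(n)^p n^eps, and conditioning on B, which is independent of both
variables, the L1 bound applies to it.  The remainder is controlled by a moment of
order beta = alpha (1 - eps/2), slightly below alpha, of B + c_n X_n; such moments are
bounded uniformly in n because |x|^beta is an average of 1 - cos (u x) over u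
(moment_le).  The powers of ln n are absorbed by n^(eps/2). *)

(** * Measures with a density, and changes of variable *)

Section density.
Local Open Scope ereal_scope.
Context d (T : measurableType d) (R : realType).
Variables (nu mu : {measure set T -> \bar R}) (rho : T -> R).
Hypotheses (mrho : measurable_fun setT rho) (rho0 : forall x, (0 <= rho x)%R).
Hypothesis nuE : forall A, measurable A -> nu A = \int[mu]_(x in A) (rho x)%:E.

Import HBNNSimple.

(** The integral against a measure with a density, by monotone approximation of the
integrand by simple functions. *)
Lemma ge0_integral_density (f : T -> \bar R) :
  measurable_fun setT f -> (forall x, 0 <= f x) ->
  \int[nu]_x f x = \int[mu]_x (f x * (rho x)%:E).
Proof.
move=> mf f0.
pose f_ := nnsfun_approx measurableT mf.
have mfr n : measurable_fun setT (fun x => (f_ n x)%:E * (rho x)%:E).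
  apply/measurable_EFinP/measurable_funM => //.
transitivity (limn (fun n => \int[nu]_x (f_ n x)%:E)).
  rewrite -monotone_convergence//.
  - by apply: eq_integral => y _; apply/esym/cvg_lim => //; apply: cvg_nnsfun_approx.
  - by move=> n; exact/measurable_EFinP.
  - by move=> n y _; rewrite lee_fin.
  - by move=> y _ m n mn; rewrite lee_fin; exact/lefP/nd_nnsfun_approx.
transitivity (limn (fun n => \int[mu]_x ((f_ n x)%:E * (rho x)%:E))); last first.
  rewrite -monotone_convergence//.
  - apply: eq_integral => y _; apply/cvg_lim => //.
    by apply: cvgeZr => //; apply: cvg_nnsfun_approx.
  - by move=> n y _; rewrite mule_ge0// lee_fin.
  - move=> y _ m n mn; rewrite lee_wpmul2r// lee_fin//.
    exact/lefP/nd_nnsfun_approx.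
congr (limn _); apply/funext => n.
under eq_integral do rewrite fimfunE -fsumEFin//.
rewrite ge0_integral_fsum//; last 2 first.
  - by move=> r; exact/measurable_EFinP/measurable_funM.
  - by move=> r x _; rewrite nnfun_muleindic_ge0.
under [RHS]eq_integral.
  move=> x _.
  rewrite (_ : _ * _ = \sum_(k \in range (f_ n))
      (k * \1_(f_ n @^-1` [set k]) x)%:E * (rho x)%:E); last first.
    rewrite -ge0_mule_fsuml; last by move=> r; rewrite /= ?EFinM nnfun_muleindic_ge0.
    by rewrite fimfunE -fsumEFin.
  over.
rewrite [RHS]ge0_integral_fsum//; last 2 first.
  - move=> r; apply: emeasurable_funM; last exact/measurable_EFinP.
    exact/measurable_EFinP/measurable_funM.
  - move=> r x _; apply: mule_ge0; last by rewrite lee_fin.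
    by rewrite EFinM nnfun_muleindic_ge0.
apply: eq_fsbigr => r _.
rewrite integralZl_indic_nnsfun// integral_indic// setIT.
have [r0|r0] := leP 0%R r; last first.
  rewrite preimage_nnfun0// measure0 mule0 integral0_eq// => x _.
  by rewrite indic0 mulr0 mul0e.
rewrite nuE// -ge0_integralZl//; last 2 first.
- exact/measurable_funTS/measurable_EFinP.
- by move=> x _; rewrite lee_fin.
rewrite integral_mkcond; apply: eq_integral => x _.
rewrite patchE indicE; case: ifPn => _; first by rewrite mulr1.
by rewrite mulr0 mul0e.
Qed.

End density.

Section affine.
Context {R : realType}.
Notation mu := (@lebesgue_measure R).
Variables (k b : R) (k0 : 0 < k).

Let phi : measurableTypeR R -> measurableTypeR R := fun x => k * x + b.
Let mphi : measurable_fun [set: measurableTypeR R] phi.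
Proof.
have : measurable_fun [set: R] (fun x : R => k * x + b).
  by apply: measurable_funD => //; apply: measurable_funM.
by [].
Qed.
Let pm : {measure set (measurableTypeR R) -> \bar R} :=
  measure_function_pushforward__canonical__measure_function_Measure mu mphi.
Let k_nng : {nonneg R} := NngNum (ltW k0).

Lemma lebesgue_measure_affine (A : set R) : measurable A ->
  (k%:E * mu ((fun x => k * x + b)%R @^-1` A) = mu A)%E.
Proof.
move=> mA.
have := @lebesgue_measure_unique R (mscale k_nng pm).
move=> H; rewrite (H _ A mA) /mscale //=.
move=> _ [[x y]] _ <-; rewrite /mscale/= /pushforward/=.
rewrite (_ : phi @^-1` `]x, y] = `](x - b) / k, (y - b) / k]%classic); last first.
  apply/seteqP; split => z /=; rewrite /phi !in_itv/= ltr_pdivrMr//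
    ler_pdivlMr// ltrBlDr lerBrDr mulrC//.
rewrite !lebesgue_measure_itv/= !lte_fin ltr_pM2r ?invr_gt0// ltrD2r.
case: ifPn => _; last by rewrite mule0.
rewrite -!EFinB -EFinM; congr EFin; field; exact: lt0r_neq0.
Qed.

Lemma ge0_integral_affine (f : R -> \bar R) :
  measurable_fun setT f -> (forall x, (0 <= f x)%E) ->
  (\int[mu]_x f x = k%:E * \int[mu]_x f (k * x + b)%R)%E.
Proof.
move=> mf f0.
rewrite -(@ge0_integral_pushforward _ _ _ _ _ phi mphi mu setT f)//.
have -> : (\int[mu]_x f x = \int[mscale k_nng pm]_x f x)%E.
  apply: eq_measure_integral => A mA _; rewrite /mscale/= /pushforward.
  exact/esym/lebesgue_measure_affine.
by rewrite (@ge0_integral_mscale _ _ _ _ setT).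
Qed.

Lemma measurable_fun_affine d (T : measurableType d) (f : R -> T) :
  measurable_fun setT f -> measurable_fun setT (fun x : R => f (k * x + b)).
Proof. by move=> mf; exact: (measurableT_comp mf mphi). Qed.

Lemma integrable_affine (f : R -> R) :
  mu.-integrable setT (EFin \o f) ->
  mu.-integrable setT (fun x => (f (k * x + b)%R)%:E).
Proof.
move=> /integrableP[mf fi]; apply/integrableP; split.
  exact: (measurable_fun_affine mf).
move: fi; rewrite (@ge0_integral_affine (fun x => `|(f x)%:E|%E))//; last first.
  exact: measurableT_comp.
apply: contraPP => /negP; rewrite -leNgt leye_eq => /eqP ->.
by rewrite gt0_muley ?lte_fin.
Qed.

Lemma Rintegral_affine (f : R -> R) :
  mu.-integrable setT (EFin \o f) ->
  \int[mu]_x f x = k * \int[mu]_x f (k * x + b).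
Proof.
move=> fi.
have mf : measurable_fun setT (EFin \o f) by case/integrableP : fi.
have fi' := integrable_affine fi.
have E : (\int[mu]_x (f x)%:E = k%:E * \int[mu]_x (f (k * x + b)%R)%:E)%E.
  rewrite integralE [in RHS]integralE muleBr//; last first.
    by rewrite fin_num_adde_defr// integrable_pos_fin_num.
  have fp := ge0_integral_affine (measurable_funepos mf) (fun x => funepos_ge0 _ x).
  have fn := ge0_integral_affine (measurable_funeneg mf) (fun x => funeneg_ge0 _ x).
  congr (_ - _)%E.
    rewrite [LHS]fp; congr (_ * _)%E; apply: eq_integral => x _.
    by rewrite !funeposE.
  rewrite [LHS]fn; congr (_ * _)%E; apply: eq_integral => x _.
  by rewrite !funenegE.
by rewrite /Rintegral E fineM//; exact: integrable_fin_num.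
Qed.

End affine.

Section opp.
Context {R : realType}.
Notation mu := (@lebesgue_measure R).

Lemma ge0_integral_opp (f : R -> \bar R) :
  measurable_fun setT f -> (forall x, (0 <= f x)%E) ->
  (\int[mu]_x f x = \int[mu]_x f (- x)%R)%E.
Proof.
move=> mf f0.
pose phi : measurableTypeR R -> measurableTypeR R := -%R.
have mphi : measurable_fun [set: measurableTypeR R] phi.
  have : measurable_fun [set: R] (fun x : R => - x) by exact: measurable_funN.
  by [].
rewrite -(@ge0_integral_pushforward _ _ _ _ _ phi mphi mu setT f)//.
by apply: eq_measure_integral => A mA _; exact/esym/lebesgue_measureN.
Qed.

End opp.

Section evenodd.
Context {R : realType}.
Notation mu := (@lebesgue_measure R).

Lemma ge0_integral_even (f : R -> \bar R) :
  measurable_fun setT f -> (forall x, (0 <= f x)%E) ->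
  (forall x, f (- x) = f x) ->
  (\int[mu]_x f x = 2%:E * \int[mu]_(x in `]0%R, +oo[) f x)%E.
Proof.
move=> mf f0 fe.
have -> : [set: R] = `]-oo, 0%R[%classic `|` `[0%R, +oo[%classic.
  by rewrite -setCitvr setvU.
rewrite ge0_integral_setU//=; last 2 first.
  exact: measurable_funTS.
  rewrite -setCitvr; apply/disj_setPS => x []//.
have -> : (\int[mu]_(x in `[0%R, +oo[) f x = \int[mu]_(x in `]0%R, +oo[) f x)%E.
  rewrite [RHS]integral_itv_obnd_cbnd//; exact: measurable_funTS.
have -> : (\int[mu]_(x in `]-oo, 0%R[) f x = \int[mu]_(x in `]0%R, +oo[) f x)%E.
  rewrite integral_mkcond [RHS]integral_mkcond ge0_integral_opp.
  - apply: eq_integral => x _; rewrite !patchE fe.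
    rewrite (_ : (- x \in _) = (x \in `]0%R, +oo[%classic))//.
    by apply/idP/idP; rewrite !inE/= !in_itv/= andbT oppr_lt0.
  - by apply/(measurable_restrictT _ _).1 => //; exact: measurable_funTS.
  - by move=> x; rewrite patchE; case: ifP.
by rewrite -[(2%:E)]/((1 + 1)%:E) EFinD ge0_muleDl ?mul1e// lee_fin.
Qed.

End evenodd.

(** * Integrals depending on a parameter, and the half-line *)

Section integrable_tools.
Context d (T : measurableType d) (R : realType) (m : {measure set T -> \bar R}).
Implicit Types (D : set T) (f g : T -> R).

Lemma le_integrable_fin D f g : measurable D -> measurable_fun D f ->
  m.-integrable D (EFin \o g) -> (forall x, D x -> `|f x| <= g x) ->
  m.-integrable D (EFin \o f).
Proof.
move=> mD mf ig fg; apply: (le_integrable mD _ _ ig).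
  exact/measurable_EFinP.
move=> x Dx /=; rewrite lee_fin (le_trans (fg _ Dx))//.
exact: ler_norm.
Qed.

Lemma integrableM_bounded D f g (M : R) : measurable D ->
  m.-integrable D (EFin \o f) -> measurable_fun D g ->
  (forall x, D x -> `|g x| <= M) ->
  m.-integrable D (EFin \o (fun x => f x * g x)).
Proof.
move=> mD fi mg gM.
have mf : measurable_fun D f by case/integrableP : fi => /measurable_EFinP.
apply: (@le_integrable_fin _ _ (fun x => M * `|f x|)) => //.
- exact: measurable_funM.
- have := integrableZl mD M (integrable_norm fi).
  by apply: eq_integrable.
- by move=> x Dx; rewrite normrM mulrC ler_wpM2r// gM.
Qed.

End integrable_tools.

Section fubini.
Context d1 d2 (T1 : measurableType d1) (T2 : measurableType d2) (R : realType).
Variables (m1 : {sigma_finite_measure set T1 -> \bar R})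
  (m2 : {sigma_finite_measure set T2 -> \bar R}).
Variables (A : set T1) (B : set T2) (mA : measurable A) (mB : measurable B).
Variables (g : T1 -> R) (k : T2 -> R) (b : T1 * T2 -> R) (M : R).
Hypotheses (ig : m1.-integrable A (EFin \o g)) (ik : m2.-integrable B (EFin \o k)).
Hypotheses (mb : measurable_fun setT b) (bM : forall z, `|b z| <= M).

Let mbx x : measurable_fun setT (fun y => b (x, y)).
Proof. by apply: measurableT_comp => //; exact: measurable_pair1. Qed.
Let mby y : measurable_fun setT (fun x => b (x, y)).
Proof. by apply: measurableT_comp => //; exact: measurable_pair2. Qed.

(** Exchange of integrals for a product of integrable factors coupled through a bounded
kernel: the shape in which sines and cosines enter below. *)
Lemma fubini_kernel :
  \int[m1]_(x in A) (g x * \int[m2]_(y in B) (k y * b (x, y))) =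
  \int[m2]_(y in B) (k y * \int[m1]_(x in A) (g x * b (x, y))).
Proof.
pose F (z : T1 * T2) : R := (g \_ A) z.1 * (k \_ B) z.2 * b z.
have igT : m1.-integrable setT (EFin \o (g \_ A)).
  by rewrite -restrict_EFin; apply/(integrable_mkcond _ mA).
have ikT : m2.-integrable setT (EFin \o (k \_ B)).
  by rewrite -restrict_EFin; apply/(integrable_mkcond _ mB).
have mg : measurable_fun setT (g \_ A).
  by case/integrableP : igT => /measurable_EFinP.
have mk : measurable_fun setT (k \_ B).
  by case/integrableP : ikT => /measurable_EFinP.
have mF : measurable_fun setT (EFin \o F).
  apply/measurable_EFinP; apply: measurable_funM => //.
  by apply: measurable_funM; apply: measurableT_comp.
have iF : (m1 \x m2)%E.-integrable setT (EFin \o F).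
  apply/integrable12ltyP => //.
  pose c := \int[m2]_y `|(k \_ B) y|.
  have iH : m1.-integrable setT (fun x => ((M * c)%:E * `|(g \_ A) x|%:E)%E).
    exact: (integrableZl measurableT _ (integrable_norm igT)).
  have M0 : 0 <= M by rewrite (le_trans _ (bM point)).
  have c0 : 0 <= c by exact: Rintegral_ge0.
  apply: le_lt_trans (integrable_lty measurableT iH).
  apply: ge0_le_integral => //=.
  - by move=> x _; apply: integral_ge0.
  - apply: (@measurable_fun_fubini_tonelli_F _ _ _ _ _ m2
      (fun z => `|(EFin \o F) z|%E)) => //.
    exact: measurableT_comp.
  - apply: emeasurable_funM => //; apply/measurable_EFinP; exact: measurableT_comp.
  - move=> x _.
    have cE : (c%:E = \int[m2]_y `|(k \_ B) y|%:E)%E.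
      by rewrite /c /Rintegral fineK//; exact/integrable_fin_num/integrable_norm.
    rewrite (_ : ((M * c)%:E * _ =
        \int[m2]_y (`|(k \_ B) y|%:E * (M * `|(g \_ A) x|)%:E))%E); last first.
      rewrite ge0_integralZr//; last 2 first.
      - by apply/measurable_EFinP; exact: measurableT_comp.
      - by rewrite lee_fin mulr_ge0.
      by rewrite -cE -!EFinM; congr EFin; ring.
    apply: ge0_le_integral => //=.
    + apply/measurable_EFinP; apply: measurableT_comp => //.
      apply: (measurable_funM (f := fun y => (g \_ A) x * (k \_ B) y)); last exact: mbx.
      exact: measurable_funM.
    + apply: emeasurable_funM => //.
      by apply/measurable_EFinP; exact: measurableT_comp.
    + move=> y _; rewrite -!EFinM lee_fin /F/= !normrM.
      by rewrite [leRHS]mulrC -[leRHS]mulrA [leRHS]mulrC ler_wpM2l ?mulr_ge0.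
have Fub := Fubini iF.
have step1 : \int[m1]_(x in A) (g x * \int[m2]_(y in B) (k y * b (x, y))) =
    fine (\int[m1]_x \int[m2]_y (EFin \o F) (x, y))%E.
  rewrite {1}/Rintegral integral_mkcond; congr fine; apply: eq_integral => x _.
  rewrite /F/= patchE.
  have ikb : m2.-integrable setT (EFin \o (fun y => (k \_ B) y * b (x, y))).
    by apply: (@integrableM_bounded _ _ _ _ _ _ _ M).
  rewrite (_ : \int[m2]_(y in B) (k y * b (x, y)) =
      \int[m2]_y ((k \_ B) y * b (x, y))); last first.
    rewrite Rintegral_mkcond; apply: eq_Rintegral => y _.
    by rewrite !patchE; case: ifP => //; rewrite mul0r.
  under [RHS]eq_integral do rewrite -mulrA EFinM.
  rewrite integralZl// patchE; case: ifP => xA; last by rewrite mul0e.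
  by rewrite EFinM /Rintegral fineK//; exact: integrable_fin_num.
have step2 : \int[m2]_(y in B) (k y * \int[m1]_(x in A) (g x * b (x, y))) =
    fine (\int[m2]_y \int[m1]_x (EFin \o F) (x, y))%E.
  rewrite {1}/Rintegral integral_mkcond; congr fine; apply: eq_integral => y _.
  rewrite /F/= patchE.
  have igb : m1.-integrable setT (EFin \o (fun x => (g \_ A) x * b (x, y))).
    by apply: (@integrableM_bounded _ _ _ _ _ _ _ M).
  rewrite (_ : \int[m1]_(x in A) (g x * b (x, y)) =
      \int[m1]_x ((g \_ A) x * b (x, y))); last first.
    rewrite Rintegral_mkcond; apply: eq_Rintegral => x _.
    by rewrite !patchE; case: ifP => //; rewrite mul0r.
  under [RHS]eq_integral do rewrite mulrAC [_ * b _ * _]mulrC EFinM.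
  rewrite integralZl// patchE; case: ifP => yB; last by rewrite mul0e.
  by rewrite EFinM /Rintegral fineK//; exact: integrable_fin_num.
by rewrite step1 step2 Fub.
Qed.

(** Adding M |k| makes the integrand nonnegative, so that measurability of the inner
integral comes from the theorem of Tonelli. *)
Lemma measurable_kernel_integral :
  measurable_fun setT (fun x => \int[m2]_(y in B) (k y * b (x, y))).
Proof.
have M0 : 0 <= M by rewrite (le_trans _ (bM point)).
have mk : measurable_fun setT (k \_ B).
  apply/(measurable_restrictT _ _).1 => //.
  by case/integrableP : ik => /measurable_EFinP.
have ikT : m2.-integrable setT (EFin \o (k \_ B)).
  by rewrite -restrict_EFin; apply/(integrable_mkcond _ mB).
pose G (z : T1 * T2) : \bar R := ((k \_ B) z.2 * b z + M * `|(k \_ B) z.2|)%:E.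
have G0 z : (0 <= G z)%E.
  rewrite lee_fin -lerBlDl sub0r.
  have := ler_norm (- ((k \_ B) z.2 * b z)); rewrite normrN => /le_trans; apply.
  by rewrite normrM mulrC ler_wpM2r.
have mG : measurable_fun setT G.
  apply/measurable_EFinP; apply: measurable_funD.
    by apply: measurable_funM => //; apply: measurableT_comp.
  by apply: measurable_funM => //; do 2 apply: measurableT_comp => //.
have := @measurable_fun_fubini_tonelli_F _ _ _ _ _ m2 G mG G0.
pose c := \int[m2]_y `|(k \_ B) y|.
rewrite (_ : fubini_F m2 G =
  EFin \o (fun x => \int[m2]_(y in B) (k y * b (x, y)) + M * c)); last first.
  apply/funext => x; rewrite /fubini_F /G/=.
  have ikb : m2.-integrable setT (EFin \o (fun y => (k \_ B) y * b (x, y))).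
    by apply: (@integrableM_bounded _ _ _ _ _ _ _ M).
  have ikn : m2.-integrable setT (EFin \o (fun y => M * `|(k \_ B) y|)).
    exact: (integrableZl measurableT _ (integrable_norm ikT)).
  rewrite (integralD_EFin measurableT ikb ikn) EFinD; congr (_ + _)%E.
    rewrite Rintegral_mkcond /Rintegral.
    rewrite -(fineK (integrable_fin_num measurableT ikb)); congr EFin; congr fine.
    by apply: eq_integral => y _; rewrite /= !patchE; case: ifP; rewrite ?mul0r.
  rewrite /c -RintegralZl//; last exact: (integrable_norm ikT).
  by rewrite /Rintegral fineK//; exact: (integrable_fin_num measurableT ikn).
move=> /measurable_EFinP mH.
have -> : (fun x => \int[m2]_(y in B) (k y * b (x, y))) =
    (fun x => \int[m2]_(y in B) (k y * b (x, y)) + M * c) \- cst (M * c).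
  by apply/funext => x; rewrite /= addrK.
exact: measurable_funB.
Qed.

End fubini.

Section dct.
Context d (T : measurableType d) (R : realType) (m : {measure set T -> \bar R}).
Variables (D : set T) (mD : measurable D) (f_ : nat -> T -> R) (f g : T -> R).
Hypotheses (mf_ : forall n, measurable_fun D (f_ n)).
Hypothesis f_f : forall x, D x -> f_ n x @[n --> \oo] --> f x.
Hypothesis ig : m.-integrable D (EFin \o g).
Hypothesis fg : forall n x, D x -> `|f_ n x| <= g x.

Let f_fE x : D x -> ((f_ n x)%:E @[n --> \oo] --> (f x)%:E).
Proof. by move=> Dx; apply: cvg_EFin; [exact: nearW|exact: f_f]. Qed.

Let mfE_ n : measurable_fun D (EFin \o f_ n).
Proof. exact/measurable_EFinP. Qed.

Lemma dominated_limit_measurable : measurable_fun D f.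
Proof.
apply/measurable_EFinP.
by apply: (emeasurable_fun_cvg (fun n => EFin \o f_ n)) => // x Dx; exact: f_fE.
Qed.

Lemma dominated_limit_integrable : m.-integrable D (EFin \o f).
Proof.
apply: (le_integrable_fin mD dominated_limit_measurable ig) => x Dx.
have h : `|f_ n x| @[n --> \oo] --> `|f x| by apply: cvg_norm; exact: f_f.
rewrite -(cvg_lim _ h)//; apply: limr_le; first by apply/cvg_ex; exists `|f x|.
by apply: nearW => n; exact: fg.
Qed.

Lemma cvg_Rintegral :
  \int[m]_(x in D) f_ n x @[n --> \oo] --> \int[m]_(x in D) f x.
Proof.
apply: fine_cvg; rewrite /Rintegral fineK; last first.
  exact: (integrable_fin_num mD dominated_limit_integrable).
by apply: (dominated_cvg mD mfE_ f_fE _ ig).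
Qed.

End dct.

Section ftc.
Context {R : realType}.
Notation mu := (@lebesgue_measure R).
Notation Rp := (`]0%R, +oo[%classic : set R).

(** The fundamental theorem on the open half-line, with limits at both ends: exhaust by
the intervals [1/(n+1), n+2]. *)
Lemma Rintegral_FTC_Rp (f F : R -> R) (l0 l1 : R) :
  mu.-integrable Rp (EFin \o f) ->
  (forall x : R, 0 < x -> {for x, continuous f}) ->
  (forall x : R, 0 < x -> is_derive x 1 F (f x)) ->
  F x @[x --> 0^'+] --> l0 -> F x @[x --> +oo] --> l1 ->
  \int[mu]_(x in Rp) f x = l1 - l0.
Proof.
move=> fi cf dF F0 F1.
have mf : measurable_fun Rp f.
  by case/integrableP : fi => /measurable_EFinP.
pose a n : R := n.+1%:R^-1; pose b n : R := n.+2%:R.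
have a0 n : 0 < a n by rewrite invr_gt0.
have ab n : a n < b n.
  rewrite (@le_lt_trans _ _ 1)//; first by rewrite invf_le1// ler1n.
  by rewrite ltr1n.
have step n : \int[mu]_(x in Rp) (f x * \1_(`[a n, b n]%classic) x) =
    F (b n) - F (a n).
  have fe : (\int[mu]_(x in `[a n, b n]) (f x)%:E = (F (b n))%:E - (F (a n))%:E)%E.
    apply: continuous_FTC2 => //.
    - apply: continuous_in_subspaceT => x; rewrite inE/= in_itv/= => /andP[ax _].
      by apply: cf; exact: lt_le_trans (a0 n) ax.
    - have dd x : a n <= x -> derivable F x 1.
        by move=> ax; apply: (@ex_derive _ _ _ _ _ _ _ (dF x _)); exact: lt_le_trans (a0 n) ax.
      split.
      + by move=> x; rewrite in_itv/= => /andP[ax _]; apply: dd; exact: ltW.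
      + apply: cvg_at_right_filter; apply: differentiable_continuous.
        by apply/derivable1_diffP/dd.
      + apply: cvg_at_left_filter; apply: differentiable_continuous.
        by apply/derivable1_diffP/dd/ltW.
    - move=> x; rewrite in_itv/= => /andP[ax _].
      rewrite derive1E; apply: derive_val.
      by apply: dF; exact: lt_trans (a0 n) ax.
  rewrite /Rintegral -EFinB in fe *.
  rewrite -[RHS]/(fine (F (b n) - F (a n))%:E) -fe; congr fine.
  rewrite integral_mkcond [RHS]integral_mkcond; apply: eq_integral => x _.
  rewrite !patchE indicE; case: (boolP (x \in `[a n, b n]%classic)) => [xi|xi].
    rewrite mulr1 ifT//; move: xi; rewrite !inE/= !in_itv/= => /andP[ax _].
    by rewrite (lt_le_trans (a0 n) ax).
  by rewrite mulr0; case: ifP.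
have lim1 : F (b n) - F (a n) @[n --> \oo] --> l1 - l0.
  apply: cvgB.
    apply: (cvg_comp b F _ F1).
    by have := cvgr_idn (R := R); rewrite -(cvg_shiftn 2); under eq_fun do rewrite addn2.
  move/cvg_at_rightP : F0; apply; split=> //.
  exact: cvg_harmonic.
have lim2 : F (b n) - F (a n) @[n --> \oo] --> \int[mu]_(x in Rp) f x.
  under eq_fun do rewrite -step.
  apply: (@cvg_Rintegral _ _ _ mu Rp _
    (fun n x => f x * \1_(`[a n, b n]%classic) x) f (fun x => `|f x|)) => //.
  - by move=> n; apply: measurable_funM => //; exact: measurable_indic.
  - move=> x; rewrite /= in_itv/= andbT => x0.
    apply: cvg_near_cst; near=> n.
    rewrite indicE mem_set ?mulr1//= in_itv/=; apply/andP; split.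
      near: n; move/cvgrPdist_le : (@cvg_harmonic R) => /(_ _ x0).
      by apply: filterS => n; rewrite sub0r normrN ger0_norm// invr_ge0.
    rewrite (@le_trans _ _ n%:R)//; last by rewrite ler_nat ltnW// ltnW.
    by near: n; exact: nbhs_infty_ger.
  - exact: integrable_norm fi.
  - move=> n x _; rewrite normrM -[leRHS]mulr1 ler_wpM2l// indicE.
    by case: (_ \in _); rewrite ?normr1 ?normr0.
exact: (cvg_unique _ lim2 lim1).
Unshelve. all: by end_near.
Qed.

End ftc.

Section derive_tools.
Context {R : realType}.
Implicit Types (f g : R -> R) (x a b : R).

Lemma is_derive_eqr f x a b : is_derive x 1 f a -> a = b -> is_derive x 1 f b.
Proof. by move=> + <-. Qed.

Lemma is_derive1M f g x a b : is_derive x 1 f a -> is_derive x 1 g b ->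
  is_derive x 1 (fun y => f y * g y) (a * g x + f x * b).
Proof.
move=> fa gb; apply: is_derive_eqr (is_deriveM fa gb) _.
by rewrite /GRing.scale/= addrC [g x * a]mulrC.
Qed.

Lemma is_derive1D f g x a b : is_derive x 1 f a -> is_derive x 1 g b ->
  is_derive x 1 (fun y => f y + g y) (a + b).
Proof. by move=> fa gb; exact: (is_deriveD fa gb). Qed.

Lemma is_derive1N f x a : is_derive x 1 f a -> is_derive x 1 (fun y => - f y) (- a).
Proof. by move=> fa; exact: (is_deriveN fa). Qed.

Lemma is_derive1B f g x a b : is_derive x 1 f a -> is_derive x 1 g b ->
  is_derive x 1 (fun y => f y - g y) (a - b).
Proof. by move=> fa gb; exact: (is_deriveB fa gb). Qed.

Lemma is_derive1C c x : is_derive x 1 (fun=> c : R) 0.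
Proof. exact: is_derive_cst. Qed.

Lemma is_derive1I x : is_derive x 1 (fun y : R => y) 1.
Proof. exact: is_derive_id. Qed.

Lemma is_derive1Ml f c x a : is_derive x 1 f a -> is_derive x 1 (fun y => c * f y) (c * a).
Proof.
move=> fa; apply: is_derive_eqr (is_derive1M (is_derive1C c x) fa) _.
by rewrite mul0r add0r.
Qed.

Lemma is_derive1O f g x a b : is_derive (g x) 1 f a -> is_derive x 1 g b ->
  is_derive x 1 (fun y => f (g y)) (a * b).
Proof. exact: is_derive1_comp. Qed.

Lemma is_derive_continuous f x a : is_derive x 1 f a -> {for x, continuous f}.
Proof.
by move=> h; apply: differentiable_continuous; apply/derivable1_diffP; exact: ex_derive.
Qed.

End derive_tools.

Section Rp_integrability.
Context {R : realType}.
Notation mu := (@lebesgue_measure R).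
Notation Rp := (`]0%R, +oo[%classic : set R).

Lemma measurable_Rp : measurable (Rp : set (measurableTypeR R)).
Proof. exact: measurable_itv. Qed.

Lemma measurable_fun_Rp (f : R -> R) :
  (forall x : R, 0 < x -> {for x, continuous f}) -> measurable_fun Rp f.
Proof.
move=> cf; apply: open_continuous_measurable_fun; first exact: interval_open.
by move=> x; rewrite inE/= in_itv/= andbT; exact: cf.
Qed.

(** A nonnegative function with a bounded primitive is integrable; this starts the
theory of the powers below without any prior knowledge of an integral. *)
Lemma integrable_FTC_Rp (f F : R -> R) (C : R) :
  (forall x : R, 0 < x -> 0 <= f x) ->
  (forall x : R, 0 < x -> {for x, continuous f}) ->
  (forall x : R, 0 < x -> is_derive x 1 F (f x)) ->
  (forall x : R, 0 < x -> `|F x| <= C) ->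
  mu.-integrable Rp (EFin \o f).
Proof.
move=> f0 cf dF FC.
have mf := measurable_fun_Rp cf.
pose a n : R := n.+1%:R^-1; pose b n : R := n.+2%:R.
have a0 n : 0 < a n by rewrite invr_gt0.
have ab n : a n < b n.
  rewrite (@le_lt_trans _ _ 1)//; first by rewrite invf_le1// ler1n.
  by rewrite ltr1n.
have step n : (\int[mu]_(x in `[a n, b n]) (f x)%:E = (F (b n))%:E - (F (a n))%:E)%E.
  apply: continuous_FTC2 => //.
  - apply: continuous_in_subspaceT => x; rewrite inE/= in_itv/= => /andP[ax _].
    by apply: cf; exact: lt_le_trans (a0 n) ax.
  - have cc x : a n <= x -> {for x, continuous F}.
      by move=> ax; apply: is_derive_continuous (dF x _); exact: lt_le_trans (a0 n) ax.
    split.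
    + move=> x; rewrite in_itv/= => /andP[ax _].
      by apply: (@ex_derive _ _ _ _ _ _ _ (dF x _)); exact: lt_trans (a0 n) ax.
    + by apply: cvg_at_right_filter; exact: cc.
    + by apply: cvg_at_left_filter; apply: cc; exact: ltW.
  - move=> x; rewrite in_itv/= => /andP[ax _].
    rewrite derive1E; apply: derive_val.
    by apply: dF; exact: lt_trans (a0 n) ax.
have sub n x : `[a n, b n]%classic x -> 0 < x.
  by rewrite /= in_itv/= => /andP[ax _]; exact: lt_le_trans (a0 n) ax.
have RpE : Rp = \bigcup_n `[a n, b n]%classic.
  apply/seteqP; split => [x|x [n _ /sub]]; rewrite /= in_itv/= andbT// => x0.
  near \oo => n; exists n => //=; rewrite in_itv/=; apply/andP; split.
    near: n; move/cvgrPdist_le : (@cvg_harmonic R) => /(_ _ x0).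
    by apply: filterS => n; rewrite sub0r normrN ger0_norm// invr_ge0.
  rewrite (@le_trans _ _ n%:R)//; last by rewrite ler_nat ltnW// ltnW.
  by near: n; exact: nbhs_infty_ger.
apply/integrableP; split; first exact/measurable_EFinP.
have -> : (\int[mu]_(x in Rp) `|(EFin \o f) x| = \int[mu]_(x in Rp) (f x)%:E)%E.
  apply: eq_integral => x; rewrite inE/= in_itv/= andbT => x0.
  by rewrite ger0_norm// f0.
have H : (\int[mu]_(x in `[a n, b n]) (f x)%:E @[n --> \oo] -->
    \int[mu]_(x in Rp) (f x)%:E)%E.
  rewrite RpE; apply: ge0_nondecreasing_set_cvg_integral => //.
  - apply/nondecreasing_seqP => n; apply/subsetPset => x; rewrite /= !in_itv/=.
    move=> /andP[ax xb]; apply/andP; split.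
      by apply: le_trans ax; rewrite lef_pV2 ?posrE// ler_nat.
    by apply: (le_trans xb); rewrite ler_nat.
  - move=> n; apply/measurable_EFinP; apply: measurable_funS mf => //.
    by move=> x /sub; rewrite /= in_itv/= andbT.
  - by move=> n x /sub x0; rewrite lee_fin f0.
apply: (@le_lt_trans _ _ (C + C)%:E); last exact: ltry.
rewrite -(cvg_lim _ H)//.
apply: lime_le; first by apply/cvg_ex; eexists; exact: H.
apply: nearW => n; rewrite step -EFinB lee_fin lerD//.
  by rewrite (le_trans (ler_norm _))// FC// (lt_trans (a0 n) (ab n)).
by rewrite (le_trans (ler_norm _))// normrN FC.
Unshelve. all: by end_near.
Qed.

Lemma powR_expR_le (p : R) : 0 <= p ->
  exists2 M : R, 0 < M & forall z : R, 0 <= z -> z `^ p * expR (- z) <= M.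
Proof.
move=> p0; pose k := (Num.truncn p).+1.
have pk : p <= k%:R by rewrite ltW// truncnS_gt.
exists (1 + k`!%:R); first by rewrite addr_gt0// ltr0n fact_gt0.
move=> z z0; have [z1|z1] := leP z 1.
  rewrite (@le_trans _ _ 1)//; last by rewrite lerDl.
  rewrite -[leRHS]mulr1 ler_pM ?powR_ge0 ?expR_ge0//; last by rewrite expR_le1 oppr_le0.
  by have := ge0_ler_powR p0 (z0 : z \in Num.nneg) ler01 z1; rewrite powR1.
rewrite expRN ler_pdivrMr ?expR_gt0//.
rewrite (@le_trans _ _ (z ^+ k))//.
  by rewrite -powR_mulrn// ler_powR// ltW.
have := @expR_ge1Dxn _ z (Num.truncn p) z0; rewrite -/k => h.
rewrite (@le_trans _ _ (k`!%:R * expR z))//; last first.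
  by rewrite ler_wpM2r ?expR_ge0// lerDr.
rewrite mulrC -ler_pdivrMr ?ltr0n ?fact_gt0//.
by apply: le_trans h; rewrite lerDr.
Qed.

(** The weight z^(q-1) (1+z)^(-q-1) has the bounded primitive (z / (1+z))^q / q. *)
Lemma integrable_Rp_head (q : R) : 0 < q ->
  mu.-integrable Rp (EFin \o (fun z => z `^ (q - 1) * (1 + z) `^ (- q - 1))).
Proof.
move=> q0.
have d1 (x : R) : 0 < x -> is_derive x 1 (fun z : R => 1 + z) 1.
  move=> x0; apply: is_derive_eqr (is_derive1D (is_derive1C 1 x) (is_derive1I x)) _.
  by rewrite add0r.
have dp (x p : R) : 0 < x -> is_derive x 1 (fun z : R => (1 + z) `^ p) (p * (1 + x) `^ (p - 1)).
  move=> x0; have x1 : 0 < 1 + x by rewrite addr_gt0.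
  apply: is_derive_eqr (is_derive1O (is_derive1_powR p x1) (d1 x x0)) _.
  by rewrite mulr1.
apply: (@integrable_FTC_Rp (fun z => z `^ (q - 1) * (1 + z) `^ (- q - 1))
  (fun z => q^-1 * (z `^ q * (1 + z) `^ (- q))) q^-1).
- by move=> x x0; rewrite mulr_ge0 ?powR_ge0.
- move=> x x0; apply: (is_derive_continuous (is_derive1M (is_derive1_powR _ x0) (dp x _ x0))).
- move=> x x0.
  apply: is_derive_eqr (is_derive1Ml q^-1
    (is_derive1M (is_derive1_powR q x0) (dp x (- q) x0))) _.
  have x1 : 0 < 1 + x by rewrite addr_gt0.
  have E1 : x `^ q = x * x `^ (q - 1) by rewrite mulr_powRB1// ltW.
  have E2 : (1 + x) `^ (- q) = (1 + x) * (1 + x) `^ (- q - 1).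
    rewrite -[X in _ = X * _]powRr1 ?ltW// -powRD; first by congr powR; ring.
    by rewrite (gt_eqF x1) implybT.
  by rewrite E1 E2; field; rewrite gt_eqF.
- move=> x x0; have x1 : 0 < 1 + x by rewrite addr_gt0.
  have q'0 : 0 <= q^-1 by rewrite invr_ge0 ltW.
  rewrite ger0_norm ?mulr_ge0 ?powR_ge0//.
  rewrite -[leRHS]mulr1 ler_pM2l ?invr_gt0// powRN ler_pdivrMr ?powR_gt0// mul1r.
  by apply: ge0_ler_powR; rewrite ?nnegrE; lra.
Qed.

Lemma integrable_Rp_tail (r : R) : 0 < r ->
  mu.-integrable Rp (EFin \o (fun z => (1 + z) `^ (- 1 - r))).
Proof.
move=> r0.
have dp (x p : R) : 0 < x -> is_derive x 1 (fun z : R => (1 + z) `^ p) (p * (1 + x) `^ (p - 1)).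
  move=> x0; have x1 : 0 < 1 + x by rewrite addr_gt0.
  apply: is_derive_eqr (is_derive1O (is_derive1_powR p x1)
    (is_derive1D (is_derive1C 1 x) (is_derive1I x))) _.
  by rewrite add0r mulr1.
apply: (@integrable_FTC_Rp (fun z => (1 + z) `^ (- 1 - r))
  (fun z => - r^-1 * (1 + z) `^ (- r)) r^-1).
- by move=> x x0; rewrite powR_ge0.
- by move=> x x0; exact: (is_derive_continuous (dp x _ x0)).
- move=> x x0; apply: is_derive_eqr (is_derive1Ml _ (dp x (- r) x0)) _.
  rewrite mulrA mulNr mulrN opprK mulVf ?gt_eqF// mul1r.
  by congr powR; rewrite addrC.
- move=> x x0; have r'0 : 0 <= r^-1 by rewrite invr_ge0 ltW.
  rewrite normrM normrN (ger0_norm r'0) ger0_norm ?powR_ge0//.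
  rewrite -[leRHS]mulr1 ler_pM2l ?invr_gt0// powRN invf_le1 ?powR_gt0 ?addr_gt0//.
  have := @ge0_ler_powR R r (ltW r0) 1 (1 + x).
  by rewrite powR1 !nnegrE; apply=> //; lra.
Qed.

(** The integrability test used throughout: powers at the two ends of the half-line. *)
Lemma integrable_Rp_powR (q r M : R) (f : R -> R) : 0 < q -> 0 < r ->
  measurable_fun Rp f ->
  (forall z, 0 < z <= 1 -> `|f z| <= M * z `^ (q - 1)) ->
  (forall z, 1 <= z -> `|f z| <= M * z `^ (- 1 - r)) ->
  mu.-integrable Rp (EFin \o f).
Proof.
move=> q0 r0 mf f0 f1.
have M0 : 0 <= M.
  by have := f1 1 (lexx _); rewrite powR1 mulr1; exact: le_trans.
pose c := M * (2 `^ (q + 1) + 2 `^ (1 + r)).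
have c0 : 0 <= c by rewrite mulr_ge0// addr_ge0 ?powR_ge0.
apply: (@le_integrable_fin _ _ R mu Rp f
  (fun z => c * (z `^ (q - 1) * (1 + z) `^ (- q - 1) + (1 + z) `^ (- 1 - r)))) => //.
  have := integrableZl measurable_Rp c
    (integrableD measurable_Rp (integrable_Rp_head q0) (integrable_Rp_tail r0)).
  exact: eq_integrable.
move=> z; rewrite /= in_itv/= andbT => z0.
have z1 : 0 < 1 + z by rewrite addr_gt0.
have [zl|zg] := leP z 1.
  apply: (le_trans (f0 z _)); first by rewrite z0.
  rewrite -mulrA ler_wpM2l//.
  rewrite (@le_trans _ _ (2 `^ (q + 1) * (z `^ (q - 1) * (1 + z) `^ (- q - 1))))//.
    rewrite mulrCA -[leLHS]mulr1 ler_wpM2l ?powR_ge0//.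
    rewrite -opprD powRN ler_pdivlMr ?powR_gt0// mul1r.
    by apply: ge0_ler_powR; rewrite ?nnegrE; lra.
  rewrite ler_pM ?powR_ge0 ?mulr_ge0 ?powR_ge0//; first by rewrite lerDl powR_ge0.
  by rewrite lerDl powR_ge0.
apply: (le_trans (f1 z _)); first exact: ltW.
rewrite -mulrA ler_wpM2l//.
rewrite (@le_trans _ _ (2 `^ (1 + r) * ((1 + z) `^ (- 1 - r))))//.
  rewrite -!opprD !powRN ler_pdivlMr ?powR_gt0// mulrC ler_pdivrMr ?powR_gt0//.
  by rewrite -powRM; [apply: ge0_ler_powR; rewrite ?nnegrE; lra|lra|lra].
rewrite ler_pM ?powR_ge0 ?addr_ge0 ?mulr_ge0 ?powR_ge0//; first by rewrite lerDr powR_ge0.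
by rewrite lerDr mulr_ge0 ?powR_ge0.
Qed.

End Rp_integrability.

Section limits.
Context {R : realType}.

Lemma cvg_head_powR (p M : R) (f : R -> R) : 0 < p ->
  (forall z, 0 < z <= 1 -> `|f z| <= M * z `^ p) -> f z @[z --> 0^'+] --> 0.
Proof.
move=> p0 fM.
apply: (@squeeze_cvgr _ _ _ _ (fun z => - (M * z `^ p)) (fun z => M * z `^ p)).
- near=> z; rewrite -ler_norml; apply: fM; apply/andP; split.
    by near: z; exact: nbhs_right_gt.
  by near: z; apply: nbhs_right_le.
- rewrite -[X in _ --> X]oppr0 -[X in _ --> - X](mulr0 M); apply: cvgN.
  by apply: cvgMl_tmp; exact: powR_cvg0.
- rewrite -[X in _ --> X](mulr0 M).
  by apply: cvgMl_tmp; exact: powR_cvg0.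
Unshelve. all: by end_near.
Qed.

Lemma cvg_tail_powR (p M : R) (f : R -> R) : 0 < p ->
  (forall z, 1 <= z -> `|f z| <= M * z `^ (- p)) -> f z @[z --> +oo] --> 0.
Proof.
move=> p0 fM.
apply/cvgrPdist_le => e e0; near=> z.
have z1 : 1 <= z by near: z; apply: nbhs_pinfty_ge; rewrite num_real.
have z0 : 0 < z by exact: lt_le_trans z1.
rewrite sub0r normrN (le_trans (fM _ z1))// powRN ler_pdivrMr ?powR_gt0//.
have zM : (`|M| / e) `^ p^-1 <= z by near: z; apply: nbhs_pinfty_ge; rewrite num_real.
rewrite mulrC -ler_pdivrMr//.
have Me : 0 <= `|M| / e by rewrite divr_ge0// ltW.
rewrite (@le_trans _ _ (`|M| / e))//; first by rewrite ler_pM2r ?invr_gt0// ler_norm.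
have := @ge0_ler_powR R p (ltW p0) ((`|M| / e) `^ p^-1) z.
rewrite -powRrM mulVf ?gt_eqF// powRr1// !nnegrE; apply => //.
by rewrite powR_ge0.
Unshelve. all: by end_near.
Qed.

End limits.

Section under_integral.
Context d (T : measurableType d) (R : realType) (m : {measure set T -> \bar R}).

(** Differentiation under the integral sign, with the derivative of the integrand
dominated on a neighbourhood of the point. *)
Lemma is_derive_Rintegral (D : set T) (f df : R -> T -> R) (G : T -> R) (u v a : R) :
  measurable D -> u < a < v ->
  (forall x, u < x < v -> m.-integrable D (EFin \o f x)) ->
  (forall x y, u < x < v -> D y -> is_derive x 1 (f ^~ y) (df x y)) ->
  m.-integrable D (EFin \o G) ->
  (forall x y, u < x < v -> D y -> `|df x y| <= G y) ->
  is_derive a 1 (fun x => \int[m]_(y in D) f x y) (\int[m]_(y in D) df a y).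
Proof.
move=> mD Ia fi dfE iG dfG.
have Ia' : `]u, v[%classic a by rewrite /= in_itv.
have fi' x : `]u, v[%classic x -> m.-integrable D (EFin \o f x).
  by rewrite /= in_itv; exact: fi.
have der x y : `]u, v[%classic x -> D y -> derivable (f ^~ y) x 1.
  by rewrite /= in_itv/= => xI Dy; exact: (@ex_derive _ _ _ _ _ _ _ (dfE x y xI Dy)).
have dE x y : `]u, v[%classic x -> D y -> partial1of2 f x y = df x y.
  rewrite /= in_itv/= => xI Dy; rewrite partial1of2E.
  exact: (@derive_val _ _ _ _ _ _ _ (dfE x y xI Dy)).
have iG' := integrable_norm iG.
have GE x y : `]u, v[%classic x -> D y -> `|partial1of2 f x y| <= `|G y|.
  move=> xI Dy; rewrite dE//; move: xI; rewrite /= in_itv/= => xI.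
  by rewrite (le_trans (dfG _ _ xI Dy))// ler_norm.
have H1 := @derivable_under_integral R d T m f D mD a u v Ia' fi' der
  (fun y => `|G y|) (fun y => normr_ge0 _) iG' GE.
have H2 := @differentiation_under_integral R d T m f D mD a u v Ia' fi' der
  (fun y => `|G y|) (fun y => normr_ge0 _) iG' GE.
apply: DeriveDef => //; rewrite -derive1E H2.
by apply: eq_Rintegral => y; rewrite inE => Dy; exact: dE.
Qed.

End under_integral.

(** * Gamma integrals with a trigonometric factor *)

Section gamma_trig.
Context {R : realType}.
Notation mu := (@lebesgue_measure R).
Notation Rp := (`]0%R, +oo[%classic : set R).

Lemma integrable_gamma (s : R) : 0 < s ->
  mu.-integrable Rp (EFin \o (fun z => z `^ (s - 1) * expR (- z))).
Proof.
move=> s0; have [|M M0 MP] := @powR_expR_le R (s + 1); first by rewrite addr_ge0// ltW.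
apply: (@integrable_Rp_powR R s 1 (M + 1)) => //.
- by apply: measurable_funTS; apply: measurable_funM => //; apply: measurableT_comp.
- move=> z /andP[z0 z1]; rewrite ger0_norm ?mulr_ge0 ?powR_ge0 ?expR_ge0//.
  rewrite mulrC ler_wpM2r ?powR_ge0//.
  by rewrite (@le_trans _ _ 1) ?lerDr ?(ltW M0)// expR_le1 oppr_le0 ltW.
- move=> z z1; have z0 : 0 < z by exact: lt_le_trans z1.
  rewrite ger0_norm ?mulr_ge0 ?powR_ge0 ?expR_ge0//.
  have -> : z `^ (s - 1) = z `^ (s + 1) * z `^ (- 1 - 1).
    rewrite -powRD; first by congr powR; ring.
    by rewrite (gt_eqF z0) implybT.
  rewrite mulrAC ler_wpM2r ?powR_ge0// (le_trans (MP _ (ltW z0)))//.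
  by rewrite lerDl.
Qed.

Lemma integrable_gammaM (s : R) (h : R -> R) : 0 < s -> measurable_fun setT h ->
  (forall z, `|h z| <= 1) ->
  mu.-integrable Rp (EFin \o (fun z => z `^ (s - 1) * expR (- z) * h z)).
Proof.
move=> s0 mh h1.
by apply: (@integrableM_bounded _ _ R mu Rp _ _ 1 measurable_Rp (integrable_gamma s0)) => //; exact: measurable_funTS.
Qed.

Let C s b := \int[mu]_(z in Rp) (z `^ (s - 1) * expR (- z) * cos (b * z)).
Let S s b := \int[mu]_(z in Rp) (z `^ (s - 1) * expR (- z) * sin (b * z)).

Lemma measurable_cosM (b : R) : measurable_fun setT (fun z : R => cos (b * z)).
Proof.
apply: measurableT_comp; last exact: measurable_funM.
exact: continuous_measurable_fun (@continuous_cos R).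
Qed.

Lemma measurable_sinM (b : R) : measurable_fun setT (fun z : R => sin (b * z)).
Proof.
apply: measurableT_comp; last exact: measurable_funM.
exact: continuous_measurable_fun (@continuous_sin R).
Qed.

Lemma is_derive_cosM (b z : R) : is_derive z 1 (fun x : R => cos (b * x)) (- (b * sin (b * z))).
Proof.
apply: is_derive_eqr (is_derive1O (is_derive_cos _) (is_derive1Ml b (is_derive1I z))) _.
by rewrite mulr1 mulNr mulrC.
Qed.

Lemma is_derive_sinM (b z : R) : is_derive z 1 (fun x : R => sin (b * x)) (b * cos (b * z)).
Proof.
apply: is_derive_eqr (is_derive1O (is_derive_sin _) (is_derive1Ml b (is_derive1I z))) _.
by rewrite mulr1 mulrC.
Qed.

Lemma is_derive_expRN (z : R) : is_derive z 1 (fun x : R => expR (- x)) (- expR (- z)).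
Proof.
apply: is_derive_eqr (is_derive1O (is_derive_expR _) (is_derive1N (is_derive1I z))) _.
by rewrite mulrN mulr1.
Qed.

Let powRS (s z : R) : 0 < z -> z `^ (s + 1 - 1) = z * z `^ (s - 1).
Proof.
move=> z0; have -> : s + 1 - 1 = 1 + (s - 1) by ring.
rewrite [LHS]powRD; last by rewrite (gt_eqF z0) implybT.
by rewrite powRr1// ltW.
Qed.

Let cvg0 (s : R) (h : R -> R) : 0 < s -> (forall z, `|h z| <= 1) ->
  (z `^ s * expR (- z) * h z) @[z --> 0^'+] --> 0 /\
  (z `^ s * expR (- z) * h z) @[z --> +oo] --> 0.
Proof.
move=> s0 h1; split.
  apply: (@cvg_head_powR _ s 1) => // z /andP[z0 z1]; rewrite mul1r.
  rewrite !normrM (ger0_norm (powR_ge0 _ _)) (ger0_norm (expR_ge0 _)) -mulrA.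
  rewrite -[leRHS]mulr1 ler_wpM2l ?powR_ge0// -[leRHS]mulr1 ler_pM ?expR_ge0//.
  by rewrite expR_le1 oppr_le0 ltW.
have [|M M0 MP] := @powR_expR_le R (s + 1); first by rewrite addr_ge0// ltW.
apply: (@cvg_tail_powR _ 1 M) => // z z1; have z0 : 0 < z by exact: lt_le_trans z1.
rewrite !normrM (ger0_norm (powR_ge0 _ _)) (ger0_norm (expR_ge0 _)).
rewrite -[leRHS]mulr1 ler_pM ?mulr_ge0 ?powR_ge0 ?expR_ge0//.
rewrite powRN powRr1 ?(ltW z0)// ler_pdivlMr//.
apply: le_trans (MP _ (ltW z0)).
rewrite powRD; last by rewrite (gt_eqF z0) implybT.
by rewrite powRr1 ?(ltW z0)// mulrAC.
Qed.

Let ibpC (s b : R) : 0 < s -> s * C s b - C (s + 1) b - b * S (s + 1) b = 0.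
Proof.
move=> s0; have s10 : 0 < s + 1 by rewrite addr_gt0.
have iC := integrable_gammaM s0 (measurable_cosM b) (fun z => cos_max _).
have iC1 := integrable_gammaM s10 (measurable_cosM b) (fun z => cos_max _).
have iS1 := integrable_gammaM s10 (measurable_sinM b) (fun z => sin_max _).
have iC' := integrableZl measurable_Rp s iC.
have iS' := integrableZl measurable_Rp b iS1.
rewrite /C /S -!(RintegralZl _ measurable_Rp)// -!(RintegralB measurable_Rp)//; last first.
  exact: (integrableB measurable_Rp iC' iC1).
have [h0 h1] := cvg0 s0 (fun z => cos_max (b * z)).
apply: etrans (subrr 0); apply: (Rintegral_FTC_Rp _ _ _ h0 h1).
- exact: (integrableB measurable_Rp (integrableB measurable_Rp iC' iC1) iS').
- move=> x x0.
  have dz := is_derive1M (is_derive1_powR (s - 1) x0) (is_derive_expRN x).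
  have dz1 := is_derive1M (is_derive1_powR (s + 1 - 1) x0) (is_derive_expRN x).
  exact: (is_derive_continuous (is_derive1B (is_derive1B
    (is_derive1Ml s (is_derive1M dz (is_derive_cosM b x)))
    (is_derive1M dz1 (is_derive_cosM b x)))
    (is_derive1Ml b (is_derive1M dz1 (is_derive_sinM b x))))).
- move=> x x0; have dz := is_derive1M (is_derive1_powR s x0) (is_derive_expRN x).
  apply: is_derive_eqr (is_derive1M dz (is_derive_cosM b x)) _.
  by rewrite addrK; ring.
Qed.

Let ibpS (s b : R) : 0 < s -> s * S s b - S (s + 1) b + b * C (s + 1) b = 0.
Proof.
move=> s0; have s10 : 0 < s + 1 by rewrite addr_gt0.
have iS := integrable_gammaM s0 (measurable_sinM b) (fun z => sin_max _).
have iC1 := integrable_gammaM s10 (measurable_cosM b) (fun z => cos_max _).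
have iS1 := integrable_gammaM s10 (measurable_sinM b) (fun z => sin_max _).
have iS' := integrableZl measurable_Rp s iS.
have iC' := integrableZl measurable_Rp b iC1.
rewrite /C /S -!(RintegralZl _ measurable_Rp)// -!(RintegralB measurable_Rp)//.
rewrite -(RintegralD measurable_Rp)//; last exact: (integrableB measurable_Rp iS' iS1).
have [h0 h1] := cvg0 s0 (fun z => sin_max (b * z)).
apply: etrans (subrr 0); apply: (Rintegral_FTC_Rp _ _ _ h0 h1).
- exact: (integrableD measurable_Rp (integrableB measurable_Rp iS' iS1) iC').
- move=> x x0.
  have dz := is_derive1M (is_derive1_powR (s - 1) x0) (is_derive_expRN x).
  have dz1 := is_derive1M (is_derive1_powR (s + 1 - 1) x0) (is_derive_expRN x).
  exact: (is_derive_continuous (is_derive1D (is_derive1B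
    (is_derive1Ml s (is_derive1M dz (is_derive_sinM b x)))
    (is_derive1M dz1 (is_derive_sinM b x)))
    (is_derive1Ml b (is_derive1M dz1 (is_derive_cosM b x))))).
- move=> x x0; have dz := is_derive1M (is_derive1_powR s x0) (is_derive_expRN x).
  apply: is_derive_eqr (is_derive1M dz (is_derive_sinM b x)) _.
  by rewrite addrK; ring.
Qed.

Let dC (s b : R) : 0 < s -> is_derive b 1 (C s) (- S (s + 1) b).
Proof.
move=> s0; have s10 : 0 < s + 1 by rewrite addr_gt0.
have -> : - S (s + 1) b =
    \int[mu]_(z in Rp) (- (z * (z `^ (s - 1) * expR (- z)) * sin (b * z))).
  rewrite /S -[LHS]mulN1r -(RintegralZl _ measurable_Rp); last first.
    exact: integrable_gammaM s10 (measurable_sinM b) (fun z => sin_max _).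
  apply: eq_Rintegral => z; rewrite inE/= in_itv/= andbT => z0.
  by rewrite (powRS _ z0) mulN1r !mulrA.
apply: (@is_derive_Rintegral _ _ R mu Rp
   (fun b z => z `^ (s - 1) * expR (- z) * cos (b * z))
   (fun b z => - (z * (z `^ (s - 1) * expR (- z)) * sin (b * z)))
   (fun z => z `^ (s + 1 - 1) * expR (- z)) (b - 1) (b + 1) b measurable_Rp).
- by apply/andP; split; lra.
- move=> x _; exact: integrable_gammaM s0 (measurable_cosM x) (fun z => cos_max _).
- move=> x z _ _.
  have h := is_derive1Ml (z `^ (s - 1) * expR (- z))
    (@is_derive1O _ cos (fun y => y * z) x _ _ (is_derive_cos (x * z))
      (is_derive1M (is_derive1I x) (is_derive1C z x))).
  apply: (is_derive_eqr h); ring.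
- exact: integrable_gamma s10.
- move=> x z _; rewrite /= in_itv/= andbT => z0.
  have h0 : 0 <= z * (z `^ (s - 1) * expR (- z)).
    by rewrite !mulr_ge0 ?powR_ge0 ?expR_ge0// ltW.
  by rewrite normrN (powRS _ z0) -[leRHS]mulrA normrM (ger0_norm h0) ler_piMr// sin_max.
Qed.

Let dS (s b : R) : 0 < s -> is_derive b 1 (S s) (C (s + 1) b).
Proof.
move=> s0; have s10 : 0 < s + 1 by rewrite addr_gt0.
have -> : C (s + 1) b =
    \int[mu]_(z in Rp) (z * (z `^ (s - 1) * expR (- z)) * cos (b * z)).
  apply: eq_Rintegral => z; rewrite inE/= in_itv/= andbT => z0.
  by rewrite (powRS _ z0) !mulrA.
apply: (@is_derive_Rintegral _ _ R mu Rp
   (fun b z => z `^ (s - 1) * expR (- z) * sin (b * z))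
   (fun b z => z * (z `^ (s - 1) * expR (- z)) * cos (b * z))
   (fun z => z `^ (s + 1 - 1) * expR (- z)) (b - 1) (b + 1) b measurable_Rp).
- by apply/andP; split; lra.
- move=> x _; exact: integrable_gammaM s0 (measurable_sinM x) (fun z => sin_max _).
- move=> x z _ _.
  have h := is_derive1Ml (z `^ (s - 1) * expR (- z))
    (@is_derive1O _ sin (fun y => y * z) x _ _ (is_derive_sin (x * z))
      (is_derive1M (is_derive1I x) (is_derive1C z x))).
  apply: (is_derive_eqr h); ring.
- exact: integrable_gamma s10.
- move=> x z _; rewrite /= in_itv/= andbT => z0.
  have h0 : 0 <= z * (z `^ (s - 1) * expR (- z)).
    by rewrite !mulr_ge0 ?powR_ge0 ?expR_ge0// ltW.
  by rewrite (powRS _ z0) -[leRHS]mulrA normrM (ger0_norm h0) ler_piMr// cos_max.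
Qed.

Let oneDsqr0 (b : R) : 0 < 1 + b ^+ 2. Proof. by rewrite ltr_pwDl// sqr_ge0. Qed.

Let dC' (s b : R) : 0 < s ->
  is_derive b 1 (C s) (- (s * (S s b + b * C s b) / (1 + b ^+ 2))).
Proof.
move=> s0; apply: is_derive_eqr (dC b s0) _; congr (- _).
move: (ibpC b s0) (ibpS b s0).
move: (C s b) (S s b) (C (s + 1) b) (S (s + 1) b) => c t c1 t1 e1 e2.
apply/eqP; rewrite eq_sym -subr_eq0 -[X in _ - X](mulfK (lt0r_neq0 (oneDsqr0 b))) -mulrBl.
rewrite mulf_eq0; apply/orP; left; apply/eqP.
have -> : s * (t + b * c) = s * t + b * (s * c) by ring.
have -> : s * t = t1 - b * c1 by lra.
have -> : s * c = c1 + b * t1 by lra.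
ring.
Qed.

Let dS' (s b : R) : 0 < s ->
  is_derive b 1 (S s) (s * (C s b - b * S s b) / (1 + b ^+ 2)).
Proof.
move=> s0; apply: is_derive_eqr (dS b s0) _.
move: (ibpC b s0) (ibpS b s0).
move: (C s b) (S s b) (C (s + 1) b) (S (s + 1) b) => c t c1 t1 e1 e2.
apply/eqP; rewrite eq_sym -subr_eq0 -[X in _ - X](mulfK (lt0r_neq0 (oneDsqr0 b))) -mulrBl.
rewrite mulf_eq0; apply/orP; left; apply/eqP.
have -> : s * (c - b * t) = s * c - b * (s * t) by ring.
have -> : s * t = t1 - b * c1 by lra.
have -> : s * c = c1 + b * t1 by lra.
ring.
Qed.

Let rho s b : R := (1 + b ^+ 2) `^ (s / 2).

Let drho (s b : R) : is_derive b 1 (rho s) (rho s b * (s * b / (1 + b ^+ 2))).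
Proof.
have h := @is_derive1O _ (fun x => x `^ (s / 2)) (fun b => 1 + b * b) b _ _
  (is_derive1_powR (s / 2) (oneDsqr0 b))
  (is_derive1D (is_derive1C 1 b) (is_derive1M (is_derive1I b) (is_derive1I b))).
apply: (is_derive_eqr h); rewrite /rho.
have -> : (1 + b ^+ 2) `^ (s / 2) = (1 + b ^+ 2) * (1 + b ^+ 2) `^ (s / 2 - 1).
  rewrite -[X in _ = X * _]powRr1 ?(ltW (oneDsqr0 b))// -powRD.
    by congr powR; ring.
  by rewrite (gt_eqF (oneDsqr0 b)) implybT.
field.
exact: lt0r_neq0 (oneDsqr0 b).
Qed.

Let dtheta (s b : R) : is_derive b 1 (fun b => s * atan b) (s / (1 + b ^+ 2)).
Proof. exact: is_derive1Ml. Qed.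

Let S0 s : S s 0 = 0.
Proof.
rewrite /S; under eq_Rintegral do rewrite mul0r sin0 mulr0.
by rewrite /Rintegral integral0.
Qed.

Let C0 s : C s 0 = Gamma s.
Proof. by rewrite /C /Gamma; under eq_Rintegral do rewrite mul0r cos0 mulr1. Qed.

(** In complex form this is the identity int z^(s-1) e^(-(1-ib)z) = Gamma s (1-ib)^(-s).
An integration by parts turns the derivatives of C and S in b into a linear system in C
and S alone; its solution times (1 + b^2)^(s/2), rotated back by the angle s atan b, is
constant in b, and its value at b = 0 is (Gamma s, 0). *)
Lemma gamma_trig (s b : R) : 0 < s ->
  \int[mu]_(z in Rp) (z `^ (s - 1) * expR (- z) * cos (b * z)) =
    Gamma s * (1 + b ^+ 2) `^ (- (s / 2)) * cos (s * atan b) /\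
  \int[mu]_(z in Rp) (z `^ (s - 1) * expR (- z) * sin (b * z)) =
    Gamma s * (1 + b ^+ 2) `^ (- (s / 2)) * sin (s * atan b).
Proof.
move=> s0; rewrite -/(C s b) -/(S s b).
pose u b := rho s b * (C s b * cos (s * atan b) + S s b * sin (s * atan b)).
pose v b := rho s b * (S s b * cos (s * atan b) - C s b * sin (s * atan b)).
have dcos b' := @is_derive1O _ cos (fun x => s * atan x) b' _ _ (is_derive_cos (s * atan b')) (dtheta s b').
have dsin b' := @is_derive1O _ sin (fun x => s * atan x) b' _ _ (is_derive_sin (s * atan b')) (dtheta s b').
have du (b' : R) : is_derive b' 1 u 0.
  have h := is_derive1M (drho s b') (is_derive1D
    (is_derive1M (dC' b' s0) (dcos b')) (is_derive1M (dS' b' s0) (dsin b'))).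
  apply: (is_derive_eqr h); field; exact: lt0r_neq0 (oneDsqr0 b').
have dv (b' : R) : is_derive b' 1 v 0.
  have h := is_derive1M (drho s b') (is_derive1B
    (is_derive1M (dS' b' s0) (dcos b')) (is_derive1M (dC' b' s0) (dsin b'))).
  apply: (is_derive_eqr h); field; exact: lt0r_neq0 (oneDsqr0 b').
have r0 : rho s 0 = 1 by rewrite /rho expr0n/= addr0 powR1.
have ub : u b = Gamma s.
  rewrite (is_derive_0_is_cst b 0 du) /u atan0 mulr0 cos0 sin0 S0 C0 r0; ring.
have vb : v b = 0.
  rewrite (is_derive_0_is_cst b 0 dv) /v atan0 mulr0 cos0 sin0 S0 C0 r0; ring.
have rn0 : rho s b != 0 by rewrite gt_eqF// powR_gt0.
have cs := cos2Dsin2 (s * atan b).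
rewrite powRN -/(rho s b) -ub; split.
  rewrite /u; transitivity (C s b * (cos (s * atan b) ^+ 2 + sin (s * atan b) ^+ 2)).
    by rewrite cs mulr1.
  have e : rho s b * (S s b * cos (s * atan b) - C s b * sin (s * atan b)) * sin (s * atan b) / rho s b = 0.
    by rewrite -/(v b) vb !mul0r.
  rewrite -[RHS]subr0 -[X in _ = _ - X]e; field.
  exact: rn0.
rewrite /u; transitivity (S s b * (cos (s * atan b) ^+ 2 + sin (s * atan b) ^+ 2)).
  by rewrite cs mulr1.
have e : rho s b * (S s b * cos (s * atan b) - C s b * sin (s * atan b)) * cos (s * atan b) / rho s b = 0.
  by rewrite -/(v b) vb !mul0r.
rewrite -[RHS]addr0 -[X in _ = _ + X]e; field.
exact: rn0.
Qed.

End gamma_trig.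

(** * The constant of the stable Levy measure *)

Section trig_bounds.
Context {R : realType}.

Lemma normr_sin_le (x : R) : `|sin x| <= `|x|.
Proof.
wlog x0 : x / 0 <= x => [H|].
  have [|x0] := leP 0 x; first exact: H.
  by rewrite -(opprK x) sinN !normrN -[leLHS]normrN -sinN opprK -[leRHS]normrN -[leLHS]normrN -sinN H// oppr_ge0 ltW.
move: x0; rewrite le_eqVlt => /predU1P[<-|x0]; first by rewrite sin0 normr0.
have [//|c _] := @MVT _ sin cos 0 x x0 (fun z _ => is_derive_sin z).
  by apply: continuous_subspaceT; exact: continuous_sin.
by rewrite sin0 !subr0 => ->; rewrite normrM ler_piMl// cos_max.
Qed.

Lemma onem_cosE (x : R) : 1 - cos x = 2 * sin (x / 2) ^+ 2.
Proof.
have {1}-> : x = (x / 2) *+ 2 by rewrite mulr2n; lra.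
by rewrite cos_mulr2n cos2sin2; ring.
Qed.

Lemma onem_cos_ge0 (x : R) : 0 <= 1 - cos x.
Proof. by rewrite subr_ge0 cos_le1. Qed.

Lemma onem_cos_le2 (x : R) : 1 - cos x <= 2.
Proof. by have := cos_geN1 x; lra. Qed.

Lemma onem_cos_le_sqr (x : R) : 1 - cos x <= x ^+ 2 / 2.
Proof.
rewrite onem_cosE; have := normr_sin_le (x / 2).
rewrite -(ler_pXn2r (n := 2))// ?nnegrE// !real_normK ?num_real// => h.
by apply: (@le_trans _ _ (2 * (x / 2) ^+ 2)); [rewrite ler_pM2l|lra].
Qed.

Lemma onem_cos_le_normr (x : R) : 1 - cos x <= `|x|.
Proof.
have h2 := onem_cos_le2 x; have hs := onem_cos_le_sqr x.
have [x2|x2] := leP `|x| 2; last by apply: (le_trans h2); exact: ltW.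
apply: (le_trans hs); rewrite -[x ^+ 2]real_normK ?num_real//.
have := normr_ge0 x; nra.
Qed.

End trig_bounds.

Section levy_integral.
Context {R : realType}.
Notation mu := (@lebesgue_measure R).
Notation Rp := (`]0%R, +oo[%classic : set R).
Implicit Types (alpha b z : R).

Lemma integrable_levy alpha b : 0 < alpha < 2 ->
  mu.-integrable Rp (EFin \o (fun z => z `^ (- 1 - alpha) * (1 - cos (b * z)))).
Proof.
move=> /andP[a0 a2].
apply: (@integrable_Rp_powR R (2 - alpha) alpha (2 + b ^+ 2)) => //; first by rewrite subr_gt0.
- apply: measurable_funTS; apply: measurable_funM; first exact: measurable_powR.
  by apply: measurable_funB => //; exact: measurable_cosM.
- move=> z /andP[z0 z1]; rewrite ger0_norm ?mulr_ge0 ?powR_ge0 ?onem_cos_ge0//.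
  have -> : z `^ (2 - alpha - 1) = z `^ (- 1 - alpha) * z ^+ 2.
    rewrite -powR_mulrn ?(ltW z0)// -powRD; first by congr powR; ring.
    by rewrite (gt_eqF z0) implybT.
  rewrite mulrCA ler_wpM2l ?powR_ge0//; apply: (le_trans (onem_cos_le_sqr _)).
  by rewrite exprMn; have := sqr_ge0 z; have := sqr_ge0 b; nra.
- move=> z z1; rewrite ger0_norm ?mulr_ge0 ?powR_ge0 ?onem_cos_ge0//.
  rewrite mulrC ler_wpM2r ?powR_ge0//; apply: (le_trans (onem_cos_le2 _)).
  by rewrite lerDl sqr_ge0.
Qed.

Lemma integrable_levy1 alpha : 0 < alpha < 2 ->
  mu.-integrable Rp (EFin \o (fun z => z `^ (- 1 - alpha) * (1 - cos z))).
Proof.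
move=> a02; apply: eq_integrable (integrable_levy 1 a02) => // z _.
by rewrite /= mul1r.
Qed.

Let C s b := \int[mu]_(z in Rp) (z `^ (s - 1) * expR (- z) * cos (b * z)).
Let S s b := \int[mu]_(z in Rp) (z `^ (s - 1) * expR (- z) * sin (b * z)).

Let ge1_powR_expR (p : R) : 0 <= p ->
  exists2 M : R, 0 < M & forall z, 1 <= z -> z `^ p * expR (- z) <= M * z `^ (- 1).
Proof.
move=> p0; have [|M M0 MP] := @powR_expR_le R (p + 1); first by rewrite addr_ge0.
exists M => // z z1; have z0 : 0 < z by exact: lt_le_trans z1.
rewrite powRN powRr1 ?(ltW z0)// ler_pdivlMr//; apply: le_trans (MP _ (ltW z0)).
rewrite powRD; last by rewrite (gt_eqF z0) implybT.
by rewrite powRr1 ?(ltW z0)// mulrAC.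
Qed.

(** Two integrations by parts lower the singularity z^(-1-alpha) to the integrable power
z^(1-alpha) of the Gamma integrals; the factor e^(-z) makes them converge at infinity. *)
Lemma levy_ibp alpha b : 0 < alpha < 2 ->
  alpha * (alpha - 1) *
  \int[mu]_(z in Rp) (z `^ (- 1 - alpha) * (1 - cos (b * z)) * expR (- z)) =
  Gamma (2 - alpha) - (1 - b ^+ 2) * C (2 - alpha) b - 2 * b * S (2 - alpha) b.
Proof.
move=> a02; have /andP[a0 a2] := a02.
have s0 : 0 < 2 - alpha by rewrite subr_gt0.
have iC := integrable_gammaM s0 (measurable_cosM b) (fun z => cos_max _).
have iS := integrable_gammaM s0 (measurable_sinM b) (fun z => sin_max _).
have iG := integrable_gamma s0.
have iL : mu.-integrable Rp (EFin \o (fun z => z `^ (- 1 - alpha) * (1 - cos (b * z)) * expR (- z))).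
  apply: (@integrableM_bounded _ _ R mu Rp _ _ 1 measurable_Rp (integrable_levy b a02)).
    by apply: measurable_funTS; apply: measurableT_comp.
  move=> z; rewrite /= in_itv/= andbT => z0.
  by rewrite ger0_norm ?expR_ge0// expR_le1 oppr_le0 ltW.
have iL' := integrableZl measurable_Rp (alpha * (alpha - 1)) iL.
have iC' := integrableZl measurable_Rp (1 - b ^+ 2) iC.
have iS' := integrableZl measurable_Rp (2 * b) iS.
rewrite /C /S /Gamma -!(RintegralZl _ measurable_Rp)//.
rewrite -!(RintegralB measurable_Rp)//; last exact: (integrableB measurable_Rp iG iC').
apply/eqP; rewrite eq_sym -subr_eq0; apply/eqP.
rewrite -!(RintegralB measurable_Rp)//; last first.
  exact: (integrableB measurable_Rp (integrableB measurable_Rp iG iC') iS').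
(* The boundary terms of both integrations by parts, gathered in a single primitive. *)
pose F z := (alpha - 1) * (z `^ (- alpha) * ((1 - cos (b * z)) * expR (- z))) +
  z `^ (1 - alpha) * ((b * sin (b * z) - (1 - cos (b * z))) * expR (- z)).
have d1c (x : R) : is_derive x 1 (fun z => 1 - cos (b * z)) (b * sin (b * x)).
  apply: is_derive_eqr (is_derive1B (is_derive1C 1 x) (is_derive_cosM b x)) _.
  by rewrite sub0r opprK.
have bs z : 0 <= z -> `|b * sin (b * z)| <= b ^+ 2 * z.
  move=> z0; rewrite normrM (le_trans (ler_wpM2l (normr_ge0 b) (normr_sin_le (b * z))))//.
  by rewrite normrM mulrA -expr2 real_normK ?num_real// (ger0_norm z0).
have F0 : F z @[z --> 0^'+] --> 0.
  apply: (@cvg_head_powR _ (2 - alpha) (`|alpha - 1| * b ^+ 2 + 2 * b ^+ 2)) => // z /andP[z0 z1].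
  have e1 : expR (- z) <= 1 by rewrite expR_le1 oppr_le0 ltW.
  have e0 := expR_ge0 (- z).
  have c0 := onem_cos_ge0 (b * z).
  have c1 : 1 - cos (b * z) <= b ^+ 2 * z ^+ 2.
    apply: (le_trans (onem_cos_le_sqr _)); rewrite exprMn.
    by have := mulr_ge0 (sqr_ge0 b) (sqr_ge0 z); lra.
  have -> : z `^ (2 - alpha) = z `^ (- alpha) * z ^+ 2.
    rewrite -powR_mulrn ?(ltW z0)// -powRD; first by congr powR; ring.
    by rewrite (gt_eqF z0) implybT.
  rewrite /F; have -> : z `^ (1 - alpha) = z `^ (- alpha) * z.
    rewrite -[X in _ = _ * X]powRr1 ?(ltW z0)// -powRD; first by congr powR; ring.
    by rewrite (gt_eqF z0) implybT.
  have p0 := powR_ge0 z (- alpha); set p := z `^ (- alpha) in p0 *.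
  rewrite [leRHS]mulrDl; apply: (le_trans (ler_normD _ _)); apply: lerD.
    rewrite normrM -[leRHS]mulrA ler_wpM2l// normrM (ger0_norm p0) mulrCA ler_wpM2l//.
    by rewrite ger0_norm ?mulr_ge0//; nra.
  rewrite -mulrA normrM (ger0_norm p0) [leRHS]mulrCA ler_wpM2l//.
  rewrite normrM (ger0_norm (ltW z0)) (expr2 z) [leRHS]mulrA [leLHS]mulrC ler_wpM2r ?(ltW z0)//.
  rewrite normrM (ger0_norm e0) -[leRHS]mulr1 ler_pM//.
  rewrite (le_trans (ler_normB _ _))//; have := bs z (ltW z0); rewrite (ger0_norm c0).
  by have := sqr_ge0 b; nra.
have F1 : F z @[z --> +oo] --> 0.
  have [M M0 MP] := ge1_powR_expR ler01.
  apply: (@cvg_tail_powR _ 1 (M * (`|alpha - 1| * 2 + (`|b| + 2)))) => // z z1.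
  have z0 : 0 < z by exact: lt_le_trans z1.
  have e0 := expR_ge0 (- z).
  have c0 := onem_cos_ge0 (b * z); have c2 := onem_cos_le2 (b * z).
  have pa : z `^ (- alpha) <= z.
    by rewrite -[leRHS]powRr1 ?(ltW z0)// ler_powR//; lra.
  have pb : z `^ (1 - alpha) <= z.
    by rewrite -[leRHS]powRr1 ?(ltW z0)// ler_powR//; lra.
  have := MP z z1; rewrite powRr1 ?(ltW z0)// => h.
  rewrite mulrAC; apply: (@le_trans _ _ (z * expR (- z) * (`|alpha - 1| * 2 + (`|b| + 2)))); last first.
    by rewrite ler_wpM2r// !addr_ge0 ?mulr_ge0.
  rewrite /F [leRHS]mulrDr; apply: (le_trans (ler_normD _ _)); apply: lerD.
    rewrite normrM [leRHS]mulrCA ler_wpM2l// normrM (ger0_norm (powR_ge0 _ _)).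
    by rewrite -mulrA ler_pM ?powR_ge0// ger0_norm ?mulr_ge0// mulrC ler_wpM2l.
  rewrite normrM (ger0_norm (powR_ge0 _ _)) -mulrA ler_pM ?powR_ge0//.
  rewrite normrM (ger0_norm e0) mulrC ler_wpM2l//.
  rewrite (le_trans (ler_normB _ _))// lerD ?(ger0_norm c0)//.
  by rewrite normrM ler_piMr// sin_max.
apply: etrans (subrr 0); apply: (Rintegral_FTC_Rp _ _ _ F0 F1).
- exact: (integrableB measurable_Rp (integrableB measurable_Rp
    (integrableB measurable_Rp iG iC') iS') iL').
- move=> x x0.
  have dz := is_derive1M (is_derive1_powR (2 - alpha - 1) x0) (is_derive_expRN x).
  exact: (is_derive_continuous (is_derive1B (is_derive1B (is_derive1B dz
    (is_derive1Ml (1 - b ^+ 2) (is_derive1M dz (is_derive_cosM b x))))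
    (is_derive1Ml (2 * b) (is_derive1M dz (is_derive_sinM b x))))
    (is_derive1Ml (alpha * (alpha - 1))
     (is_derive1M (is_derive1M (is_derive1_powR (- 1 - alpha) x0) (d1c x)) (is_derive_expRN x))))).
- move=> x x0.
  have h := is_derive1D (is_derive1Ml (alpha - 1) (is_derive1M (is_derive1_powR (- alpha) x0)
     (is_derive1M (d1c x) (is_derive_expRN x))))
   (is_derive1M (is_derive1_powR (1 - alpha) x0)
     (is_derive1M (is_derive1B (is_derive1Ml b (is_derive_sinM b x)) (d1c x)) (is_derive_expRN x))).
  apply: (is_derive_eqr h).
  have -> : 2 - alpha - 1 = 1 - alpha by ring.
  have -> : - alpha - 1 = - 1 - alpha by ring.
  have -> : 1 - alpha - 1 = - alpha by ring.
  ring.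
Qed.

Lemma Rintegral_Rp_scale (k : R) (h : R -> R) : 0 < k ->
  mu.-integrable Rp (EFin \o h) ->
  \int[mu]_(z in Rp) h z = k * \int[mu]_(z in Rp) h (k * z).
Proof.
move=> k0 ih; rewrite Rintegral_mkcond (@Rintegral_affine _ k 0 k0); last first.
  by rewrite -restrict_EFin; apply/(integrable_mkcond _ measurable_Rp).
congr (_ * _); rewrite [RHS]Rintegral_mkcond; apply: eq_Rintegral => z _.
rewrite !patchE addr0; congr (if _ then _ else _).
by apply/idP/idP; rewrite !inE/= !in_itv/= !andbT pmulr_rgt0.
Qed.

Let powR_invE (alpha b : R) : 0 < b -> b^-1 `^ (- 1 - alpha) = b * b `^ alpha.
Proof.
move=> b0; rewrite -(powR_inv1 (ltW b0)) -powRrM -[X in _ = X * _](powRr1 (ltW b0)).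
rewrite -powRD; first by congr powR; ring.
by rewrite (gt_eqF b0) implybT.
Qed.

Lemma levy_integral_homogeneous alpha b : 0 < alpha < 2 -> 0 < b ->
  \int[mu]_(z in Rp) (z `^ (- 1 - alpha) * (1 - cos (b * z))) =
  b `^ alpha * \int[mu]_(z in Rp) (z `^ (- 1 - alpha) * (1 - cos z)).
Proof.
move=> a02 b0; rewrite (Rintegral_Rp_scale (k := b^-1))//; last 2 first.
- by rewrite invr_gt0.
- exact: integrable_levy.
transitivity (b^-1 * \int[mu]_(z in Rp) (b * b `^ alpha *
    (z `^ (- 1 - alpha) * (1 - cos z)))).
  congr (_ * _); apply: eq_Rintegral => z; rewrite inE/= in_itv/= andbT => z0.
  rewrite mulVKf ?gt_eqF// powRM ?invr_ge0 ?(ltW b0) ?(ltW z0)// mulrA.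
  by rewrite powR_invE.
rewrite (RintegralZl _ measurable_Rp); last exact: integrable_levy1.
by rewrite !mulrA mulVf ?mul1r// gt_eqF.
Qed.

(** Scaling by b exchanges a large frequency for a weak damping, so that the undamped
integral is the limit of the damped one as b tends to infinity. *)
Lemma levy_damped alpha b : 0 < alpha < 2 -> 0 < b ->
  \int[mu]_(z in Rp) (z `^ (- 1 - alpha) * (1 - cos (b * z)) * expR (- z)) =
  b `^ alpha * \int[mu]_(z in Rp) (z `^ (- 1 - alpha) * (1 - cos z) * expR (- (b^-1 * z))).
Proof.
move=> a02 b0.
have iL (c : R) (e : R) : 0 < e -> mu.-integrable Rp
    (EFin \o (fun z => z `^ (- 1 - alpha) * (1 - cos (c * z)) * expR (- (e * z)))).
  move=> e0.
  apply: (@integrableM_bounded _ _ R mu Rp _ _ 1 measurable_Rp (integrable_levy c a02)).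
    apply: measurable_funTS; apply: measurableT_comp => //.
    by apply: measurable_funN; apply: measurable_funM.
  move=> z; rewrite /= in_itv/= andbT => z0.
  by rewrite ger0_norm ?expR_ge0// expR_le1 oppr_le0 mulr_ge0// ltW.
have iL1 : mu.-integrable Rp
    (EFin \o (fun z => z `^ (- 1 - alpha) * (1 - cos (b * z)) * expR (- z))).
  by apply: eq_integrable (iL b 1 ltr01) => // z _; rewrite /= mul1r.
rewrite (Rintegral_Rp_scale (k := b^-1))//; last by rewrite invr_gt0.
have b'0 : 0 < b^-1 by rewrite invr_gt0.
have iL2 : mu.-integrable Rp
    (EFin \o (fun z => z `^ (- 1 - alpha) * (1 - cos z) * expR (- (b^-1 * z)))).
  by apply: eq_integrable (iL 1 _ b'0) => // z _; rewrite /= mul1r.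
transitivity (b^-1 * \int[mu]_(z in Rp) (b * b `^ alpha *
    (z `^ (- 1 - alpha) * (1 - cos z) * expR (- (b^-1 * z))))).
  congr (_ * _); apply: eq_Rintegral => z; rewrite inE/= in_itv/= andbT => z0.
  rewrite mulVKf ?gt_eqF// powRM ?invr_ge0 ?(ltW b0) ?(ltW z0)// !mulrA.
  by rewrite powR_invE.
rewrite (RintegralZl _ measurable_Rp)//.
by rewrite !mulrA mulVf ?mul1r// gt_eqF.
Qed.

Lemma levy_damped_cvg alpha : 0 < alpha < 2 ->
  \int[mu]_(z in Rp) (z `^ (- 1 - alpha) * (1 - cos z) * expR (- (n.+1%:R^-1 * z)))
    @[n --> \oo] --> \int[mu]_(z in Rp) (z `^ (- 1 - alpha) * (1 - cos z)).
Proof.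
move=> a02; have iL := integrable_levy1 a02.
apply: (@cvg_Rintegral _ _ R mu Rp measurable_Rp
  (fun n z => z `^ (- 1 - alpha) * (1 - cos z) * expR (- (n.+1%:R^-1 * z)))
  (fun z => z `^ (- 1 - alpha) * (1 - cos z))
  (fun z => z `^ (- 1 - alpha) * (1 - cos z))) => //.
- move=> n; apply: measurable_funM; first by case/integrableP : iL => /measurable_EFinP.
  apply: measurable_funTS; apply: measurableT_comp => //.
  by apply: measurable_funN; apply: measurable_funM.
- move=> z _; rewrite -[X in _ --> X]mulr1; apply: cvgMl_tmp.
  rewrite -[X in _ --> X](@expR0 R); apply: continuous_cvg; first exact: continuous_expR.
  rewrite -[X in _ --> X]oppr0 -[X in _ --> - X](mul0r z).
  by apply: cvgN; apply: cvgMr_tmp; exact: (@cvg_harmonic R).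
- move=> n z; rewrite /= in_itv/= andbT => z0.
  have h : 0 <= z `^ (- 1 - alpha) * (1 - cos z) by rewrite mulr_ge0 ?powR_ge0 ?onem_cos_ge0.
  rewrite normrM (ger0_norm h) ler_piMr// ger0_norm ?expR_ge0//.
  by rewrite expR_le1 oppr_le0 mulr_ge0// ltW.
Qed.

End levy_integral.

Section levy_constant.
Context {R : realType}.
Notation mu := (@lebesgue_measure R).
Notation Rp := (`]0%R, +oo[%classic : set R).
Implicit Types (alpha b z : R).
Let I alpha := \int[mu]_(z in Rp) (z `^ (- 1 - alpha) * (1 - cos z)).

Let oneDsqr0 b : 0 < 1 + b ^+ 2. Proof. by rewrite ltr_pwDl// sqr_ge0. Qed.

(** The trigonometric factors of gamma_trig combine, since 1 - b^2 and 2b are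
(1 + b^2) times the cosine and sine of the angle 2 atan b. *)
Let damped_formula alpha b : 0 < alpha < 2 ->
  alpha * (alpha - 1) *
  \int[mu]_(z in Rp) (z `^ (- 1 - alpha) * (1 - cos (b * z)) * expR (- z)) =
  Gamma (2 - alpha) * (1 - (1 + b ^+ 2) `^ (alpha / 2) * cos (alpha * atan b)).
Proof.
move=> a02; have s0 : 0 < 2 - alpha by case/andP : a02 => _; rewrite subr_gt0.
rewrite levy_ibp//; have [-> ->] := gamma_trig b s0.
have -> : alpha * atan b = (atan b + atan b) - (2 - alpha) * atan b by ring.
rewrite cosB cosD sinD.
have q0 : 0 < Num.sqrt (1 + b ^+ 2) by rewrite sqrtr_gt0.
have E : sin (atan b) = b * cos (atan b).
  have := atanK b; rewrite /tan => {2}<-; rewrite mulfVK//.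
  by rewrite cos_atan invr_eq0 gt_eqF.
have -> : (1 + b ^+ 2) `^ (alpha / 2) = (1 + b ^+ 2) * (1 + b ^+ 2) `^ (- ((2 - alpha) / 2)).
  rewrite -[X in _ = X * _]powRr1 ?(ltW (oneDsqr0 b))// -powRD; first by congr powR; field.
  by rewrite (gt_eqF (oneDsqr0 b)) implybT.
have c2 : (1 + b ^+ 2) * cos (atan b) ^+ 2 = 1.
  by rewrite cos_atan exprVn sqr_sqrtr ?(ltW (oneDsqr0 b))// mulfV// gt_eqF.
rewrite E; set p := _ `^ _; set c := cos (atan b) in c2 *.
set x := cos (_ * _); set y := sin (_ * _).
have -> : (1 + b ^+ 2) * p * ((c * c - b * c * (b * c)) * x + (b * c * c + c * (b * c)) * y) =
  ((1 + b ^+ 2) * c ^+ 2) * p * ((1 - b ^+ 2) * x + 2 * b * y) by ring.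
rewrite c2; ring.
Qed.

Let invS_cvg0 : (n.+1%:R^-1 : R) @[n --> \oo] --> 0.
Proof. exact: (@cvg_harmonic R). Qed.

Let S_cvgy : (n.+1%:R : R) @[n --> \oo] --> +oo.
Proof. by have := cvgr_idn (R := R); rewrite -(cvg_shiftn 1); under eq_fun do rewrite addn1. Qed.

(** In the damped formula at frequency b = n+1, divided by b^alpha, the constant 1
disappears in the limit and alpha atan b tends to alpha pi / 2.  For alpha = 1 both sides
vanish, and that case is treated separately. *)
Lemma levy_integral_ne1 alpha : 0 < alpha < 2 ->
  alpha * (alpha - 1) * I alpha = - (Gamma (2 - alpha) * cos (pi * alpha / 2)).
Proof.
move=> a02; have a0 : 0 < alpha by case/andP : a02.
have lim1 := levy_damped_cvg a02.
have {lim1} : alpha * (alpha - 1) * \int[mu]_(z in Rp) (z `^ (- 1 - alpha) * (1 - cos z) * expR (- (n.+1%:R^-1 * z)))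
    @[n --> \oo] --> alpha * (alpha - 1) * I alpha by apply: cvgMl_tmp.
have -> : (fun n => alpha * (alpha - 1) * \int[mu]_(z in Rp)
    (z `^ (- 1 - alpha) * (1 - cos z) * expR (- (n.+1%:R^-1 * z)))) =
  (fun n : nat => Gamma (2 - alpha) * (n.+1%:R^-1 `^ alpha -
     (1 + n.+1%:R^-1 ^+ 2) `^ (alpha / 2) * cos (alpha * atan n.+1%:R))).
  apply/funext => n; have := ltr0Sn R n; move: (n.+1%:R : R) => b b0.
  have ba0 : b `^ alpha != 0 by rewrite gt_eqF// powR_gt0.
  apply: (mulfI ba0); rewrite mulrCA -levy_damped// damped_formula//.
  rewrite mulrCA; congr (_ * _); rewrite mulrBr mulrA -!powRM ?invr_ge0 ?(ltW b0)//.
  have bn0 : b != 0 by rewrite gt_eqF.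
  rewrite mulfV// powR1; congr (_ - _ * _).
  have -> : b `^ alpha = (b ^+ 2) `^ (alpha / 2).
    by rewrite -powR_mulrn ?(ltW b0)// -powRrM; congr powR; field.
  rewrite -powRM ?sqr_ge0 ?(ltW (oneDsqr0 _))//; congr powR; field.
  exact: bn0.
move=> lim1; apply: (cvg_unique _ lim1) => //.
have -> : - (Gamma (2 - alpha) * cos (pi * alpha / 2)) =
  Gamma (2 - alpha) * (0 - 1 * cos (alpha * (pi / 2))).
  by rewrite sub0r mul1r mulrN; congr (- (_ * cos _)); ring.
apply: cvgMl_tmp; apply: cvgB.
  have /cvg_at_rightP := powR_cvg0 a0; apply; split; last exact: invS_cvg0.
  by move=> n; rewrite invr_gt0.
apply: cvgM.
  have h : {for 0, continuous (fun x : R => (1 + x ^+ 2) `^ (alpha / 2))}.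
    exact: is_derive_continuous (@is_derive1O _ (fun x => x `^ (alpha / 2)) (fun x => 1 + x * x) 0 _ _
     (is_derive1_powR _ (oneDsqr0 0)) (is_derive1D (is_derive1C 1 0) (is_derive1M (is_derive1I 0) (is_derive1I 0)))).
  have := cvg_comp (fun n => n.+1%:R^-1 : R) (fun x : R => (1 + x ^+ 2) `^ (alpha / 2)) invS_cvg0 h.
  by rewrite expr0n/= addr0 powR1.
apply: continuous_cvg; first exact: continuous_cos.
by apply: cvgMl_tmp; apply: cvg_comp S_cvgy (@cvgy_atan R).
Qed.

Let Gamma1 : Gamma 1 = 1 :> R.
Proof.
have iG := integrable_gamma (@ltr01 R).
have d1 (x : R) : is_derive x 1 (fun x => - expR (- x)) (expR (- x)).
  by apply: is_derive_eqr (is_derive1N (is_derive_expRN x)) _; rewrite opprK.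
transitivity (0 - (-1) : R); last by ring.
apply: (@Rintegral_FTC_Rp _ _ (fun x => - expR (- x))) => //.
- move=> x x0.
  exact: is_derive_continuous (is_derive1M (is_derive1_powR _ x0) (is_derive_expRN x)).
- move=> x x0; apply: is_derive_eqr (d1 x) _.
  by rewrite subrr powRr0 mul1r.
- apply: cvg_at_right_filter.
  have := is_derive_continuous (d1 0); rewrite /prop_for /continuous_at oppr0 expR0.
  exact.
- by rewrite -[X in _ --> X]oppr0; apply: cvgN; exact: cvgr_expR.
Qed.

Let integrable_sinc b : mu.-integrable Rp (EFin \o (fun z => z `^ (- 1) * sin (b * z) * expR (- z))).
Proof.
apply: (@le_integrable_fin _ _ R mu Rp _ (fun z => `|b| * (z `^ (1 - 1) * expR (- z))) measurable_Rp).
- apply: measurable_funTS; apply: measurable_funM; last exact: measurableT_comp.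
  by apply: measurable_funM; [exact: measurable_powR|exact: measurable_sinM].
- exact: (integrableZl measurable_Rp _ (integrable_gamma ltr01)).
- move=> z; rewrite /= in_itv/= andbT => z0.
  rewrite subrr powRr0 mul1r normrM (ger0_norm (expR_ge0 _)) ler_wpM2r ?expR_ge0//.
  rewrite normrM (ger0_norm (powR_ge0 _ _)) powR_inv1 ?(ltW z0)// mulrC ler_pdivrMr//.
  by rewrite (le_trans (normr_sin_le _))// normrM (ger0_norm (ltW z0)).
Qed.

Lemma laplace_cos (x : R) :
  \int[mu]_(z in Rp) (cos (x * z) * expR (- z)) = (1 + x ^+ 2)^-1.
Proof.
  have [h _] := gamma_trig x (@ltr01 R).
  transitivity (\int[mu]_(z in Rp) (z `^ (1 - 1) * expR (- z) * cos (x * z))).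
    by apply: eq_Rintegral => z _; rewrite subrr powRr0 mul1r mulrC.
  rewrite h Gamma1 !mul1r cos_atan powRN.
  rewrite powR12_sqrt ?(ltW (oneDsqr0 x))// -invfM -expr2 sqr_sqrtr//.
  exact: ltW (oneDsqr0 x).
Qed.

(** The derivative in b is the Laplace transform of the cosine, 1 / (1 + b^2). *)
Let sinc_atan b : \int[mu]_(z in Rp) (z `^ (- 1) * sin (b * z) * expR (- z)) = atan b.
Proof.
pose J b := \int[mu]_(z in Rp) (z `^ (- 1) * sin (b * z) * expR (- z)).
have dJ (x : R) : is_derive x 1 J ((1 + x ^+ 2)^-1).
  rewrite -(laplace_cos x); apply: (@is_derive_Rintegral _ _ R mu Rp
    (fun b z => z `^ (- 1) * sin (b * z) * expR (- z))
    (fun b z => cos (b * z) * expR (- z))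
    (fun z => z `^ (1 - 1) * expR (- z)) (x - 1) (x + 1) x measurable_Rp).
  - by apply/andP; split; lra.
  - by move=> y _; exact: integrable_sinc.
  - move=> y z _; rewrite /= in_itv/= andbT => z0.
    have h := is_derive1M (is_derive1Ml (z `^ (- 1)) (@is_derive1O _ sin (fun y => y * z) y _ _ (is_derive_sin (y * z))
      (is_derive1M (is_derive1I y) (is_derive1C z y)))) (is_derive1C (expR (- z)) y).
    apply: (is_derive_eqr h); rewrite powR_inv1 ?(ltW z0)//; field.
    by rewrite gt_eqF.
  - exact: integrable_gamma ltr01.
  - move=> y z _ _; rewrite subrr powRr0 mul1r normrM (ger0_norm (expR_ge0 _)).
    by rewrite ler_piMl ?expR_ge0// cos_max.
have dd (x : R) : is_derive x 1 (fun x => J x - atan x) 0.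
  by apply: is_derive_eqr (is_derive1B (dJ x) (is_derive1_atan x)) _; rewrite subrr.
apply/eqP; rewrite -subr_eq0 -/(J b); apply/eqP.
rewrite (is_derive_0_is_cst b 0 dd) atan0 subr0 /J.
under eq_Rintegral do rewrite mul0r sin0 mulr0 mul0r.
by rewrite /Rintegral integral0.
Qed.

Let measurable_onem_cos b : measurable_fun setT (fun z => 1 - cos (b * z)).
Proof. by apply: measurable_funB => //; exact: measurable_cosM. Qed.

Let onem_cosV_le b z : 0 < z -> `|z `^ (- 1) * (1 - cos (b * z)) * expR (- z)| <=
  `|b| * (z `^ (1 - 1) * expR (- z)).
Proof.
move=> z0; rewrite subrr powRr0 mul1r normrM (ger0_norm (expR_ge0 _)) ler_wpM2r ?expR_ge0//.
rewrite normrM (ger0_norm (powR_ge0 _ _)) powR_inv1 ?(ltW z0)// mulrC ler_pdivrMr//.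
rewrite ger0_norm ?onem_cos_ge0//.
by rewrite (le_trans (onem_cos_le_normr _))// normrM (ger0_norm (ltW z0)).
Qed.

Let integrable_onem_cosV b :
  mu.-integrable Rp (EFin \o (fun z => z `^ (- 1) * (1 - cos (b * z)) * expR (- z))).
Proof.
apply: (@le_integrable_fin _ _ R mu Rp _ (fun z => `|b| * (z `^ (1 - 1) * expR (- z))) measurable_Rp).
- apply: measurable_funTS; apply: measurable_funM; last exact: measurableT_comp.
  by apply: measurable_funM; [exact: measurable_powR|exact: measurable_onem_cos].
- exact: (integrableZl measurable_Rp _ (integrable_gamma ltr01)).
- by move=> z; rewrite /= in_itv/= andbT => z0; exact: onem_cosV_le.
Qed.

(** For alpha = 1 a single integration by parts leaves the integral of sinc_atan. *)
Let damped1 b :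
  \int[mu]_(z in Rp) (z `^ (- 1 - 1) * (1 - cos (b * z)) * expR (- z)) =
  b * atan b - \int[mu]_(z in Rp) (z `^ (- 1) * (1 - cos (b * z)) * expR (- z)).
Proof.
have a02 : 0 < (1 : R) < 2 by apply/andP; split; lra.
have iL : mu.-integrable Rp (EFin \o (fun z => z `^ (- 1 - 1) * (1 - cos (b * z)) * expR (- z))).
  apply: (@integrableM_bounded _ _ R mu Rp _ _ 1 measurable_Rp (integrable_levy b a02)).
    by apply: measurable_funTS; apply: measurableT_comp.
  move=> z; rewrite /= in_itv/= andbT => z0.
  by rewrite ger0_norm ?expR_ge0// expR_le1 oppr_le0 ltW.
have iK := integrable_onem_cosV b.
have iJ := integrableZl measurable_Rp b (integrable_sinc b).
rewrite -sinc_atan -(RintegralZl _ measurable_Rp (integrable_sinc b)).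
rewrite -(RintegralB measurable_Rp iJ iK).
apply/eqP; rewrite eq_sym -subr_eq0; apply/eqP.
rewrite -(RintegralB measurable_Rp (integrableB measurable_Rp iJ iK) iL).
pose F z := z `^ (- 1) * (1 - cos (b * z)) * expR (- z).
have F0 : F z @[z --> 0^'+] --> 0.
  apply: (@cvg_head_powR _ 1 (b ^+ 2)) => // z /andP[z0 z1].
  have e1 : expR (- z) <= 1 by rewrite expR_le1 oppr_le0 ltW.
  have e0 := expR_ge0 (- z).
  rewrite /F normrM (ger0_norm e0) powRr1 ?(ltW z0)//.
  rewrite -[leRHS]mulr1 ler_pM// normrM (ger0_norm (powR_ge0 _ _)) powR_inv1 ?(ltW z0)//.
  rewrite mulrC ler_pdivrMr// ger0_norm ?onem_cos_ge0//.
  apply: (le_trans (onem_cos_le_sqr _)); rewrite exprMn -[leRHS]mulrA -expr2.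
  by have := mulr_ge0 (sqr_ge0 b) (sqr_ge0 z); lra.
have F1 : F z @[z --> +oo] --> 0.
  apply: (@cvg_tail_powR _ 1 2) => // z z1; have z0 : 0 < z by exact: lt_le_trans z1.
  have e1 : expR (- z) <= 1 by rewrite expR_le1 oppr_le0 ltW.
  rewrite /F normrM (ger0_norm (expR_ge0 _)) -[leRHS]mulr1 ler_pM ?expR_ge0//.
  rewrite normrM (ger0_norm (powR_ge0 _ _)) mulrC ler_wpM2r ?powR_ge0//.
  by rewrite ger0_norm ?onem_cos_ge0 ?onem_cos_le2.
have d1c (x : R) : is_derive x 1 (fun z => 1 - cos (b * z)) (b * sin (b * x)).
  apply: is_derive_eqr (is_derive1B (is_derive1C 1 x) (is_derive_cosM b x)) _.
  by rewrite sub0r opprK.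
apply: etrans (subrr 0); apply: (Rintegral_FTC_Rp _ _ _ F0 F1).
- exact: (integrableB measurable_Rp (integrableB measurable_Rp iJ iK) iL).
- move=> x x0.
  have dp := is_derive1_powR (- 1) x0; have de := is_derive_expRN x.
  exact: (is_derive_continuous (is_derive1B (is_derive1B
    (is_derive1Ml b (is_derive1M (is_derive1M dp (is_derive_sinM b x)) de))
    (is_derive1M (is_derive1M dp (d1c x)) de))
    (is_derive1M (is_derive1M (is_derive1_powR (- 1 - 1) x0) (d1c x)) de))).
- move=> x x0.
  have h := is_derive1M (is_derive1M (is_derive1_powR (- 1) x0) (d1c x)) (is_derive_expRN x).
  by apply: (is_derive_eqr h); ring.
Qed.

Lemma levy_integral_1 : I 1 = pi / 2.
Proof.
have a02 : 0 < (1 : R) < 2 by apply/andP; split; lra.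
have lim1 := levy_damped_cvg a02.
apply: (cvg_unique _ lim1) => //.
have -> : (fun n => \int[mu]_(z in Rp)
    (z `^ (- 1 - 1) * (1 - cos z) * expR (- (n.+1%:R^-1 * z)))) =
  (fun n : nat => atan n.+1%:R -
     \int[mu]_(z in Rp) (n.+1%:R^-1 * (z `^ (- 1) * (1 - cos (n.+1%:R * z)) * expR (- z)))).
  apply/funext => n; have := ltr0Sn R n; move: (n.+1%:R : R) => b b0.
  rewrite (RintegralZl _ measurable_Rp (integrable_onem_cosV b)).
  apply: (mulfI (lt0r_neq0 b0)); rewrite mulrBr mulVKf ?gt_eqF// -damped1 levy_damped//.
  by rewrite powRr1// ltW.
rewrite -(subr0 (pi / 2)); apply: cvgB; first exact: cvg_comp S_cvgy (@cvgy_atan R).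
have Z : \int[mu]_(z in Rp) (0 : R) = 0 by rewrite /Rintegral integral0.
suff : \int[mu]_(z in Rp) (n.+1%:R^-1 * (z `^ (- 1) * (1 - cos (n.+1%:R * z)) * expR (- z)))
    @[n --> \oo] --> \int[mu]_(z in Rp) (0 : R) by rewrite Z.
apply: (@cvg_Rintegral _ _ R mu Rp measurable_Rp
  (fun n z => n.+1%:R^-1 * (z `^ (- 1) * (1 - cos (n.+1%:R * z)) * expR (- z)))
  (fun=> 0) (fun z => z `^ (1 - 1) * expR (- z))).
- move=> n; apply: measurable_funM => //.
  by case/integrableP : (integrable_onem_cosV n.+1%:R) => /measurable_EFinP.
- move=> z; rewrite /= in_itv/= andbT => z0.
  apply: (@squeeze_cvgr _ _ _ _ (fun=> 0) (fun n => n.+1%:R^-1 * (z `^ (- 1) * 2))).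
  + apply: nearW => n; apply/andP; split.
      by rewrite !mulr_ge0 ?powR_ge0 ?expR_ge0 ?onem_cos_ge0.
    rewrite ler_wpM2l// -mulrA ler_wpM2l ?powR_ge0// -[leRHS]mulr1.
    by rewrite ler_pM ?expR_ge0 ?onem_cos_ge0 ?onem_cos_le2// expR_le1 oppr_le0 ltW.
  + exact: cvg_cst.
  + by rewrite -[X in _ --> X](mul0r (z `^ (- 1) * 2)); apply: cvgMr_tmp.
- exact: integrable_gamma.
- move=> n z; rewrite /= in_itv/= andbT => z0.
  rewrite normrM (@ger0_norm _ n.+1%:R^-1) ?invr_ge0//.
  rewrite mulrC ler_pdivrMr// [leRHS]mulrC; apply: (le_trans (onem_cosV_le _ z0)).
  by rewrite ger0_norm.
Qed.

(** Needed to divide by the integral: the sign of Gamma (2 - alpha) cos (pi alpha / 2)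
is never computed, but deduced from this positivity. *)
Lemma levy_integral_gt0 alpha : 0 < alpha < 2 -> 0 < I alpha.
Proof.
move=> a02; have iL := integrable_levy1 a02.
have c1 : cos (1 : R) < 1.
  have p2 := @pi_ge2 R.
  rewrite -[ltRHS]cos0 ltr_cos ?ltr01// in_itv/=; apply/andP; split; lra.
pose m := 2 `^ (- 1 - alpha) * (1 - cos (1 : R)).
have m0 : 0 < m by rewrite mulr_gt0 ?powR_gt0// subr_gt0.
apply: (lt_le_trans m0).
have -> : m = \int[mu]_(z in Rp) (m * \1_(`[1, 2]%classic) z).
  rewrite RintegralZl//; last first.
    apply: (integrableS _ _ _ (integrable_indic_itv (1 : R) 2 true false)) => //.
  rewrite /Rintegral integral_indic//=.
  rewrite (_ : _ `&` _ = `[1, 2]%classic); last first.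
    apply/setIidPl => z; rewrite /= !in_itv/= => /andP[z1 _]; rewrite andbT.
    exact: lt_le_trans z1.
  rewrite lebesgue_measure_itv/= lte_fin ltr1n/=; ring.
apply: le_Rintegral => //.
- have := integrableS measurableT measurable_Rp (@subsetT _ _) (integrable_indic_itv (1 : R) 2 true false).
  by move=> H; exact: (integrableZl measurable_Rp m H).
- move=> z; rewrite /= in_itv/= andbT => z0.
  rewrite indicE; case: (boolP (z \in _)) => [|_]; last first.
    by rewrite mulr0 mulr_ge0 ?powR_ge0 ?onem_cos_ge0.
  rewrite inE/= in_itv/= => /andP[z1 z2]; rewrite mulr1 ler_pM ?powR_ge0 ?onem_cos_ge0//.
    rewrite -opprD !powRN lef_pV2 ?posrE ?powR_gt0//.
    by case/andP : a02 => *; apply: ge0_ler_powR; rewrite ?nnegrE; lra.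
  rewrite lerD2l lerN2.
  have p2 := @pi_ge2 R; rewrite leNgt ltr_cos -?leNgt// in_itv/=.
    by apply/andP; split; lra.
  by apply/andP; split; lra.
Qed.

(** This identifies c_alpha: the jump measure c_alpha |z|^(-1-alpha) has exponent
|b|^alpha.  It also represents b^alpha as an average of 1 - cos (b z), which is what
the moment bounds rest on. *)
Lemma levy_integralE alpha b : 0 < alpha < 2 -> 0 <= b ->
  2 * stable_const alpha *
  \int[mu]_(z in Rp) (z `^ (- 1 - alpha) * (1 - cos (b * z))) = b `^ alpha.
Proof.
move=> a02; have /andP[a0 a2] := a02.
rewrite le_eqVlt => /predU1P[<-|b0].
  under eq_Rintegral do rewrite mul0r cos0 subrr mulr0.
  by rewrite /Rintegral integral0/= mulr0 powR0// gt_eqF.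
rewrite levy_integral_homogeneous// -/(I alpha) mulrCA -[RHS]mulr1; congr (_ * _).
have I0 := levy_integral_gt0 a02; rewrite /stable_const; case: ifPn => [/eqP a1|a1].
  have p0 : pi != 0 :> R by rewrite gt_eqF ?pi_gt0.
  by rewrite a1 levy_integral_1; move: p0; move: (pi : R) => p p0; field.
have := levy_integral_ne1 a02; move: I0; move: (I alpha) => J J0 JE.
have aa : alpha * (alpha - 1) != 0.
  by apply: mulf_neq0; [rewrite gt_eqF|rewrite subr_eq0].
have gc : Gamma (2 - alpha) * cos (pi * alpha / 2) != 0.
  rewrite -oppr_eq0 -JE mulf_neq0// gt_eqF//.
have E : alpha * (alpha - 1) = - (Gamma (2 - alpha) * cos (pi * alpha / 2)) / J.
  by rewrite -JE mulfK// gt_eqF.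
rewrite E; move: gc; rewrite mulf_eq0 negb_or => /andP[g0 c0].
by field; rewrite g0 c0 gt_eqF.
Qed.

Lemma stable_const_gt0 alpha : 0 < alpha < 2 -> 0 < stable_const alpha.
Proof.
move=> a02; have := levy_integralE a02 (@ler01 R).
under eq_Rintegral do rewrite mul1r.
rewrite powR1 -/(I alpha) => E; have I0 := levy_integral_gt0 a02.
have := ltr01 (R := R); rewrite -E pmulr_lgt0// pmulr_rgt0//.
Qed.

End levy_constant.

(** * Densities from integrable characteristic functions *)

Section cosine_transform.
Context {R : realType}.
Notation mu := (@lebesgue_measure R).
Notation Rp := (`]0%R, +oo[%classic : set R).

(** The inverse Fourier transform at y of the even extension of h. *)
Definition cosine_transform (h : R -> R) (y : R) : R :=
  pi^-1 * \int[mu]_(u in Rp) (h u * cos (u * y)).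

Lemma measurable_cos2 : measurable_fun setT (fun z : R * R => cos (z.1 * z.2)).
Proof.
apply: measurableT_comp; first exact: continuous_measurable_fun (@continuous_cos R).
exact: measurable_funM.
Qed.

Lemma measurable_cosine_transform h : mu.-integrable Rp (EFin \o h) ->
  measurable_fun setT (cosine_transform h).
Proof.
move=> ih; apply: measurable_funM => //.
apply: (@measurable_kernel_integral _ _ R _ _ mu Rp measurable_Rp h (fun z => cos (z.2 * z.1)) 1 ih).
  apply: measurableT_comp; first exact: continuous_measurable_fun (@continuous_cos R).
  exact: measurable_funM.
by move=> z; exact: cos_max.
Qed.

Lemma integrableM_cos h y : mu.-integrable Rp (EFin \o h) ->
  mu.-integrable Rp (EFin \o (fun u => h u * cos (u * y))).
Proof.
move=> ih; apply: (@integrableM_bounded _ _ R mu Rp _ _ 1 measurable_Rp ih).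
  apply: measurable_funTS; apply: measurableT_comp; first exact: continuous_measurable_fun (@continuous_cos R).
  exact: measurable_funM.
by move=> z _; exact: cos_max.
Qed.

Lemma normr_cosine_transform h y : mu.-integrable Rp (EFin \o h) ->
  `|cosine_transform h y| <= pi^-1 * \int[mu]_(u in Rp) `|h u|.
Proof.
move=> ih; rewrite normrM ger0_norm ?invr_ge0 ?pi_ge0// ler_wpM2l ?invr_ge0 ?pi_ge0//.
have iy := integrableM_cos y ih.
apply: (le_trans (le_normr_Rintegral measurable_Rp iy)).
apply: le_Rintegral => //.
- exact: integrable_norm iy.
- exact: integrable_norm ih.
- by move=> u _; rewrite normrM ler_piMr// cos_max.
Qed.

Definition cauchy_kernel (s v : R) := s / (s ^+ 2 + v ^+ 2).

Lemma integrable_expRM (s : R) : 0 < s -> mu.-integrable Rp (EFin \o (fun u => expR (- (s * u)))).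
Proof.
move=> s0; pose f (x : R) := expR (- (s * x)).
apply: (@integrable_FTC_Rp R (fun u => expR (- (s * u))) (fun u => - s^-1 * expR (- (s * u))) s^-1).
- by move=> x _; rewrite expR_ge0.
- move=> x _.
  exact: (is_derive_continuous (@is_derive1O _ expR (fun u => - (s * u)) x _ _ (is_derive_expR _)
    (is_derive1N (is_derive1Ml s (is_derive1I x))))).
- move=> x _.
  have h := is_derive1Ml (- s^-1) (@is_derive1O _ expR (fun u => - (s * u)) x _ _ (is_derive_expR _)
    (is_derive1N (is_derive1Ml s (is_derive1I x)))).
  apply: (is_derive_eqr h); field; exact: lt0r_neq0.
- move=> x x0; have s'0 : 0 <= s^-1 by rewrite invr_ge0 ltW.
  rewrite normrM normrN (ger0_norm s'0) (ger0_norm (expR_ge0 _)).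
  by rewrite ler_piMr ?invr_ge0 ?(ltW s0)// expR_le1 oppr_le0 mulr_ge0 ?(ltW s0)// ltW.
Qed.

(** The Cauchy kernel is the approximate identity whose Fourier side is e^(-s u). *)
Lemma cauchy_kernelE (s v : R) : 0 < s ->
  \int[mu]_(u in Rp) (expR (- (s * u)) * cos (u * v)) = cauchy_kernel s v.
Proof.
move=> s0; rewrite (Rintegral_Rp_scale (k := s^-1)) ?invr_gt0//; last first.
  exact: integrableM_cos (integrable_expRM s0).
transitivity (s^-1 * \int[mu]_(z in Rp) (cos (v / s * z) * expR (- z))).
  congr (_ * _); apply: eq_Rintegral => z _.
  rewrite mulVKf ?gt_eqF// mulrC; congr (cos _ * _); ring.
rewrite laplace_cos /cauchy_kernel; field.
by rewrite !gt_eqF// ltr_pwDl ?exprn_gt0 ?sqr_ge0//.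
Qed.

Lemma cauchy_kernel_ge0 (s v : R) : 0 < s -> 0 <= cauchy_kernel s v.
Proof. by move=> s0; rewrite divr_ge0 ?addr_ge0 ?sqr_ge0// ltW. Qed.

Lemma cauchy_kernel_le (s v : R) : 0 < s -> cauchy_kernel s v <= s^-1.
Proof.
move=> s0; rewrite ler_pdivrMr ?ltr_pwDl ?exprn_gt0 ?sqr_ge0//.
rewrite mulrDr expr2 mulKf ?gt_eqF// lerDl mulr_ge0 ?sqr_ge0// invr_ge0 ltW//.
Qed.

Lemma continuous_cauchy_kernel (s x : R) : 0 < s -> continuous (fun y => cauchy_kernel s (x - y)).
Proof.
move=> s0 y; apply: (@is_derive_continuous _ _ _ (2 * s * (x - y) / (s ^+ 2 + (x - y) ^+ 2) ^+ 2)).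
have d0 : s ^+ 2 + (x - y) * (x - y) != 0.
  by rewrite -expr2 gt_eqF// ltr_pwDl ?exprn_gt0 ?sqr_ge0.
have di := is_derive1B (is_derive1C x y) (is_derive1I y).
have h := is_derive1Ml s (@is_deriveV R (fun y => s ^+ 2 + (x - y) * (x - y)) y _ 1 d0
  (is_derive1D (is_derive1C (s ^+ 2) y) (is_derive1M di di))).
apply: (is_derive_eqr h); rewrite /GRing.scale/=; field; exact: d0.
Qed.

Lemma Rintegral_cauchy_kernel (s x a b : R) : 0 < s -> a < b ->
  \int[mu]_(y in `[a, b]) cauchy_kernel s (x - y) = atan ((b - x) / s) - atan ((a - x) / s).
Proof.
move=> s0 ab; pose F y := atan ((y - x) / s).
have dF (y : R) : is_derive y 1 F (cauchy_kernel s (x - y)).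
  have h := @is_derive1O _ atan (fun y => (y - x) / s) y _ _ (is_derive1_atan _)
    (is_derive1M (is_derive1B (is_derive1I y) (is_derive1C x y)) (is_derive1C s^-1 y)).
  apply: (is_derive_eqr h); rewrite /cauchy_kernel.
  have d0 : s ^+ 2 + (x - y) ^+ 2 != 0 by rewrite gt_eqF// ltr_pwDl ?exprn_gt0 ?sqr_ge0.
  have d1 : 1 + ((y - x) / s) ^+ 2 != 0 by rewrite gt_eqF// ltr_pwDl ?sqr_ge0.
  have -> : 1 + ((y - x) / s) ^+ 2 = (s ^+ 2 + (x - y) ^+ 2) / s ^+ 2.
    by field; rewrite gt_eqF.
  by field; rewrite d0 gt_eqF.
rewrite /Rintegral (@continuous_FTC2 _ _ F)//.
- by apply: continuous_subspaceT; exact: continuous_cauchy_kernel.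
- split.
  + by move=> y _; exact: (@ex_derive _ _ _ _ _ _ _ (dF y)).
  + by apply: cvg_at_right_filter; exact: is_derive_continuous (dF a).
  + by apply: cvg_at_left_filter; exact: is_derive_continuous (dF b).
- by move=> y _; rewrite derive1E; exact: (@derive_val _ _ _ _ _ _ _ (dF y)).
Qed.

End cosine_transform.

Section inversion.
Context {R : realType} d (T : measurableType d) (P : probability T R).
Notation mu := (@lebesgue_measure R).
Notation Rp := (`]0%R, +oo[%classic : set R).
Variables (X : T -> R) (phi : R -> R).
Hypotheses (mX : measurable_fun setT X) (iphi : mu.-integrable Rp (EFin \o phi)).
Hypothesis cosX : forall u, 0 < u -> \int[P]_w cos (u * X w) = phi u.
Hypothesis sinX : forall u, 0 < u -> \int[P]_w sin (u * X w) = 0.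

Let p := cosine_transform phi.
Let mp : measurable_fun setT p := measurable_cosine_transform iphi.
Let K := pi^-1 * \int[mu]_(u in Rp) `|phi u|.
Let K0 : 0 <= K.
Proof. by rewrite mulr_ge0 ?invr_ge0 ?pi_ge0// Rintegral_ge0. Qed.

Let bounded_integrable (h : T -> R) (M : R) : measurable_fun setT h ->
  (forall w, `|h w| <= M) -> P.-integrable setT (EFin \o h).
Proof.
move=> mh hM; have i1 := @finite_measure_integrable_cst _ _ _ P setT 1 measurableT.
have := @integrableM_bounded _ _ _ P setT (cst 1) h M measurableT i1 mh (fun w _ => hM w).
by apply: eq_integrable => // w _ /=; rewrite mul1r.
Qed.

Let cosXB (u y : R) : 0 < u -> \int[P]_w cos (u * (X w - y)) = phi u * cos (u * y).
Proof.
move=> u0.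
have mc : measurable_fun setT (fun w => cos (u * X w)).
  apply: measurableT_comp; first exact: continuous_measurable_fun (@continuous_cos R).
  exact: measurable_funM.
have ms : measurable_fun setT (fun w => sin (u * X w)).
  apply: measurableT_comp; first exact: continuous_measurable_fun (@continuous_sin R).
  exact: measurable_funM.
have ic := bounded_integrable mc (fun w => cos_max _).
have is_ := bounded_integrable ms (fun w => sin_max _).
transitivity (\int[P]_w (cos (u * y) * cos (u * X w) + sin (u * y) * sin (u * X w))).
  by apply: eq_Rintegral => w _; rewrite mulrBr cosB; ring.
rewrite RintegralD//; last 2 first.
- exact: (integrableZl measurableT _ ic).
- exact: (integrableZl measurableT _ is_).
by rewrite !RintegralZl// cosX// sinX// mulr0 addr0 mulrC.
Qed.

Let q (s y : R) := cosine_transform (fun u => expR (- (s * u)) * phi u) y.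

(** Damping phi by e^(-s u) convolves the law of X with the Cauchy density of scale s. *)
Let qE (s y : R) : 0 < s -> q s y = \int[P]_w (pi^-1 * cauchy_kernel s (X w - y)).
Proof.
move=> s0.
have mk : measurable_fun setT (fun w => cauchy_kernel s (X w - y)).
  have := continuous_measurable_fun (@continuous_cauchy_kernel R s 0 s0).
  move=> h; have -> : (fun w => cauchy_kernel s (X w - y)) =
      (fun y => cauchy_kernel s (0 - y)) \o (fun w => y - X w).
    by apply/funext => w /=; congr cauchy_kernel; ring.
  by apply: measurableT_comp => //; exact: measurable_funB.
have ik : P.-integrable setT (EFin \o (fun w => cauchy_kernel s (X w - y))).
  apply: (bounded_integrable mk (M := s^-1)) => w.
  by rewrite ger0_norm ?cauchy_kernel_ge0// cauchy_kernel_le.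
rewrite RintegralZl//; congr (_ * _).
transitivity (\int[mu]_(u in Rp) (expR (- (s * u)) * \int[P]_w (1 * cos (u * (X w - y))))).
  apply: eq_Rintegral => u; rewrite inE/= in_itv/= andbT => u0.
  rewrite -mulrA -cosXB//; congr (_ * _).
  by apply: eq_Rintegral => w _; rewrite mul1r.
rewrite (@fubini_kernel _ _ _ _ _ mu P Rp setT measurable_Rp measurableT
  (fun u => expR (- (s * u))) (fun=> 1) (fun z => cos (z.1 * (X z.2 - y))) 1).
- apply: eq_Rintegral => w _; rewrite mul1r -cauchy_kernelE//.
- exact: integrable_expRM.
- exact: finite_measure_integrable_cst.
- apply: measurableT_comp; first exact: continuous_measurable_fun (@continuous_cos R).
  apply: measurable_funM => //; apply: measurable_funB => //.
  exact: measurableT_comp.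
- by move=> z; exact: cos_max.
Qed.

Let sn (n : nat) : R := n.+1%:R^-1.
Let sn0 n : 0 < sn n. Proof. by rewrite invr_gt0. Qed.

Let idamped (s : R) : 0 < s -> mu.-integrable Rp (EFin \o (fun u => expR (- (s * u)) * phi u)).
Proof.
move=> s0.
have := @integrableM_bounded _ _ R mu Rp phi (fun u => expR (- (s * u))) 1 measurable_Rp iphi.
move=> H; have := H _ _.
rewrite (_ : (fun x => phi x * _) = (fun u => expR (- (s * u)) * phi u)).
  apply.
    apply: measurable_funTS; apply: measurableT_comp => //.
    by apply: measurable_funN; apply: measurable_funM.
  move=> z; rewrite /= in_itv/= andbT => z0.
  by rewrite ger0_norm ?expR_ge0// expR_le1 oppr_le0 mulr_ge0// ltW.
by apply/funext => u; rewrite mulrC.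
Qed.

Let q_cvg (y : R) : q (sn n) y @[n --> \oo] --> p y.
Proof.
apply: cvgMl_tmp.
apply: (@cvg_Rintegral _ _ R mu Rp measurable_Rp
  (fun n u => expR (- (sn n * u)) * phi u * cos (u * y)) (fun u => phi u * cos (u * y))
  (fun u => `|phi u|)).
- by move=> n; case/integrableP : (integrableM_cos y (idamped (sn0 n))) => /measurable_EFinP.
- move=> u _; apply: cvgMr_tmp; rewrite -[X in _ --> X]mul1r; apply: cvgMr_tmp.
  rewrite -[X in _ --> X](@expR0 R); apply: continuous_cvg; first exact: continuous_expR.
  rewrite -[X in _ --> X]oppr0 -[X in _ --> - X](mul0r u).
  by apply: cvgN; apply: cvgMr_tmp; exact: (@cvg_harmonic R).
- exact: integrable_norm iphi.
- move=> n u; rewrite /= in_itv/= andbT => u0.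
  rewrite normrM -[leRHS]mulr1 ler_pM ?cos_max//.
  rewrite normrM ler_piMl// ger0_norm ?expR_ge0// expR_le1 oppr_le0 mulr_ge0 ?(ltW (sn0 _))//.
  exact: ltW.
Qed.

Let q_ge0 n y : 0 <= q (sn n) y.
Proof.
rewrite qE//; apply: Rintegral_ge0 => w _.
by rewrite mulr_ge0 ?invr_ge0 ?pi_ge0// cauchy_kernel_ge0.
Qed.

Let q_le n y : `|q (sn n) y| <= K.
Proof.
apply: (le_trans (normr_cosine_transform _ (idamped (sn0 n)))).
rewrite ler_wpM2l ?invr_ge0 ?pi_ge0//; apply: le_Rintegral => //.
- exact: integrable_norm (idamped (sn0 n)).
- exact: integrable_norm iphi.
- move=> u; rewrite /= in_itv/= andbT => u0.
  rewrite normrM ler_piMl// ger0_norm ?expR_ge0// expR_le1 oppr_le0 mulr_ge0 ?(ltW (sn0 _))//.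
  exact: ltW.
Qed.

(** The transform of an integrable characteristic function is the pointwise limit of the
Cauchy-smoothed densities, which are nonnegative. *)
Lemma cosine_transform_ge0 y : 0 <= cosine_transform phi y.
Proof.
rewrite -/(p y) -(cvg_lim _ (@q_cvg y))//.
apply: limr_ge; first by apply/cvg_ex; exists (p y); exact: q_cvg.
by apply: nearW => n; exact: q_ge0.
Qed.

(** theta s is the Cauchy probability of [a, b] around x; its limit theta0 as s tends to 0
is the indicator of [a, b], with value 1/2 at both ends. *)
Let theta (s a b x : R) := pi^-1 * (atan ((b - x) / s) - atan ((a - x) / s)).
Let theta0 (a b x : R) : R := (Num.sg (b - x) - Num.sg (a - x)) / 2.

Let theta_cvg (a b x : R) : theta (sn n) a b x @[n --> \oo] --> theta0 a b x.
Proof.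
have atn (v : R) : atan (v / sn n) @[n --> \oo] --> pi / 2 * Num.sg v.
  have S_cvgy : (n.+1%:R : R) @[n --> \oo] --> +oo.
    by have := cvgr_idn (R := R); rewrite -(cvg_shiftn 1); under eq_fun do rewrite addn1.
  rewrite /sn; under eq_fun do rewrite invrK.
  have pos (t : R) : 0 < t -> atan (t * n.+1%:R) @[n --> \oo] --> pi / 2.
    move=> t0; apply: (cvg_comp (fun n => t * n.+1%:R) (@atan R) _ (@cvgy_atan R)).
    apply/cvgryPge => A; near=> n; rewrite mulrC -ler_pdivrMr//.
    by near: n; exact: (cvgryPge (R := R) _).1.
  have [v0|v0|->] := ltgtP v 0.
  - rewrite ltr0_sg// mulrN1.
    have -> : (fun n => atan (v * n.+1%:R)) = (fun n => - atan (- v * n.+1%:R)).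
      by apply/funext => n; rewrite mulNr atanN opprK.
    by apply: cvgN; apply: pos; rewrite oppr_gt0.
  - by rewrite gtr0_sg// mulr1; exact: pos.
  - by rewrite sgr0 mulr0; under eq_fun do rewrite mul0r atan0; exact: cvg_cst.
rewrite /theta /theta0.
have -> : (Num.sg (b - x) - Num.sg (a - x)) / 2 =
    pi^-1 * (pi / 2 * Num.sg (b - x) - pi / 2 * Num.sg (a - x)).
  have := pi_gt0 R; move: (pi : R) => pp pp0; field; exact: lt0r_neq0.
by apply: cvgMl_tmp; apply: cvgB; exact: atn.
Unshelve. all: by end_near.
Qed.

Let matan (s a : R) : measurable_fun setT (fun w => atan ((a - X w) / s)).
Proof.
apply: measurableT_comp; first exact: continuous_measurable_fun (@continuous_atan R).
by apply: measurable_funM => //; exact: measurable_funB.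
Qed.

Let theta_le (s a b x : R) : `|theta s a b x| <= 1.
Proof.
have pp := pi_gt0 R.
rewrite normrM ger0_norm ?invr_ge0 ?pi_ge0// mulrC ler_pdivrMr// mul1r ler_norml.
have h1 := atan_ltpi2 ((b - x) / s); have h2 := atan_gtNpi2 ((b - x) / s).
have h3 := atan_ltpi2 ((a - x) / s); have h4 := atan_gtNpi2 ((a - x) / s).
by apply/andP; split; lra.
Qed.

Let interval_formula (a b : R) : a < b ->
  \int[mu]_(y in `[a, b]) p y = \int[P]_w theta0 a b (X w).
Proof.
move=> ab.
have i1 : mu.-integrable `[a, b] (EFin \o cst (1 : R)).
  apply: continuous_compact_integrable; first exact: segment_compact.
  by apply: continuous_subspaceT => x; exact: cvg_cst.
have E n : \int[mu]_(y in `[a, b]) q (sn n) y = \int[P]_w theta (sn n) a b (X w).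
  transitivity (\int[mu]_(y in `[a, b]) (1 * \int[P]_w (1 * (pi^-1 * cauchy_kernel (sn n) (X w - y))))).
    apply: eq_Rintegral => y _; rewrite mul1r qE//.
    by apply: eq_Rintegral => w _; rewrite mul1r.
  rewrite (@fubini_kernel _ _ _ _ _ mu P `[a, b]%classic setT (measurable_itv _) measurableT
    (fun=> 1) (fun=> 1) (fun z => pi^-1 * cauchy_kernel (sn n) (X z.2 - z.1)) (pi^-1 * (sn n)^-1)).
  - apply: eq_Rintegral => w _; rewrite mul1r.
    rewrite /theta -Rintegral_cauchy_kernel// -RintegralZl//.
      by apply: eq_Rintegral => y _; rewrite mul1r.
    apply: continuous_compact_integrable; first exact: segment_compact.
    by apply: continuous_subspaceT; exact: continuous_cauchy_kernel.
  - exact: i1.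
  - exact: finite_measure_integrable_cst.
  - apply: measurable_funM => //.
    have := continuous_measurable_fun (@continuous_cauchy_kernel R (sn n) 0 (sn0 n)).
    move=> h; have -> : (fun z : R * T => cauchy_kernel (sn n) (X z.2 - z.1)) =
        (fun y => cauchy_kernel (sn n) (0 - y)) \o (fun z => z.1 - X z.2).
      by apply/funext => w /=; congr cauchy_kernel; ring.
    apply: measurableT_comp => //; apply: measurable_funB => //.
    exact: measurableT_comp.
  - move=> z; rewrite normrM !ger0_norm ?cauchy_kernel_ge0 ?invr_ge0 ?pi_ge0//.
    by rewrite ler_wpM2l ?invr_ge0 ?pi_ge0// cauchy_kernel_le.
have lim1 : \int[mu]_(y in `[a, b]) q (sn n) y @[n --> \oo] --> \int[mu]_(y in `[a, b]) p y.
  apply: (@cvg_Rintegral _ _ R mu `[a, b]%classic (measurable_itv _) (fun n => q (sn n)) p (fun=> K)).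
  - by move=> n; apply: measurable_funTS; exact: measurable_cosine_transform (idamped (sn0 n)).
  - by move=> y _; exact: q_cvg.
  - apply: continuous_compact_integrable; first exact: segment_compact.
    by apply: continuous_subspaceT => x; exact: cvg_cst.
  - by move=> n y _; exact: q_le.
apply: (cvg_unique _ lim1) => //.
have -> : (fun n => \int[mu]_(y in `[a, b]) q (sn n) y) =
  (fun n => \int[P]_w theta (sn n) a b (X w)) by apply/funext => n; exact: E.
apply: (@cvg_Rintegral _ _ R P setT measurableT (fun n w => theta (sn n) a b (X w))
  (fun w => theta0 a b (X w)) (fun=> 1)) => //.
- move=> n; apply: measurable_funM => //.
  by apply: measurable_funB; exact: matan.
- exact: finite_measure_integrable_cst.
Qed.

Let mtheta0 (a b : R) : measurable_fun setT (fun w => theta0 a b (X w)).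
Proof.
apply: (@dominated_limit_measurable _ _ _ setT (fun n w => theta (sn n) a b (X w))) => //.
- move=> n; apply: measurable_funM => //.
  by apply: measurable_funB; exact: matan.
Qed.

Let theta0E (a b x : R) : a < b -> theta0 a b x = \1_(`]a, b]%classic) x
  + 2^-1 * \1_([set a]) x - 2^-1 * \1_([set b]) x.
Proof.
move=> ab; rewrite /theta0 !indicE.
have mem (A : set R) : (x \in A) = `[< A x >] by apply/idP/asboolP; rewrite inE.
have [xa|xa|xa] := ltgtP x a.
- rewrite !gtr0_sg ?subr_gt0//; last exact: lt_trans ab.
  rewrite memNset ?memNset ?memNset/=; first by lra.
  + by move=> /= xb; move: xa; rewrite xb; lra.
  + by move=> /= xb; move: xa; rewrite xb; lra.
  + by rewrite in_itv/=; move=> /andP[]; lra.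
- have [xb|xb|xb] := ltgtP x b.
  + rewrite gtr0_sg ?subr_gt0// ltr0_sg ?subr_lt0//.
    rewrite mem_set/=; last by rewrite in_itv/= xa ltW.
    rewrite memNset ?memNset/=; first by lra.
      by move=> xb'; lra.
    by move=> xb'; lra.
  + rewrite !ltr0_sg ?subr_lt0//.
    rewrite memNset ?memNset ?memNset/=; first by lra.
    * by move=> xb'; lra.
    * by move=> xb'; lra.
    * by rewrite in_itv/=; move=> /andP[]; lra.
  + rewrite xb subrr sgr0 ltr0_sg ?subr_lt0//.
    rewrite mem_set/=; last by rewrite in_itv/= ab lexx.
    rewrite memNset ?mem_set/=; first by lra.
    * by [].
    * by move=> xb'; lra.
- rewrite xa subrr sgr0 gtr0_sg ?subr_gt0//.
  rewrite memNset/=; last by rewrite in_itv/= ltxx.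
  rewrite mem_set//= memNset/=; first by lra.
  by move=> xb'; lra.
Qed.

Let iindic (A : set R) : measurable A -> P.-integrable setT (EFin \o (fun w => \1_A (X w))).
Proof.
move=> mA; apply: (bounded_integrable (M := 1)).
  by apply: measurableT_comp => //; exact: measurable_indic.
by move=> w; rewrite indicE; case: (_ \in _); rewrite ?normr1 ?normr0.
Qed.

Let Eindic (A : set R) : measurable A -> \int[P]_w (\1_A (X w)) = fine (P (X @^-1` A)).
Proof.
move=> mA; rewrite /Rintegral.
rewrite (_ : (fun w => (\1_A (X w))%:E) = (fun w => (\1_(X @^-1` A) w)%:E)).
  by rewrite integral_indic ?setIT// -[X @^-1` A]setTI; exact: mX.
by apply/funext => w; rewrite !indicE; congr (nat_of_bool _)%:R%:E; apply/idP/idP; rewrite !inE.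
Qed.

Let iK (a b : R) : mu.-integrable `[a, b] (EFin \o p).
Proof.
apply: (@le_integrable_fin _ _ R mu `[a, b]%classic p (fun=> K)) => //.
- exact: measurable_funTS.
- apply: continuous_compact_integrable; first exact: segment_compact.
  by apply: continuous_subspaceT => x; exact: cvg_cst.
- by move=> y _; exact: normr_cosine_transform.
Qed.

(** The interval formula counts half of an atom at the left end of [c, c + h], while the
transform is bounded: the mass at c is at most a multiple of h. *)
Let no_atom (c : R) : P (X @^-1` [set c]) = 0%E.
Proof.
have fP : P (X @^-1` [set c]) \is a fin_num.
  by apply: fin_num_measure; rewrite -[X @^-1` _]setTI; exact: mX.
rewrite -[LHS]fineK//; congr EFin; apply/eqP; rewrite eq_le; apply/andP; split; last first.
  exact: fine_ge0.
apply/ler_addgt0Pr => e e0; rewrite add0r.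
pose h := e / (2 * (K + 1)).
have K1 : 0 < K + 1 by rewrite ltr_wpDl.
have h0 : 0 < h by rewrite divr_gt0// mulr_gt0.
have ch : c < c + h by rewrite ltrDl.
have := interval_formula ch => E.
have le1 : \int[mu]_(y in `[c, c + h]) p y <= K * h.
  apply: (@le_trans _ _ (\int[mu]_(y in `[c, c + h]) K)).
    apply: le_Rintegral => //.
    - apply: continuous_compact_integrable; first exact: segment_compact.
      by apply: continuous_subspaceT => x; exact: cvg_cst.
    - move=> y _; apply: le_trans (normr_cosine_transform y iphi).
      exact: ler_norm.
  rewrite Rintegral_cst//= lebesgue_measure_itv/= lte_fin ch.
  by rewrite (_ : fine _ = h)//= addrC addKr.
have ge1 : 2^-1 * fine (P (X @^-1` [set c])) <= \int[P]_w theta0 c (c + h) (X w).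
  rewrite -Eindic// -RintegralZl//; last exact: iindic.
  apply: le_Rintegral => //.
  - exact: (integrableZl measurableT _ (iindic (measurable_set1 c))).
  - apply: (bounded_integrable (M := 1)); first exact: mtheta0.
    move=> w; rewrite /theta0 normrM [`|2^-1|]ger0_norm// ler_pdivrMr// mul1r.
    rewrite (le_trans (ler_normB _ _))// (_ : 2 = 1 + 1)//.
    by rewrite lerD// normr_sg; case: (_ == _).
  - move=> w _; rewrite /theta0 indicE; move: (X w) => x.
    have [xc|cx|->] := ltgtP x c.
    + rewrite memNset/=; last by move=> /= xc'; lra.
      by rewrite !gtr0_sg ?subr_gt0//; [lra|exact: lt_trans ch].
    + rewrite memNset/=; last by move=> /= xc'; lra.
      rewrite (ltr0_sg (x := c - x)) ?subr_lt0//.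
      have : -1 <= Num.sg (c + h - x) by case: sgrP; lra.
      lra.
    + rewrite mem_set//= subrr sgr0 subr0 gtr0_sg//; first by lra.
      by rewrite addrAC subrr add0r.
rewrite -E in ge1.
have : 2^-1 * fine (P (X @^-1` [set c])) <= K * h by exact: le_trans ge1 le1.
have KhE : K * h <= e / 2.
  rewrite /h mulrA ler_pdivrMr ?mulr_gt0//.
  rewrite (_ : e / 2 * (2 * (K + 1)) = e * (K + 1)); last by field.
  by rewrite mulrC ler_pM2l// lerDl.
by move=> ?; lra.
Qed.

Let interval_density (a b : R) : a < b ->
  P (X @^-1` `]a, b]) = (\int[mu]_(y in `]a, b]) (p y)%:E)%E.
Proof.
move=> ab.
have mE (A : set R) : measurable A -> measurable (X @^-1` A).
  by move=> mA; rewrite -[X @^-1` _]setTI; exact: mX.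
rewrite integral_itv_obnd_cbnd; last by apply/measurable_EFinP; exact: measurable_funTS.
rewrite -[LHS]fineK; last exact/fin_num_measure/mE.
rewrite -[RHS]fineK; last by apply: integrable_fin_num => //; exact: iK.
congr EFin; rewrite -[RHS]/(\int[mu]_(y in `[a, b]) p y) interval_formula//.
rewrite (_ : (fun w => theta0 a b (X w)) = (fun w => \1_(`]a, b]%classic) (X w)
  + 2^-1 * \1_([set a]) (X w) - 2^-1 * \1_([set b]) (X w))); last first.
  by apply/funext => w; rewrite theta0E.
have ia := integrableZl measurableT 2^-1 (iindic (measurable_set1 a)).
have ib := integrableZl measurableT 2^-1 (iindic (measurable_set1 b)).
have iab := iindic (measurable_itv `]a, b]).
rewrite RintegralB//; last exact: (integrableD measurableT iab ia).
rewrite RintegralD// !RintegralZl//; [|exact: iindic..].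
by rewrite !Eindic// !no_atom/= !mulr0 addr0 subr0.
Qed.

Let nu (A : set (measurableTypeR R)) : \bar R := (\int[mu]_(y in A) (p y)%:E)%E.

Let nu0 : nu set0 = 0%E. Proof. exact: integral_set0. Qed.

Let nu_ge0 A : (0 <= nu A)%E.
Proof. by apply: integral_ge0 => y _; rewrite lee_fin cosine_transform_ge0. Qed.

Let nu_sigma_additive : semi_sigma_additive nu.
Proof.
move=> F mF tF mUF; rewrite /nu ge0_integral_bigcup//.
- apply: is_cvg_ereal_nneg_natsum_cond => n _ _; exact: nu_ge0.
- by apply/measurable_EFinP; exact: measurable_funTS.
- by move=> y _; rewrite lee_fin cosine_transform_ge0.
Qed.

Let nu_mixin := isMeasure.Build _ _ _ nu nu0 nu_ge0 nu_sigma_additive.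
Let nu_measure : {measure set (measurableTypeR R) -> \bar R} := HB.pack nu nu_mixin.

Let X' : T -> measurableTypeR R := X.
Let mX' : measurable_fun setT X'. Proof. exact: mX. Qed.
Let law : {measure set (measurableTypeR R) -> \bar R} :=
  measure_function_pushforward__canonical__measure_function_Measure P mX'.

(** Inversion: the limit s -> 0 of the smoothed laws gives the probabilities of the
intervals ]a, b], which determine the law. *)
Lemma density_of_charfun (A : set R) : measurable A ->
  P (X @^-1` A) = (\int[mu]_(y in A) (cosine_transform phi y)%:E)%E.
Proof.
move=> mA.
have cover : \bigcup_n `](- n%:R), n%:R]%classic = [set: R].
  apply/seteqP; split => // x _; near \oo => n; exists n => //=.
  rewrite in_itv/=; apply/andP; split.
    rewrite ltrNl; near: n; exact: nbhs_infty_gtr.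
  by near: n; exact: nbhs_infty_ger.
have := @measure_unique _ R (measurableTypeR R) (@ocitv R) (fun n => `](- n%:R), n%:R]%classic)
  erefl (@ocitvI R) _ cover law nu_measure.
apply => //.
- by move=> n; exact: is_ocitv.
- move=> _ [[a b] _ <-]; rewrite /law/= /pushforward.
  have [ab|ba] := ltP a b; first exact: interval_density.
  by rewrite set_itv_ge ?bnd_simp -?leNgt// preimage_set0 measure0 nu0.
- move=> n; rewrite /law/= /pushforward.
  apply: le_lt_trans (ltry 1); apply: probability_le1.
  by rewrite -[X in measurable X]setTI; exact: mX.
Unshelve. all: by end_near.
Qed.

End inversion.

(** * Expectations and total variation through densities *)

Section image_density.
Context {R : realType} d (T : measurableType d) (nu : {measure set T -> \bar R}).
Notation mu := (@lebesgue_measure R).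
Variables (X : T -> R) (p : R -> R).
Hypotheses (mX : measurable_fun setT X) (mp : measurable_fun setT p).
Hypothesis p0 : forall y, 0 <= p y.
Hypothesis lawX : forall A : set R, measurable A ->
  nu (X @^-1` A) = (\int[mu]_(y in A) (p y)%:E)%E.

Let X' : T -> measurableTypeR R := X.
Let mX' : measurable_fun setT X'. Proof. exact: mX. Qed.
Let law : {measure set (measurableTypeR R) -> \bar R} :=
  measure_function_pushforward__canonical__measure_function_Measure nu mX'.

(** Stated for an arbitrary measure: besides the law of a random variable it covers a
Levy measure, with X the identity. *)
Lemma ge0_expectation_density (f : R -> \bar R) : measurable_fun setT f ->
  (forall x, (0 <= f x)%E) ->
  (\int[nu]_w f (X w) = \int[mu]_y (f y * (p y)%:E))%E.
Proof.
move=> mf f0.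
rewrite -(@ge0_integral_density _ (measurableTypeR R) R law mu p)//.
by rewrite (@ge0_integral_pushforward _ _ _ _ _ X' mX' nu setT f).
Qed.

End image_density.

Section expectation_density.
Context {R : realType} d (T : measurableType d) (P : probability T R).
Notation mu := (@lebesgue_measure R).
Variables (X : T -> R) (p : R -> R).
Hypotheses (mX : measurable_fun setT X) (mp : measurable_fun setT p).
Hypothesis p0 : forall y, 0 <= p y.
Hypothesis lawX : forall A : set R, measurable A ->
  P (X @^-1` A) = (\int[mu]_(y in A) (p y)%:E)%E.

Lemma integral_density1 : (\int[mu]_y (p y)%:E = 1)%E.
Proof. by rewrite -lawX// preimage_setT probability_setT. Qed.

Lemma integrable_density : mu.-integrable setT (EFin \o p).
Proof.
apply/integrableP; split; first exact/measurable_EFinP.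
have -> : (\int[mu]_x `|(EFin \o p) x| = \int[mu]_y (p y)%:E)%E.
  by apply: eq_integral => y _ /=; rewrite ger0_norm.
by rewrite integral_density1 ltry.
Qed.

Lemma expectation_density (h : R -> R) (M : R) : measurable_fun setT h ->
  (forall x, `|h x| <= M) ->
  \int[P]_w h (X w) = \int[mu]_y (h y * p y).
Proof.
move=> mh hM.
have M0 : 0 <= M by rewrite (le_trans _ (hM 0)).
have hM0 y : 0 <= h y + M.
  by have := hM y; rewrite ler_norml => /andP[]; lra.
have ip := integrable_density.
have ih : P.-integrable setT (EFin \o (fun w => h (X w))).
  have i1 := @finite_measure_integrable_cst _ _ _ P setT M measurableT.
  apply: (le_integrable_fin measurableT _ i1) => //.
  exact: measurableT_comp.
have iM := @finite_measure_integrable_cst _ _ _ P setT M measurableT.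
have ihp : mu.-integrable setT (EFin \o (fun y => h y * p y)).
  have := @integrableM_bounded _ _ _ mu setT p h M measurableT ip mh (fun y _ => hM y).
  by apply: eq_integrable => // y _ /=; rewrite mulrC.
have iMp := integrableZl measurableT M ip.
have E : \int[P]_w (h (X w) + M) = \int[mu]_y (h y * p y + M * p y).
  rewrite /Rintegral.
  rewrite (ge0_expectation_density mX mp p0 lawX (f := fun y => (h y + M)%:E)); last 2 first.
  - by apply/measurable_EFinP; exact: measurable_funD.
  - by move=> y; rewrite lee_fin.
  by congr fine; apply: eq_integral => y _; rewrite -EFinM mulrDl.
move: E; rewrite RintegralD// RintegralD//.
rewrite (RintegralZl M measurableT ip).
rewrite [\int[mu]_x p x]/Rintegral integral_density1/= mulr1.
rewrite (_ : \int[P]_x M = M); first by move/addIr.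
by rewrite Rintegral_cst//= probability_setT mulr1.
Qed.

End expectation_density.

Section total_variation.
Context {R : realType} d (T : measurableType d) (P : probability T R).
Notation mu := (@lebesgue_measure R).
Variables (X Y : T -> R) (p q : R -> R).
Hypotheses (mX : measurable_fun setT X) (mY : measurable_fun setT Y).
Hypotheses (mp : measurable_fun setT p) (mq : measurable_fun setT q).
Hypotheses (p0 : forall y, 0 <= p y) (q0 : forall y, 0 <= q y).
Hypothesis lawX : forall A : set R, measurable A ->
  P (X @^-1` A) = (\int[mu]_(y in A) (p y)%:E)%E.
Hypothesis lawY : forall A : set R, measurable A ->
  P (Y @^-1` A) = (\int[mu]_(y in A) (q y)%:E)%E.
Variable e : R.
Hypothesis pq : (\int[mu]_y `|p y - q y|%:E <= e%:E)%E.

Lemma expectation_dist (h : R -> R) (M : R) : measurable_fun setT h ->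
  (forall x, `|h x| <= M) ->
  `|\int[P]_w h (X w) - \int[P]_w h (Y w)| <= M * e.
Proof.
move=> mh hM; have M0 : 0 <= M by rewrite (le_trans _ (hM 0)).
have ip := integrable_density mp p0 lawX.
have iq := integrable_density mq q0 lawY.
rewrite (expectation_density mX mp p0 lawX mh hM) (expectation_density mY mq q0 lawY mh hM).
have bd f : mu.-integrable setT (EFin \o f) -> mu.-integrable setT (EFin \o (fun y => h y * f y)).
  move=> if_; have := @integrableM_bounded _ _ _ mu setT f h M measurableT if_ mh (fun y _ => hM y).
  by apply: eq_integrable => // y _ /=; rewrite mulrC.
rewrite -RintegralB//; [|exact: bd..].
have id := integrableB measurableT (bd _ ip) (bd _ iq).
apply: (le_trans (le_normr_Rintegral measurableT id)).
have idn := integrable_norm (integrableB measurableT ip iq).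
apply: (@le_trans _ _ (\int[mu]_y (M * `|p y - q y|))).
  apply: le_Rintegral => //.
  - exact: integrable_norm id.
  - exact: (integrableZl measurableT M idn).
  - by move=> y _; rewrite -mulrBr normrM ler_wpM2r.
rewrite (RintegralZl M measurableT idn) ler_wpM2l//.
by rewrite -lee_fin /Rintegral fineK//; exact: (integrable_fin_num measurableT idn).
Qed.

Lemma dTV_density : (dTV P X Y <= e%:E)%E.
Proof.
apply: ge_ereal_sup => _ [A mA <-].
have mXA : measurable (X @^-1` A) by rewrite -[X @^-1` _]setTI; exact: mX.
have mYA : measurable (Y @^-1` A) by rewrite -[Y @^-1` _]setTI; exact: mY.
have E (Z : T -> R) : measurable_fun setT Z -> P (Z @^-1` A) = (\int[P]_w \1_A (Z w))%:E.
  move=> mZ; have mZA : measurable (Z @^-1` A) by rewrite -[Z @^-1` _]setTI; exact: mZ.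
  rewrite /Rintegral (_ : (fun w => (\1_A (Z w))%:E) = (fun w => (\1_(Z @^-1` A) w)%:E)).
    by rewrite integral_indic ?setIT// fineK// fin_num_measure.
  by apply/funext => w; rewrite !indicE; congr (nat_of_bool _)%:R%:E; apply/idP/idP; rewrite !inE.
rewrite (E X mX) (E Y mY) -EFinB abse_EFin lee_fin -[leRHS]mul1r.
apply: expectation_dist; first exact: measurable_indic.
by move=> y; rewrite indicE; case: (_ \in _); rewrite ?normr1 ?normr0.
Qed.

End total_variation.

(** * Perturbation by a finite signed jump measure *)

Section fatou.
Context d (T : measurableType d) (R : realType) (m : {measure set T -> \bar R}).

Lemma le_integral_norm_limit (f_ : nat -> T -> R) (f : T -> R) (c : \bar R) :
  (forall n, measurable_fun setT (f_ n)) ->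
  (forall x, f_ n x @[n --> \oo] --> f x) ->
  (forall n, (\int[m]_x `|f_ n x|%:E <= c)%E) ->
  (\int[m]_x `|f x|%:E <= c)%E.
Proof.
move=> mf ff fc.
have mf' n : measurable_fun setT (fun x => `|f_ n x|%:E).
  by apply/measurable_EFinP; exact: measurableT_comp.
have := @fatou _ _ _ m setT measurableT (fun n x => `|f_ n x|%:E) mf' (fun n x _ => normr_ge0 _).
have -> : (\int[m]_x limn_einf (fun n => `|f_ n x|%:E) = \int[m]_x `|f x|%:E)%E.
  apply: eq_integral => x _.
  have h : `|f_ n x|%:E @[n --> \oo] --> `|f x|%:E.
    by apply: cvg_EFin; [exact: nearW|apply: cvg_norm; exact: ff].
  by rewrite is_cvg_limn_einfE; [exact: cvg_lim|apply/cvg_ex; exists `|f x|%:E].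
move=> /le_trans; apply.
rewrite limn_einf_lim; apply: lime_le; first exact: is_cvg_einfs.
apply: nearW => n; apply: le_trans (fc n).
by apply: ereal_inf_lbound; exists n => /=.
Qed.

End fatou.

Section perturbation.
Context {R : realType}.
Notation mu := (@lebesgue_measure R).
Notation Rp := (`]0%R, +oo[%classic : set R).
Variables (delta : R -> R) (eps : R).
Hypothesis idelta : mu.-integrable Rp (EFin \o delta).
Hypothesis delta_eps : \int[mu]_(z in Rp) `|delta z| <= eps.

Let D (u : R) := 2 * \int[mu]_(z in Rp) (delta z * (1 - cos (u * z))).

Let eps0 : 0 <= eps.
Proof. by apply: le_trans delta_eps; exact: Rintegral_ge0. Qed.

Let mcosu (u : R) : measurable_fun setT (fun z => 1 - cos (u * z)).
Proof. by apply: measurable_funB => //; exact: measurable_cosM. Qed.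

Let idc (u : R) : mu.-integrable Rp (EFin \o (fun z => delta z * (1 - cos (u * z)))).
Proof.
apply: (@integrableM_bounded _ _ R mu Rp _ _ 2 measurable_Rp idelta).
  by apply: measurable_funTS; exact: mcosu.
by move=> z _; rewrite ger0_norm ?onem_cos_ge0 ?onem_cos_le2.
Qed.

Lemma normr_levy_exponent_le (u : R) : `|D u| <= 4 * eps.
Proof.
rewrite normrM ger0_norm// (_ : 4 = 2 * 2); last by ring.
rewrite -mulrA ler_wpM2l//.
apply: (le_trans (le_normr_Rintegral measurable_Rp (idc u))).
apply: (@le_trans _ _ (\int[mu]_(z in Rp) (2 * `|delta z|))); last first.
  by rewrite (RintegralZl _ measurable_Rp (integrable_norm idelta)) ler_wpM2l.
apply: le_Rintegral => //.
- exact: integrable_norm (idc u).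
- exact: (integrableZl measurable_Rp _ (integrable_norm idelta)).
- move=> z _; rewrite normrM mulrC ler_wpM2r//.
  by rewrite ger0_norm ?onem_cos_ge0 ?onem_cos_le2.
Qed.

Lemma measurable_levy_exponent : measurable_fun setT D.
Proof.
apply: measurable_funM => //.
apply: (@measurable_kernel_integral _ _ R _ _ mu Rp measurable_Rp delta
   (fun z => 1 - cos (z.1 * z.2)) 2 idelta).
  by apply: measurable_funB => //; exact: measurable_cos2.
by move=> z; rewrite ger0_norm ?onem_cos_ge0 ?onem_cos_le2.
Qed.

Lemma integrableM_levy_exponent (h : R -> R) : mu.-integrable Rp (EFin \o h) ->
  mu.-integrable Rp (EFin \o (fun u => h u * D u)).
Proof.
move=> ih; apply: (@integrableM_bounded _ _ R mu Rp _ _ (4 * eps) measurable_Rp ih).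
  by apply: measurable_funTS; exact: measurable_levy_exponent.
by move=> u _; exact: normr_levy_exponent_le.
Qed.

Section one_factor.
Variable h : R -> R.
Hypothesis ih : mu.-integrable Rp (EFin \o h).
Let A := cosine_transform h.
Let mA : measurable_fun setT A := measurable_cosine_transform ih.

Let second_difference (y z : R) := 2 * A y - A (y + z) - A (y - z).

(** cos (u (y+z)) + cos (u (y-z)) = 2 cos (u y) cos (u z): multiplication by the exponent
D becomes averaging of second differences. *)
Lemma cosine_transform_levy (y : R) :
  cosine_transform (fun u => h u * D u) y =
  \int[mu]_(z in Rp) (delta z * second_difference y z).
Proof.
pose b (w : R * R) := 2 * cos (w.1 * y) - cos (w.1 * (y + w.2)) - cos (w.1 * (y - w.2)).
have mb : measurable_fun setT b.
  apply: measurable_funB; first apply: measurable_funB.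
  - apply: measurable_funM => //; apply: measurableT_comp.
      exact: continuous_measurable_fun (@continuous_cos R).
    exact: measurable_funM.
  - apply: measurableT_comp; first exact: continuous_measurable_fun (@continuous_cos R).
    by apply: measurable_funM => //; exact: measurable_funD.
  - apply: measurableT_comp; first exact: continuous_measurable_fun (@continuous_cos R).
    by apply: measurable_funM => //; exact: measurable_funB.
have b4 w : `|b w| <= 4.
  rewrite /b; have := cos_le1 (w.1 * y); have := cos_geN1 (w.1 * y).
  have := cos_le1 (w.1 * (y + w.2)); have := cos_geN1 (w.1 * (y + w.2)).
  have := cos_le1 (w.1 * (y - w.2)); have := cos_geN1 (w.1 * (y - w.2)).
  by move=> *; rewrite ler_norml; apply/andP; split; lra.
transitivity (pi^-1 * \int[mu]_(u in Rp) (h u * \int[mu]_(z in Rp) (delta z * b (u, z)))).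
  congr (_ * _); apply: eq_Rintegral => u _.
  rewrite -mulrA; congr (_ * _); rewrite /D -mulrA mulrC -mulrA.
  rewrite -(RintegralZr _ measurable_Rp (idc u)).
  apply: eq_Rintegral => z _; rewrite /b/=.
  by rewrite (mulrDr u y z) (mulrBr u y z) cosD cosB; ring.
rewrite (@fubini_kernel _ _ _ _ _ mu mu Rp Rp measurable_Rp measurable_Rp h delta b 4)//.
rewrite -(RintegralZl _ measurable_Rp); last first.
  apply: (@integrableM_bounded _ _ R mu Rp _ _ (4 * \int[mu]_(u in Rp) `|h u|) measurable_Rp idelta).
    apply: measurable_funTS.
    apply: (@measurable_kernel_integral _ _ R _ _ mu Rp measurable_Rp h
      (fun w => b (w.2, w.1)) 4 ih) => //.
    by apply: measurableT_comp => //; exact: measurable_swap.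
  move=> z _.
  have ihb : mu.-integrable Rp (EFin \o (fun u => h u * b (u, z))).
    apply: (@integrableM_bounded _ _ R mu Rp _ _ 4 measurable_Rp ih) => //.
    by apply: measurable_funTS; apply: measurableT_comp => //; exact: measurable_pair2.
  apply: (le_trans (le_normr_Rintegral measurable_Rp ihb)).
  rewrite -(RintegralZl _ measurable_Rp (integrable_norm ih)); apply: le_Rintegral => //.
  - exact: integrable_norm ihb.
  - exact: (integrableZl measurable_Rp _ (integrable_norm ih)).
  - by move=> u _; rewrite normrM mulrC ler_wpM2r.
apply: eq_Rintegral => z _; rewrite mulrCA; congr (_ * _).
rewrite /second_difference /A /cosine_transform mulrCA -!mulrBr; congr (_ * _).
have i1 := integrableM_cos y ih; have i2 := integrableM_cos (y + z) ih.
have i3 := integrableM_cos (y - z) ih; have i1' := integrableZl measurable_Rp 2 i1.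
rewrite -(RintegralZl _ measurable_Rp i1) -(RintegralB measurable_Rp i1' i2).
rewrite -(RintegralB measurable_Rp (integrableB measurable_Rp i1' i2) i3).
by apply: eq_Rintegral => u _; rewrite /b/=; ring.
Qed.

(** Each of the four values in a second difference contributes the L1 norm of the
transform, by translation invariance. *)
Lemma integral_norm_cosine_transform_levy :
  (\int[mu]_y `|cosine_transform (fun u => h u * D u) y|%:E <=
  (4 * eps)%:E * \int[mu]_y `|A y|%:E)%E.
Proof.
pose G (w : R * R) := (`|(delta \_ Rp) w.2|%:E * (2 * `|A w.1| + `|A (w.1 + w.2)| + `|A (w.1 - w.2)|)%:E)%E.
have mdelta : measurable_fun setT (delta \_ Rp).
  apply/(measurable_restrictT _ _).1; first exact: measurable_Rp.
  by case/integrableP : idelta => /measurable_EFinP.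
have mG : measurable_fun setT G.
  apply: emeasurable_funM; apply/measurable_EFinP.
    by do 2 apply: measurableT_comp => //.
  apply: measurable_funD; first apply: measurable_funD.
  - by apply: measurable_funM => //; do 2 apply: measurableT_comp => //.
  - by do 2 apply: measurableT_comp => //; exact: measurable_funD.
  - by do 2 apply: measurableT_comp => //; exact: measurable_funB.
have G0 w : (0 <= G w)%E by rewrite mule_ge0// lee_fin// !addr_ge0// mulr_ge0.
have mp (z : R) : measurable_fun setT (fun y : R => `|A (y + z)|%:E).
  apply/measurable_EFinP; do 2 apply: measurableT_comp => //.
  exact: measurable_funD.
have mm (z : R) : measurable_fun setT (fun y : R => `|A (y - z)|%:E).
  apply/measurable_EFinP; do 2 apply: measurableT_comp => //.
  exact: measurable_funB.
have mA0 : measurable_fun setT (fun y : R => `|A y|%:E).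
  by apply/measurable_EFinP; exact: measurableT_comp.
have AK y : (`|A y| <= pi^-1 * \int[mu]_(u in Rp) `|h u|)%R by exact: normr_cosine_transform.
set K := (pi^-1 * _)%R in AK.
have K0 : (0 <= K)%R by apply: le_trans (AK 0%R).
have id2 y : mu.-integrable Rp (EFin \o (fun z => delta z * second_difference y z)%R).
  apply: (@integrableM_bounded _ _ R mu Rp _ _ (4 * K)%R measurable_Rp idelta).
    apply: measurable_funTS; apply: measurable_funB; first apply: measurable_funB => //.
      by apply: measurableT_comp => //; exact: measurable_funD.
    by apply: measurableT_comp => //; exact: measurable_funB.
  move=> z _; rewrite /second_difference (le_trans (ler_normB _ _))//.
  have := AK y; have := AK (y + z)%R; have := AK (y - z)%R => h1 h2 h3.
  have := ler_normB (2 * A y)%R (A (y + z)); rewrite normrM (ger0_norm (ler0n _ 2)).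
  by lra.
have step1 : (\int[mu]_y `|cosine_transform (fun u => h u * D u) y|%:E <=
    \int[mu]_y \int[mu]_z G (y, z))%E.
  apply: ge0_le_integral => //.
  - apply/measurable_EFinP; apply: measurableT_comp => //.
    exact: measurable_cosine_transform (integrableM_levy_exponent ih).
  - exact: (@measurable_fun_fubini_tonelli_F _ _ _ _ _ mu G mG G0).
  - move=> y _; rewrite cosine_transform_levy.
    apply: (@le_trans _ _ (\int[mu]_(z in Rp) `|delta z * second_difference y z|)%:E).
      by rewrite lee_fin; exact: (le_normr_Rintegral measurable_Rp (id2 y)).
    rewrite /Rintegral fineK; last first.
      exact: (integrable_fin_num measurable_Rp (integrable_norm (id2 y))).
    rewrite integral_mkcond; apply: ge0_le_integral => //.
    + by move=> z _; rewrite patchE; case: ifP.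
    + apply/(measurable_restrictT _ _).1; first exact: measurable_Rp.
      by case/integrableP : (integrable_norm (id2 y)).
    + by apply: measurableT_comp => //; exact: measurable_pair1.
    + move=> z _; rewrite /G/= !patchE; case: ifP => zR; last by rewrite normr0 mul0e.
      rewrite -EFinM lee_fin normrM ler_wpM2l// /second_difference.
      rewrite (le_trans (ler_normB _ _))// lerD2r.
      by rewrite (le_trans (ler_normB _ _))// lerD2r normrM ger0_norm.
apply: (le_trans step1).
rewrite fubini_tonelli//.
have inner z : (\int[mu]_y G (y, z) = `|(delta \_ Rp) z|%:E * (4%:E * \int[mu]_y `|A y|%:E))%E.
  rewrite /G/= ge0_integralZl//; last first.
    apply/measurable_EFinP; apply: measurable_funD; first apply: measurable_funD.
    - by apply: measurable_funM => //; apply: measurableT_comp.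
    - by apply: measurableT_comp => //; apply: measurableT_comp => //; exact: measurable_funD.
    - by apply: measurableT_comp => //; apply: measurableT_comp => //; exact: measurable_funB.
  congr (_ * _)%E.
  under eq_integral do rewrite !EFinD EFinM.
  have m2A : measurable_fun setT (fun y : R => 2%:E * `|A y|%:E)%E by exact: emeasurable_funM.
  rewrite ge0_integralD//; last 3 first.
  - by move=> y _; rewrite adde_ge0// mule_ge0// lee_fin.
  - apply: emeasurable_funD => //; exact: (mp z).
  - exact: (mm z).
  rewrite ge0_integralD//; last exact: (mp z).
  rewrite (@ge0_integralZl _ _ _ mu setT measurableT _ mA0 2%:E)// ?lee_fin//.
  have tr (c : R) : (\int[mu]_y `|A (y + c)|%:E = \int[mu]_y `|A y|%:E)%E.
    rewrite [RHS](@ge0_integral_affine R 1 c ltr01)// mul1e.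
    by apply: eq_integral => y _; rewrite mul1r.
  rewrite !tr; move: (integral _ _ _) => I.
  rewrite (_ : 4%:E = 2%:E + 1 + 1 :> \bar R)%E; last by rewrite -!EFinD; congr EFin; ring.
  by rewrite !ge0_muleDl ?mul1e ?adde_ge0// lee_fin.
under eq_integral do rewrite inner.
have N0 : (0 <= \int[mu]_y `|A y|%:E)%E by exact: integral_ge0.
rewrite ge0_integralZr//; last 2 first.
- by apply/measurable_EFinP; exact: measurableT_comp.
- by rewrite mule_ge0.
rewrite muleA lee_wpmul2r//.
rewrite (_ : (\int[mu]_x `|(delta \_ Rp) x|%:E)%E = (\int[mu]_(z in Rp) `|delta z|)%:E); last first.
  rewrite /Rintegral fineK; last first.
    exact: (integrable_fin_num measurable_Rp (integrable_norm idelta)).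
  rewrite [RHS]integral_mkcond; apply: eq_integral => z _.
  by rewrite !patchE; case: ifP => //; rewrite normr0.
by rewrite -EFinM lee_fin mulrC ler_wpM2l.
Qed.

End one_factor.

Section exponential.
Variable phi : R -> R.
Hypothesis iphi : mu.-integrable Rp (EFin \o phi).
Hypothesis phi1 : (\int[mu]_y `|cosine_transform phi y|%:E <= 1)%E.

Let integrable_power k : mu.-integrable Rp (EFin \o (fun u => phi u * D u ^+ k)).
Proof.
elim: k => [|k IH]; first by apply: eq_integrable iphi => // u _ /=; rewrite expr0 mulr1.
apply: eq_integrable (integrableM_levy_exponent IH) => // u _ /=.
by congr EFin; rewrite [in RHS]exprSr [RHS]mulrA.
Qed.

Let norm_power k : (\int[mu]_y `|cosine_transform (fun u => (phi u * D u ^+ k)%R) y|%:E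
  <= ((4 * eps) ^+ k)%:E)%E.
Proof.
elim: k => [|k IH].
  rewrite expr0; apply: le_trans phi1; rewrite le_eqVlt; apply/orP; left; apply/eqP.
  apply: eq_integral => y _; congr (`|_ * _|%:E); apply: eq_Rintegral => u _.
  by rewrite expr0 mulr1.
have -> : (fun u => phi u * D u ^+ k.+1) = (fun u => (phi u * D u ^+ k) * D u).
  by apply/funext => u; rewrite exprSr mulrA.
apply: (le_trans (integral_norm_cosine_transform_levy (integrable_power k))).
rewrite exprS [X in (_ <= X)%E]EFinM lee_wpmul2l// lee_fin mulr_ge0//.
Qed.

Let partial_exp n (x : R) := series (exp_coeff x) n.+1 - 1.

Let partial_expS n x : partial_exp n.+1 x = partial_exp n x + (n.+1`!%:R)^-1 * x ^+ n.+1.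
Proof.
rewrite /partial_exp /series/= big_nat_recr//= /exp_coeff/= [x ^+ n.+1 / _]mulrC.
by rewrite addrAC.
Qed.

Let partial_exp0 x : partial_exp 0 x = 0.
Proof. by rewrite /partial_exp /series/= big_nat1 /exp_coeff/= fact0 expr0 divr1 subrr. Qed.

Let partial_exp_le n x : 0 <= x -> partial_exp n x <= expR x - 1.
Proof.
move=> x0; rewrite lerD2r; apply: nondecreasing_cvgn_le; last exact: is_cvg_series_exp_coeff.
by apply: nondecreasing_series => k _ _; exact: exp_coeff_ge0.
Qed.

Let normr_partial_exp n x : `|partial_exp n x| <= partial_exp n `|x|.
Proof.
elim: n => [|n IH]; first by rewrite !partial_exp0 normr0.
rewrite !partial_expS (le_trans (ler_normD _ _))// lerD//.
by rewrite normrM normrX ger0_norm// invr_ge0.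
Qed.

Let partial_exp_cvg x : partial_exp n x @[n --> \oo] --> expR x - 1.
Proof.
apply: cvgB; last exact: cvg_cst.
have h : series (exp_coeff x) n @[n --> \oo] --> expR x by exact: is_cvg_series_exp_coeff.
by move: h; rewrite -(cvg_shiftn 1); under eq_fun do rewrite addn1.
Qed.

Let integrable_partial n : mu.-integrable Rp (EFin \o (fun u => phi u * partial_exp n (D u))).
Proof.
elim: n => [|n IH].
  apply: eq_integrable (integrableZl measurable_Rp 0 iphi) => // u _ /=.
  by rewrite partial_exp0 mulr0 mul0e.
have h := integrableZl measurable_Rp (n.+1`!%:R)^-1 (integrable_power n.+1).
apply: eq_integrable (integrableD measurable_Rp IH h) => // u _ /=.
by rewrite partial_expS -EFinM -EFinD; congr EFin; rewrite [RHS]mulrDr [in RHS](mulrCA (phi u)).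
Qed.

Let norm_partial n : (\int[mu]_y `|cosine_transform (fun u => (phi u * partial_exp n (D u))%R) y|%:E
  <= (partial_exp n (4 * eps))%:E)%E.
Proof.
elim: n => [|n IH].
  rewrite partial_exp0 integral0_eq// => y _.
  rewrite /cosine_transform (_ : \int[mu]_(u in Rp) _ = 0) ?mulr0 ?normr0//.
  transitivity (\int[mu]_(u in Rp) (0 : R)); last by rewrite /Rintegral integral0.
  by apply: eq_Rintegral => u _; rewrite partial_exp0 mulr0 mul0r.
pose c : R := (n.+1`!%:R)^-1.
have c0 : 0 <= c by rewrite invr_ge0.
have E y : cosine_transform (fun u => phi u * partial_exp n.+1 (D u)) y =
    cosine_transform (fun u => phi u * partial_exp n (D u)) y +
    c * cosine_transform (fun u => phi u * D u ^+ n.+1) y.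
  rewrite /cosine_transform mulrCA -mulrDr; congr (_ * _).
  have i1 := integrableM_cos y (integrable_partial n).
  have i2 := integrableM_cos y (integrable_power n.+1).
  rewrite -(RintegralZl _ measurable_Rp i2).
  rewrite -(RintegralD measurable_Rp i1 (integrableZl measurable_Rp c i2)).
  apply: eq_Rintegral => u _; rewrite partial_expS -/c !mulrA -mulrDl; congr (_ * _).
  by rewrite mulrDr (mulrCA (phi u)) !mulrA.
have m1 : measurable_fun setT (fun y =>
    `|cosine_transform (fun u => phi u * partial_exp n (D u)) y|%:E).
  apply/measurable_EFinP; apply: measurableT_comp => //.
  exact: measurable_cosine_transform (integrable_partial n).
have m2 : measurable_fun setT (fun y =>
    `|cosine_transform (fun u => phi u * D u ^+ n.+1) y|%:E).
  apply/measurable_EFinP; apply: measurableT_comp => //.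
  exact: measurable_cosine_transform (integrable_power n.+1).
have m2' : measurable_fun setT (fun y => c%:E *
    `|cosine_transform (fun u => phi u * D u ^+ n.+1) y|%:E)%E by exact: emeasurable_funM.
apply: (@le_trans _ _ (\int[mu]_y (`|cosine_transform (fun u => phi u * partial_exp n (D u)) y|%:E
   + c%:E * `|cosine_transform (fun u => phi u * D u ^+ n.+1) y|%:E))%E).
  apply: ge0_le_integral => //.
  - apply/measurable_EFinP; apply: measurableT_comp => //.
    exact: measurable_cosine_transform (integrable_partial n.+1).
  - exact: emeasurable_funD.
  - move=> y _; rewrite E -EFinM -EFinD lee_fin (le_trans (ler_normD _ _))//.
    by rewrite lerD2l (normrM c) (ger0_norm c0).
rewrite ge0_integralD//; last first.
  by move=> y _; rewrite mule_ge0// lee_fin.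
rewrite ge0_integralZl// partial_expS EFinD leeD//.
by rewrite -/c EFinM lee_wpmul2l// lee_fin.
Qed.

(** The partial sums of the exponential series are bounded in L1 by norm_power, and the
lemma of Fatou passes to the limit. *)
Lemma integral_norm_cosine_transform_expR :
  (\int[mu]_y `|cosine_transform (fun u => (phi u * (expR (D u) - 1))%R) y|%:E
    <= (expR (4 * eps) - 1)%:E)%E.
Proof.
apply: (@le_integral_norm_limit _ (measurableTypeR R) R mu
  (fun n => cosine_transform (fun u => phi u * partial_exp n (D u)))).
- by move=> n; exact: measurable_cosine_transform (integrable_partial n).
- move=> y; apply: cvgMl_tmp.
  apply: (@cvg_Rintegral _ _ R mu Rp measurable_Rp
    (fun n u => phi u * partial_exp n (D u) * cos (u * y))
    (fun u => phi u * (expR (D u) - 1) * cos (u * y))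
    (fun u => (expR (4 * eps) - 1) * `|phi u|)).
  + by move=> n; case/integrableP : (integrableM_cos y (integrable_partial n)) => /measurable_EFinP.
  + by move=> u _; apply: cvgMr_tmp; apply: cvgMl_tmp; exact: partial_exp_cvg.
  + exact: (integrableZl measurable_Rp _ (integrable_norm iphi)).
  + move=> n u _; rewrite normrM -[leRHS]mulr1 ler_pM ?cos_max//.
    rewrite normrM mulrC ler_wpM2r//; apply: (le_trans (normr_partial_exp _ _)).
    apply: (le_trans (partial_exp_le _ (normr_ge0 _))).
    by rewrite lerD2r ler_expR; exact: normr_levy_exponent_le.
- move=> n; apply: (le_trans (norm_partial n)).
  by rewrite lee_fin; apply: partial_exp_le; rewrite mulr_ge0.
Qed.

End exponential.

End perturbation.

(** * Perturbation by small jumps *)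

Section smooth_transform.
Context {R : realType}.
Notation mu := (@lebesgue_measure R).
Notation Rp := (`]0%R, +oo[%classic : set R).

Lemma integral_oneDsqrV : (\int[mu]_y ((1 + y ^+ 2)^-1)%:E = pi%:E :> \bar R)%E.
Proof.
have d0 (x : R) : 0 < 1 + x ^+ 2 by rewrite ltr_pwDl// sqr_ge0.
rewrite ge0_integral_even//.
- have E : (\int[mu]_(y in Rp) ((1 + y ^+ 2)^-1)%:E = (pi / 2)%:E)%E.
    rewrite integral_itv_obnd_cbnd; last first.
      apply/measurable_EFinP; apply: measurable_funTS.
      exact: continuous_measurable_fun (@continuous_oneDsqrV R).
    exact: integral0y_oneDsqr.
  by rewrite E -EFinM; congr EFin; field.
- apply/measurable_EFinP.
  exact: continuous_measurable_fun (@continuous_oneDsqrV R).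
- by move=> x; rewrite lee_fin invr_ge0 ltW.
- by move=> x; rewrite sqrrN.
Qed.

Variables w w1 w2 : R -> R.
Hypotheses (iw : mu.-integrable Rp (EFin \o w)) (iw2 : mu.-integrable Rp (EFin \o w2)).
Hypothesis dw : forall u : R, 0 < u -> is_derive u 1 w (w1 u).
Hypothesis dw1 : forall u : R, 0 < u -> is_derive u 1 w1 (w2 u).
Hypothesis cw2 : forall u : R, 0 < u -> {for u, continuous w2}.
Hypotheses (w0 : w u @[u --> 0^'+] --> 0) (wy : w u @[u --> +oo] --> 0).
Hypotheses (w10 : w1 u @[u --> 0^'+] --> 0) (w1y : w1 u @[u --> +oo] --> 0).

Let cvg0_bounded (F : set_system R) (FF : Filter F) (f g : R -> R) :
  (forall u, `|g u| <= 1) -> f u @[u --> F] --> 0 -> f u * g u @[u --> F] --> 0.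
Proof.
move=> g1 f0; apply/cvgrPdist_le => e e0; move/cvgrPdist_le : f0 => /(_ e e0).
apply: filterS => u; rewrite !sub0r !normrN => h.
by rewrite normrM (le_trans _ h)// ler_piMr.
Qed.

Lemma cosine_transform_ibp y :
  y ^+ 2 * cosine_transform w y = - cosine_transform w2 y.
Proof.
apply/eqP; rewrite -subr_eq0 opprK; apply/eqP.
have i1 := integrableM_cos y iw; have i2 := integrableM_cos y iw2.
rewrite /cosine_transform mulrCA -mulrDr.
rewrite -(RintegralZl _ measurable_Rp i1).
rewrite -(RintegralD measurable_Rp (integrableZl measurable_Rp _ i1) i2).
apply/eqP; rewrite mulf_eq0; apply/orP; right; apply/eqP.
pose F u := y * (w u * sin (y * u)) + w1 u * cos (y * u).
have lim G (FG : ProperFilter G) : w u @[u --> G] --> 0 -> w1 u @[u --> G] --> 0 -> F u @[u --> G] --> 0.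
  move=> h h1; rewrite -[X in _ --> X]addr0; apply: cvgD.
    rewrite -[X in _ --> X](mulr0 y); apply: cvgMl_tmp.
    by apply: cvg0_bounded => // u; exact: sin_max.
  by apply: cvg0_bounded => // u; exact: cos_max.
apply: etrans (subrr 0).
apply: (Rintegral_FTC_Rp _ _ _ (lim _ _ w0 w10) (lim _ _ wy w1y)).
- exact: (integrableD measurable_Rp (integrableZl measurable_Rp _ i1) i2).
- move=> u u0.
  have cc : {for u, continuous (fun x : R => cos (x * y))}.
    exact: is_derive_continuous (@is_derive1O _ cos (fun x : R => x * y) u _ _ (is_derive_cos _)
      (is_derive1M (is_derive1I u) (is_derive1C y u))).
  apply: cvgD; last by apply: cvgM; [exact: cw2|exact: cc].
  apply: cvgMl_tmp; apply: cvgM; last exact: cc.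
  exact: is_derive_continuous (dw u0).
- move=> u u0.
  have h := is_derive1D (is_derive1Ml y (is_derive1M (dw u0) (is_derive_sinM y u)))
    (is_derive1M (dw1 u0) (is_derive_cosM y u)).
  by apply: (is_derive_eqr h); rewrite (mulrC u y); ring.
Qed.

(** (1 + y^2) times the transform of w is bounded by the L1 norms of w and w'', and
1 / (1 + y^2) has integral pi, which cancels the normalization of the transform. *)
Lemma integral_norm_cosine_transform_smooth :
  (\int[mu]_y `|cosine_transform w y|%:E <=
   (\int[mu]_(u in Rp) `|w u| + \int[mu]_(u in Rp) `|w2 u|)%R%:E)%E.
Proof.
set N := _ + _.
have N0 : 0 <= N by rewrite addr_ge0//; exact: Rintegral_ge0.
have d0 (x : R) : 0 < 1 + x ^+ 2 by rewrite ltr_pwDl// sqr_ge0.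
have bound y : `|cosine_transform w y| <= pi^-1 * N * (1 + y ^+ 2)^-1.
  rewrite ler_pdivlMr// mulrDr mulr1 [X in _ + X]mulrC.
  rewrite -[X in _ + X * _](ger0_norm (sqr_ge0 y)) -normrM cosine_transform_ibp normrN.
  by rewrite mulrDr lerD//; exact: normr_cosine_transform.
have mV : measurable_fun setT (fun y : R => ((1 + y ^+ 2)^-1)%:E).
  by apply/measurable_EFinP; exact: continuous_measurable_fun (@continuous_oneDsqrV R).
apply: (@le_trans _ _ (\int[mu]_y ((pi^-1 * N)%:E * ((1 + y ^+ 2)^-1)%:E))%E).
  apply: ge0_le_integral => //.
  - apply/measurable_EFinP; apply: measurableT_comp => //.
    exact: measurable_cosine_transform.
  - exact: emeasurable_funM.
  - by move=> y _; rewrite -EFinM lee_fin; exact: bound.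
have pN : 0 <= pi^-1 * N by rewrite mulr_ge0// invr_ge0 pi_ge0.
rewrite ge0_integralZl//; last first.
  by move=> y _; rewrite lee_fin invr_ge0 ltW.
rewrite integral_oneDsqrV -EFinM lee_fin mulrAC mulVf ?mul1r//.
by rewrite gt_eqF ?pi_gt0.
Qed.

End smooth_transform.

Section exp_bound.
Context {R : realType}.

Lemma normr_expRB1 (x : R) : `|expR x - 1| <= `|x| * expR `|x|.
Proof.
have [x0|x0] := leP 0 x.
  rewrite (ger0_norm x0) ger0_norm ?subr_ge0 -?expR0 ?ler_expR// expR0.
  have h1 := expRxMexpNx_1 x; have h2 := expR_ge1Dx (- x).
  by have := ler_wpM2l (expR_ge0 x) h2; rewrite h1; lra.
rewrite ler0_norm ?subr_le0 ?expR_le1 ?(ltW x0)// opprB.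
apply: (@le_trans _ _ `|x|); first by rewrite ltr0_norm//; have := expR_ge1Dx x; lra.
rewrite -[leLHS]mulr1 ler_wpM2l//.
by rewrite -expR0 ler_expR.
Qed.

End exp_bound.

Section weight.
Context {R : realType}.
Notation mu := (@lebesgue_measure R).
Notation Rp := (`]0%R, +oo[%classic : set R).
Variable alpha : R.
Hypothesis a0 : 0 < alpha.

(** The fourth power dominates every polynomial factor produced below by differentiating
e^(-u^alpha) twice, since alpha < 2 gives u^(2 alpha) <= (1 + u)^4. *)
Definition stretched_weight (u : R) := (1 + u) ^+ 4 * expR (- (u `^ alpha / 2)).

Lemma stretched_weight_ge0 u : 0 <= u -> 0 <= stretched_weight u.
Proof. by move=> u0; rewrite mulr_ge0 ?expR_ge0// exprn_ge0// addr_ge0. Qed.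

Lemma measurable_stretched_weight : measurable_fun setT stretched_weight.
Proof.
apply: measurable_funM; first by apply: measurable_funX; exact: measurable_funD.
apply: measurableT_comp => //; apply: measurable_funN; apply: measurable_funM => //.
Qed.

Lemma stretched_weight_tail :
  exists2 M, 0 < M & forall u, 1 <= u -> stretched_weight u <= M * u `^ (- 2).
Proof.
have p0 : 0 <= 6 / alpha by rewrite divr_ge0// ltW.
have [M M0 MP] := powR_expR_le p0.
exists (16 * (2 `^ (6 / alpha) * M)); first by rewrite !mulr_gt0// powR_gt0.
move=> u u1; have u0 : 0 < u by exact: lt_le_trans u1.
rewrite powRN ler_pdivlMr ?powR_gt0//.
have e0 := expR_ge0 (- (u `^ alpha / 2)).
have h1 : (1 + u) ^+ 4 <= 16 * u ^+ 4.
  rewrite (_ : 16 = 2 ^+ 4); last by ring.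
  by rewrite -exprMn ler_pXn2r// ?nnegrE; lra.
have h2 : u ^+ 4 * u `^ 2 * expR (- (u `^ alpha / 2)) <= 2 `^ (6 / alpha) * M.
  have -> : u ^+ 4 * u `^ 2 = 2 `^ (6 / alpha) * (u `^ alpha / 2) `^ (6 / alpha).
    rewrite -powRM//; last by rewrite divr_ge0// powR_ge0.
    rewrite mulrCA mulfV// mulr1 -powRrM mulrCA mulfV ?gt_eqF// mulr1.
    rewrite -powR_mulrn ?(ltW u0)// -powRD; last by rewrite (gt_eqF u0) implybT.
    by congr powR; ring.
  rewrite -mulrA ler_wpM2l ?powR_ge0//; apply: MP.
  by rewrite divr_ge0// powR_ge0.
apply: le_trans (_ : 16 * (u ^+ 4 * u `^ 2 * expR (- (u `^ alpha / 2))) <= _); last by rewrite ler_pM2l.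
rewrite /stretched_weight mulrAC -mulrA [leRHS](_ : _ = (16 * u ^+ 4) * (u `^ 2 * expR (- (u `^ alpha / 2)))).
  by rewrite mulrC; rewrite [u `^ 2 * _]mulrC mulrC; rewrite ler_wpM2r// mulr_ge0// powR_ge0.
by ring.
Qed.

Lemma integrable_stretched_weight : mu.-integrable Rp (EFin \o stretched_weight).
Proof.
have [M M0 MP] := stretched_weight_tail.
apply: (@integrable_Rp_powR R 1 1 (16 + M)) => //.
- by apply: measurable_funTS; exact: measurable_stretched_weight.
- move=> z /andP[z0 z1]; rewrite subrr powRr0 mulr1.
  rewrite ger0_norm ?stretched_weight_ge0// ?(ltW z0)//.
  apply: (@le_trans _ _ 16); last by rewrite lerDl ltW.
  rewrite -[leRHS]mulr1 ler_pM ?expR_ge0 ?exprn_ge0 ?addr_ge0 ?(ltW z0)//.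
    rewrite (_ : 16 = 2 ^+ 4); last by ring.
    by rewrite ler_pXn2r// ?nnegrE; lra.
  by rewrite expR_le1 oppr_le0 divr_ge0 ?powR_ge0.
- move=> z z1; rewrite ger0_norm ?stretched_weight_ge0 ?(le_trans ler01)//.
  rewrite (_ : - 1 - 1 = - 2); last by ring.
  by rewrite (le_trans (MP _ z1))// ler_wpM2r ?powR_ge0// lerDr.
Qed.

End weight.

Section small_jumps.
Context {R : realType}.
Notation mu := (@lebesgue_measure R).
Notation Rp := (`]0%R, +oo[%classic : set R).
Variables (alpha : R) (delta : R -> R) (kappa : R).
Hypothesis a02 : 0 < alpha < 2.
Hypothesis mdelta : measurable_fun Rp delta.
Hypothesis delta_small : forall z, 1 < z -> delta z = 0.
Hypothesis delta_le : forall z, 0 < z ->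
  `|delta z| <= stable_const alpha / 2 * z `^ (- 1 - alpha).
Hypothesis delta_kappa : 2 * \int[mu]_(z in Rp) `|z ^+ 2 * delta z| <= kappa.

Let a0 : 0 < alpha. Proof. by case/andP : a02. Qed.
Let c0 : 0 < stable_const alpha. Proof. exact: stable_const_gt0. Qed.

Let mz2 : measurable_fun Rp (fun z => z ^+ 2 * delta z).
Proof. by apply: measurable_funM => //; apply: measurable_funTS; exact: measurable_funX. Qed.

Let i2 : mu.-integrable Rp (EFin \o (fun z => z ^+ 2 * delta z)).
Proof.
apply: (@integrable_Rp_powR R (2 - alpha) 1 (stable_const alpha / 2)) => //.
- by case/andP : a02; rewrite subr_gt0.
- move=> z /andP[z0 z1]; rewrite normrM ger0_norm ?sqr_ge0//.
  have -> : z `^ (2 - alpha - 1) = z ^+ 2 * z `^ (- 1 - alpha).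
    rewrite -powR_mulrn ?(ltW z0)// -powRD; first by congr powR; ring.
    by rewrite (gt_eqF z0) implybT.
  by rewrite mulrCA ler_wpM2l ?sqr_ge0// delta_le.
- move=> z; rewrite le_eqVlt => /predU1P[<-|z1].
    by rewrite expr1n mul1r powR1 mulr1 (le_trans (delta_le ltr01))// powR1 mulr1.
  by rewrite delta_small// mulr0 normr0 mulr_ge0 ?powR_ge0// divr_ge0// ltW.
Qed.

Let i2n : mu.-integrable Rp (EFin \o (fun z => `|z ^+ 2 * delta z|)).
Proof. exact: integrable_norm i2. Qed.

Let dom (f : R -> R) (C : R) : measurable_fun Rp f ->
  (forall z, 0 < z -> `|f z| <= C * `|z ^+ 2 * delta z|) -> mu.-integrable Rp (EFin \o f).
Proof.
move=> mf fC; have := integrableZl measurable_Rp C i2n => iC.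
apply: (@le_integrable_fin _ _ R mu Rp f (fun z => C * `|z ^+ 2 * delta z|)) => //.
by move=> z; rewrite /= in_itv/= andbT; exact: fC.
Qed.

Let dom_le (f : R -> R) (C : R) : 0 <= C -> measurable_fun Rp f ->
  (forall z, 0 < z -> `|f z| <= C * `|z ^+ 2 * delta z|) ->
  `|2 * \int[mu]_(z in Rp) f z| <= C * kappa.
Proof.
move=> C0 mf fC; have if_ := dom mf fC.
rewrite normrM ger0_norm//.
apply: (@le_trans _ _ (2 * (C * \int[mu]_(z in Rp) `|z ^+ 2 * delta z|))); last first.
  by rewrite mulrCA ler_wpM2l.
rewrite ler_wpM2l//; apply: (le_trans (le_normr_Rintegral measurable_Rp if_)).
rewrite -(RintegralZl _ measurable_Rp i2n); apply: le_Rintegral => //.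
- exact: integrable_norm if_.
- exact: (integrableZl measurable_Rp _ i2n).
- by move=> z; rewrite /= in_itv/= andbT; exact: fC.
Qed.

(** f0 is the integrand of the exponent, f1, f2 and f3 its successive derivatives in u;
each is dominated by z^2 |delta z|, up to a factor depending on u; the last one uses the
support in z <= 1. *)
Let f0 u z := delta z * (1 - cos (u * z)).
Let f1 u z := z * delta z * sin (u * z).
Let f2 u z := z ^+ 2 * delta z * cos (u * z).
Let f3 u z := - (z ^+ 3 * delta z * sin (u * z)).

Let mf0 u : measurable_fun Rp (f0 u).
Proof.
apply: measurable_funM => //; apply: measurable_funTS.
by apply: measurable_funB => //; exact: measurable_cosM.
Qed.
Let mf1 u : measurable_fun Rp (f1 u).
Proof.
apply: measurable_funM; last by apply: measurable_funTS; exact: measurable_sinM.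
by apply: measurable_funM => //; exact: measurable_funTS.
Qed.
Let mf2 u : measurable_fun Rp (f2 u).
Proof. by apply: measurable_funM => //; apply: measurable_funTS; exact: measurable_cosM. Qed.
Let b0 u z : 0 < z -> `|f0 u z| <= u ^+ 2 / 2 * `|z ^+ 2 * delta z|.
Proof.
move=> z0; rewrite /f0 (normrM (delta z)) (normrM (z ^+ 2)).
rewrite (ger0_norm (onem_cos_ge0 _)) (ger0_norm (sqr_ge0 z)).
rewrite mulrC mulrA ler_wpM2r// (le_trans (onem_cos_le_sqr _))// exprMn; lra.
Qed.
Let b1 u z : 0 < z -> `|f1 u z| <= `|u| * `|z ^+ 2 * delta z|.
Proof.
move=> z0; rewrite /f1 (normrM (z * _)) (normrM z) (normrM (z ^+ 2)).
rewrite (ger0_norm (sqr_ge0 z)) (ger0_norm (ltW z0)).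
have h := normr_sin_le (u * z); rewrite normrM (ger0_norm (ltW z0)) in h.
rewrite mulrAC [leRHS]mulrA ler_wpM2r//.
by have := ler_wpM2l (ltW z0) h; rewrite expr2; lra.
Qed.
Let b2 u z : 0 < z -> `|f2 u z| <= 1 * `|z ^+ 2 * delta z|.
Proof. by move=> z0; rewrite /f2 mul1r normrM ler_piMr// cos_max. Qed.
Let b3 u z : 0 < z -> `|f3 u z| <= 1 * `|z ^+ 2 * delta z|.
Proof.
move=> z0; rewrite /f3 mul1r normrN normrM; have [z1|z1] := leP z 1; last first.
  by rewrite delta_small// !mulr0 normr0 mul0r.
rewrite -[leRHS]mulr1 ler_pM ?sin_max// exprS -mulrA normrM ler_piMl//.
by rewrite ger0_norm// ltW.
Qed.

Let D u := 2 * \int[mu]_(z in Rp) f0 u z.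
Let D1 u := 2 * \int[mu]_(z in Rp) f1 u z.
Let D2 u := 2 * \int[mu]_(z in Rp) f2 u z.
Let D3 u := 2 * \int[mu]_(z in Rp) f3 u z.

Let k0 : 0 <= kappa.
Proof. by apply: le_trans delta_kappa; rewrite mulr_ge0// Rintegral_ge0. Qed.

Let dD (u : R) : 0 < u -> is_derive u 1 D (D1 u).
Proof.
move=> u0; apply: is_derive1Ml.
have iG := integrableZl measurable_Rp (u + 1) i2n.
apply: (@is_derive_Rintegral _ _ R mu Rp f0 f1 (fun z => (u + 1) * `|z ^+ 2 * delta z|)
  0 (u + 1) u measurable_Rp) => //.
- by rewrite u0 ltrDl ltr01.
- by move=> x _; exact: dom (mf0 x) (b0 x).
- move=> x z _; rewrite /= in_itv/= andbT => z0.
  have h := is_derive1Ml (delta z) (is_derive1B (is_derive1C 1 x)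
    (@is_derive1O _ cos (fun y => y * z) x _ _ (is_derive_cos (x * z))
      (is_derive1M (is_derive1I x) (is_derive1C z x)))).
  by apply: (is_derive_eqr h); rewrite /f1; ring.
- move=> x z /andP[x0 xu]; rewrite /= in_itv/= andbT => z0.
  apply: (le_trans (b1 x z0)); rewrite ler_wpM2r// ger0_norm; exact: ltW.
Qed.

Let dD1 (u : R) : 0 < u -> is_derive u 1 D1 (D2 u).
Proof.
move=> u0; apply: is_derive1Ml.
apply: (@is_derive_Rintegral _ _ R mu Rp f1 f2 (fun z => `|z ^+ 2 * delta z|)
  0 (u + 1) u measurable_Rp) => //.
- by rewrite u0 ltrDl ltr01.
- by move=> x _; exact: dom (mf1 x) (b1 x).
- move=> x z _; rewrite /= in_itv/= andbT => z0.
  have h := is_derive1Ml (z * delta z)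
    (@is_derive1O _ sin (fun y => y * z) x _ _ (is_derive_sin (x * z))
      (is_derive1M (is_derive1I x) (is_derive1C z x))).
  by apply: (is_derive_eqr h); rewrite /f2; ring.
- move=> x z _; rewrite /= in_itv/= andbT => z0.
  by apply: (le_trans (b2 x z0)); rewrite mul1r.
Qed.

Let dD2 (u : R) : 0 < u -> is_derive u 1 D2 (D3 u).
Proof.
move=> u0; apply: is_derive1Ml.
apply: (@is_derive_Rintegral _ _ R mu Rp f2 f3 (fun z => `|z ^+ 2 * delta z|)
  0 (u + 1) u measurable_Rp) => //.
- by rewrite u0 ltrDl ltr01.
- by move=> x _; exact: dom (mf2 x) (b2 x).
- move=> x z _; rewrite /= in_itv/= andbT => z0.
  have h := is_derive1Ml (z ^+ 2 * delta z)
    (@is_derive1O _ cos (fun y => y * z) x _ _ (is_derive_cos (x * z))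
      (is_derive1M (is_derive1I x) (is_derive1C z x))).
  by apply: (is_derive_eqr h); rewrite /f3; ring.
- move=> x z _; rewrite /= in_itv/= andbT => z0.
  by apply: (le_trans (b3 x z0)); rewrite mul1r.
Qed.

Let D_le u : `|D u| <= u ^+ 2 / 2 * kappa.
Proof. by apply: dom_le => //; [rewrite divr_ge0// sqr_ge0|exact: b0]. Qed.
Let D1_le u : 0 < u -> `|D1 u| <= u * kappa.
Proof.
by move=> u0; have := dom_le (normr_ge0 u) (mf1 u) (b1 u); rewrite (ger0_norm (ltW u0)).
Qed.
Let D2_le u : `|D2 u| <= kappa.
Proof. by have := dom_le ler01 (mf2 u) (b2 u); rewrite mul1r. Qed.

(** The factor 1/2 in the hypothesis on delta leaves half of the decay of e^(-u^alpha)
to the perturbed characteristic function. *)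
Lemma normr_exponent_small_jumps u : 0 < u -> `|D u| <= u `^ alpha / 2.
Proof.
move=> u0; rewrite -(levy_integralE a02 (ltW u0)).
rewrite normrM ger0_norm// -!mulrA ler_wpM2l//.
have iL := integrable_levy u a02.
have i0 := dom (mf0 u) (b0 u).
rewrite [leRHS](_ : _ = \int[mu]_(z in Rp) (stable_const alpha / 2 * (z `^ (- 1 - alpha) * (1 - cos (u * z))))); last first.
  by rewrite (RintegralZl _ measurable_Rp iL); ring.
apply: (le_trans (le_normr_Rintegral measurable_Rp i0)).
apply: le_Rintegral => //.
- exact: integrable_norm i0.
- exact: (integrableZl measurable_Rp _ iL).
- move=> z; rewrite /= in_itv/= andbT => z0.
  by rewrite normrM (ger0_norm (onem_cos_ge0 _)) [leRHS]mulrA ler_wpM2r ?onem_cos_ge0// delta_le.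
Qed.

Variable K0 : R.
Hypothesis kappa_le : kappa <= K0.

Let E1 u := expR (- u `^ alpha - D u).
Let w u := expR (- (u `^ alpha)) * (expR (- D u) - 1).
Let w1 u := - (alpha * u `^ (alpha - 1)) * w u - D1 u * E1 u.
Let w2 u := - (alpha * ((alpha - 1) * u `^ (alpha - 2))) * w u
  - alpha * u `^ (alpha - 1) * w1 u - D2 u * E1 u
  + D1 u * (alpha * u `^ (alpha - 1) + D1 u) * E1 u.

Let wE u : w u = E1 u - expR (- (u `^ alpha)).
Proof. by rewrite /w mulrBr mulr1 -expRD. Qed.

Let dE1 (u : R) : 0 < u -> is_derive u 1 E1 (- (alpha * u `^ (alpha - 1) + D1 u) * E1 u).
Proof.
move=> u0.
have h := @is_derive1O _ expR (fun u => - u `^ alpha - D u) u _ _ (is_derive_expR _)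
  (is_derive1B (is_derive1N (is_derive1_powR alpha u0)) (dD u0)).
by apply: (is_derive_eqr h); rewrite /E1; ring.
Qed.

Let dw (u : R) : 0 < u -> is_derive u 1 w (w1 u).
Proof.
move=> u0.
have hE := @is_derive1O _ expR (fun u => - u `^ alpha) u _ _ (is_derive_expR _)
  (is_derive1N (is_derive1_powR alpha u0)).
have h := is_derive1B (dE1 u0) hE.
have -> : w = (fun u => E1 u - expR (- u `^ alpha)) by apply/funext => x; rewrite wE.
by apply: (is_derive_eqr h); rewrite /w1 wE; ring.
Qed.

Let dP (u : R) : 0 < u ->
  is_derive u 1 (fun u => alpha * u `^ (alpha - 1)) (alpha * ((alpha - 1) * u `^ (alpha - 2))).
Proof.
move=> u0; have h := is_derive1Ml alpha (is_derive1_powR (alpha - 1) u0).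
by apply: (is_derive_eqr h); congr (_ * (_ * _ `^ _)); ring.
Qed.

Let dw1 (u : R) : 0 < u -> is_derive u 1 w1 (w2 u).
Proof.
move=> u0.
have h := is_derive1B (is_derive1M (is_derive1N (dP u0)) (dw u0)) (is_derive1M (dD1 u0) (dE1 u0)).
by apply: (is_derive_eqr h); rewrite /w2; ring.
Qed.

Let cw2 (u : R) : 0 < u -> {for u, continuous w2}.
Proof.
move=> u0.
have dQ := is_derive1Ml alpha (is_derive1Ml (alpha - 1) (is_derive1_powR (alpha - 2) u0)).
exact: (is_derive_continuous (is_derive1D (is_derive1B (is_derive1B
  (is_derive1M (is_derive1N dQ) (dw u0)) (is_derive1M (dP u0) (dw1 u0)))
  (is_derive1M (dD2 u0) (dE1 u0)))
  (is_derive1M (is_derive1M (dD1 u0) (is_derive1D (dP u0) (dD1 u0))) (dE1 u0)))).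
Qed.

Let e u := expR (- (u `^ alpha / 2)).

Let E1_le u : 0 < u -> `|E1 u| <= e u.
Proof.
move=> u0; rewrite ger0_norm ?expR_ge0// ler_expR.
by have := normr_exponent_small_jumps u0; rewrite ler_norml => /andP[]; lra.
Qed.

Let w_le u : 0 < u -> `|w u| <= kappa * (u ^+ 2 / 2) * e u.
Proof.
move=> u0; rewrite normrM (ger0_norm (expR_ge0 _)).
apply: (@le_trans _ _ (expR (- u `^ alpha) * (`|D u| * expR `|D u|))).
  by rewrite ler_wpM2l ?expR_ge0//; have := normr_expRB1 (- D u); rewrite normrN.
rewrite mulrCA -expRD ler_pM ?expR_ge0//; first by rewrite mulrC; exact: D_le.
by rewrite ler_expR; have := normr_exponent_small_jumps u0; lra.
Qed.

Let uP u : 0 < u -> u * u `^ (alpha - 1) = u `^ alpha.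
Proof. by move=> u0; rewrite mulr_powRB1// ltW. Qed.

Let uQ u : 0 < u -> u ^+ 2 * u `^ (alpha - 2) = u `^ alpha.
Proof.
move=> u0; rewrite -powR_mulrn ?(ltW u0)// -powRD; first by congr powR; ring.
by rewrite (gt_eqF u0) implybT.
Qed.

Let al2 : alpha <= 2. Proof. by case/andP : a02 => _ /ltW. Qed.

Let w1_le u : 0 < u -> `|w1 u| <= kappa * (u * u `^ alpha + u) * e u.
Proof.
move=> u0; have e0 : 0 <= e u by exact: expR_ge0.
have p0 := powR_ge0 u (alpha - 1); have v0 := powR_ge0 u alpha.
rewrite /w1 (le_trans (ler_normB _ _))// mulrDr mulrDl lerD//.
  rewrite normrM normrN (ger0_norm (mulr_ge0 (ltW a0) p0)).
  apply: (@le_trans _ _ (alpha * u `^ (alpha - 1) * (kappa * (u ^+ 2 / 2) * e u))).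
    by rewrite ler_wpM2l ?w_le// mulr_ge0 ?(ltW a0).
  rewrite (_ : _ * (_ * e u) = alpha / 2 * (kappa * (u * (u * u `^ (alpha - 1))) * e u)); last by ring.
  rewrite uP// ler_piMl//; first by rewrite !mulr_ge0// ltW.
  by rewrite ler_pdivrMr// mul1r.
rewrite normrM ler_pM//; last exact: E1_le.
by rewrite mulrC; exact: D1_le.
Qed.

(** Near 0 the term u^(alpha - 2) is compensated by w u = O(u^2), the term u^(alpha - 1)
by w' u = O(u). *)
Let w2_le u : 0 < u -> `|w2 u| <= kappa * (5 * u `^ alpha + 2 * (u `^ alpha) ^+ 2 + 1 + K0 * u ^+ 2) * e u.
Proof.
move=> u0; have e0 : 0 <= e u by exact: expR_ge0.
have p0 := powR_ge0 u (alpha - 1); have v0 := powR_ge0 u alpha; have q0 := powR_ge0 u (alpha - 2).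
have ke : 0 <= kappa * e u by rewrite mulr_ge0.
have D1b := D1_le u0; have E1b := E1_le u0.
have t1 : `|- (alpha * ((alpha - 1) * u `^ (alpha - 2))) * w u| <= kappa * u `^ alpha * e u.
  rewrite normrM normrN (normrM alpha) (normrM (alpha - 1)) (ger0_norm (ltW a0)) (ger0_norm q0).
  have aa : `|alpha - 1| <= 1 by rewrite ler_norml; have := a0; have := al2; move=> *; apply/andP; split; lra.
  have := w_le u0 => wb.
  apply: (@le_trans _ _ (2 * (1 * u `^ (alpha - 2)) * (kappa * (u ^+ 2 / 2) * e u))).
    apply: ler_pM => //; first by rewrite !mulr_ge0// ltW.
    apply: ler_pM => //; [exact: ltW|by rewrite mulr_ge0|by rewrite ler_wpM2r].
  rewrite -(uQ u0); move: (e u) (u `^ (alpha - 2)) => ee q.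
  by rewrite le_eqVlt; apply/orP; left; apply/eqP; field.
have t2 : `|alpha * u `^ (alpha - 1) * w1 u| <= kappa * (2 * (u `^ alpha) ^+ 2 + 2 * u `^ alpha) * e u.
  rewrite normrM (normrM alpha) (ger0_norm (ltW a0)) (ger0_norm p0).
  apply: (@le_trans _ _ (2 * u `^ (alpha - 1) * (kappa * (u * u `^ alpha + u) * e u))).
    by apply: ler_pM; [rewrite mulr_ge0// ltW|exact: normr_ge0|rewrite ler_wpM2r|exact: w1_le].
  rewrite [leLHS](_ : _ = kappa * (2 * ((u * u `^ (alpha - 1)) * u `^ alpha) + 2 * (u * u `^ (alpha - 1))) * e u); last by ring.
  by rewrite uP// -expr2.
have t3 : `|D2 u * E1 u| <= kappa * 1 * e u.
  by rewrite mulr1 normrM ler_pM// D2_le.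
have t4 : `|D1 u * (alpha * u `^ (alpha - 1) + D1 u) * E1 u| <= kappa * (2 * u `^ alpha + K0 * u ^+ 2) * e u.
  rewrite normrM (normrM (D1 u)); apply: ler_pM => //.
  apply: (@le_trans _ _ (u * kappa * (2 * u `^ (alpha - 1) + u * K0))).
    apply: ler_pM => //; apply: (le_trans (ler_normD _ _)); apply: lerD.
      by rewrite normrM (ger0_norm (ltW a0)) (ger0_norm p0) ler_wpM2r.
    by apply: (le_trans D1b); rewrite ler_wpM2l// ltW.
  by rewrite -(uP u0) le_eqVlt; apply/orP; left; apply/eqP; ring.
rewrite /w2 (le_trans (ler_normD _ _))//.
have n1 := ler_normB (- (alpha * ((alpha - 1) * u `^ (alpha - 2))) * w u - alpha * u `^ (alpha - 1) * w1 u) (D2 u * E1 u).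
have n2 := ler_normB (- (alpha * ((alpha - 1) * u `^ (alpha - 2))) * w u) (alpha * u `^ (alpha - 1) * w1 u).
rewrite [leRHS](_ : _ = kappa * u `^ alpha * e u + kappa * (2 * (u `^ alpha) ^+ 2 + 2 * u `^ alpha) * e u
  + kappa * 1 * e u + kappa * (2 * u `^ alpha + K0 * u ^+ 2) * e u); last by ring.
by lra.
Qed.

Let G := stretched_weight alpha.

Let v_le u : 0 < u -> u `^ alpha <= (1 + u) ^+ 2.
Proof.
move=> u0; rewrite -powR_mulrn ?addr_ge0 ?(ltW u0)//.
apply: (@le_trans _ _ ((1 + u) `^ alpha)).
  by apply: ge0_ler_powR; rewrite ?nnegrE ?(ltW a0)//; lra.
by rewrite ler_powR//; lra.
Qed.

Let w_leG u : 0 < u -> `|w u| <= kappa * G u.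
Proof.
move=> u0; apply: (le_trans (w_le u0)); rewrite /G /stretched_weight mulrA.
rewrite ler_wpM2r ?expR_ge0// ler_wpM2l//.
have t1 : 1 <= (1 + u) ^+ 2 by apply: exprn_ege1; lra.
by rewrite (_ : 4 = 2 * 2)%N// exprM; nra.
Qed.

Let w1_leG u : 0 < u -> `|w1 u| <= 2 * kappa * G u.
Proof.
move=> u0; apply: (le_trans (w1_le u0)); rewrite /G /stretched_weight mulrA.
rewrite ler_wpM2r ?expR_ge0// mulrAC mulrC ler_wpM2r//.
have vb := v_le u0; have v0 := powR_ge0 u alpha.
have t1 : 1 <= 1 + u by lra.
have t2 : 1 + u <= (1 + u) ^+ 2 by rewrite expr2; nra.
have t3 : (1 + u) ^+ 4 = (1 + u) ^+ 2 * (1 + u) ^+ 2 by rewrite -exprD.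
rewrite t3; move: t2 vb; move: ((1 + u) ^+ 2) (u `^ alpha) v0 => tt v v0 t2 vb.
by nra.
Qed.

Let w2_leG u : 0 < u -> `|w2 u| <= (8 + K0) * kappa * G u.
Proof.
move=> u0; apply: (le_trans (w2_le u0)); rewrite /G /stretched_weight mulrA.
rewrite ler_wpM2r ?expR_ge0// mulrAC mulrC ler_wpM2r//.
have K00 : 0 <= K0 by exact: le_trans kappa_le.
have vb := v_le u0; have v0 := powR_ge0 u alpha.
have t2 : 1 <= (1 + u) ^+ 2 by apply: exprn_ege1; lra.
have t3 : (1 + u) ^+ 4 = (1 + u) ^+ 2 * (1 + u) ^+ 2 by rewrite -exprD.
have t4 : u ^+ 2 <= (1 + u) ^+ 2 by rewrite ler_pXn2r// ?nnegrE; lra.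
rewrite t3; move: t2 vb t4; move: ((1 + u) ^+ 2) (u `^ alpha) v0 (sqr_ge0 u); move: (u ^+ 2) => uu tt v v0 uu0 t2 vb t4.
have h1 : v ^+ 2 <= tt * tt by rewrite expr2 ler_pM.
have h2 : v <= tt * tt by nra.
have h3 : K0 * uu <= K0 * (tt * tt) by rewrite ler_wpM2l//; nra.
by rewrite [leRHS]mulrDl; nra.
Qed.

Let iG : mu.-integrable Rp (EFin \o G) := integrable_stretched_weight a0.

Let idomG (f : R -> R) (C : R) : (forall u : R, 0 < u -> {for u, continuous f}) ->
  (forall u, 0 < u -> `|f u| <= C * G u) ->
  mu.-integrable Rp (EFin \o f) /\ \int[mu]_(u in Rp) `|f u| <= C * \int[mu]_(u in Rp) G u.
Proof.
move=> cf fC.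
have if_ : mu.-integrable Rp (EFin \o f).
  apply: (@le_integrable_fin _ _ R mu Rp f (fun z => C * G z) measurable_Rp).
  - exact: measurable_fun_Rp.
  - exact: (integrableZl measurable_Rp _ iG).
  - by move=> z; rewrite /= in_itv/= andbT; exact: fC.
split => //; rewrite -(RintegralZl _ measurable_Rp iG); apply: le_Rintegral => //.
- exact: integrable_norm if_.
- exact: (integrableZl measurable_Rp _ iG).
- by move=> z; rewrite /= in_itv/= andbT; exact: fC.
Qed.

(** The factor e^(-D) - 1 vanishes to second order at 0, which cancels the singularity of
the derivatives of e^(-u^alpha) there, so that two integrations by parts are licit. *)
Lemma integral_norm_cosine_transform_small_jumps :
  (\int[mu]_y `|cosine_transform w y|%:E <=
    ((9 + K0) * kappa * \int[mu]_(u in Rp) G u)%:E)%E.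
Proof.
have [iw nw] := idomG (fun u u0 => is_derive_continuous (dw u0)) w_leG.
have [iw2 nw2] := idomG cw2 w2_leG.
have [M M0 MP] := stretched_weight_tail a0.
have tail (f : R -> R) C : 0 <= C -> (forall u, 0 < u -> `|f u| <= C * G u) -> f u @[u --> +oo] --> 0.
  move=> C0 fC; apply: (@cvg_tail_powR _ 2 (C * M)) => // z z1.
  have z0 : 0 < z by exact: lt_le_trans z1.
  by apply: (le_trans (fC _ z0)); rewrite -mulrA ler_wpM2l// MP.
have e1 u : e u <= 1 by rewrite expR_le1 oppr_le0 divr_ge0// powR_ge0.
have w0 : w u @[u --> 0^'+] --> 0.
  apply: (@cvg_head_powR _ 2 kappa) => // z /andP[z0 z1].
  apply: (le_trans (w_le z0)); rewrite powR_mulrn ?(ltW z0)// -[leRHS]mulr1.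
  have z2 := sqr_ge0 z; apply: ler_pM => //; first by rewrite mulr_ge0// divr_ge0.
    exact: expR_ge0.
  by rewrite ler_wpM2l//; lra.
have w10 : w1 u @[u --> 0^'+] --> 0.
  apply: (@cvg_head_powR _ 1 (2 * kappa)) => // z /andP[z0 z1].
  apply: (le_trans (w1_le z0)); rewrite powRr1 ?(ltW z0)// -[leRHS]mulr1.
  have v0 := powR_ge0 z alpha.
  have v1 : z `^ alpha <= 1.
    have := @ge0_ler_powR R alpha (ltW a0) z 1.
    by rewrite powR1 !nnegrE; apply => //; exact: ltW.
  apply: ler_pM => //; [|exact: expR_ge0|].
    by rewrite mulr_ge0// addr_ge0 ?mulr_ge0 ?(ltW z0).
  by rewrite (mulrC 2) -mulrA ler_wpM2l//; nra.
have wy := tail _ _ k0 w_leG.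
have w1y : w1 u @[u --> +oo] --> 0 by apply: (tail _ _ _ w1_leG); rewrite mulr_ge0.
apply: (le_trans (integral_norm_cosine_transform_smooth iw iw2 dw dw1 cw2 w0 wy w10 w1y)).
rewrite lee_fin; apply: (le_trans (lerD nw nw2)).
by rewrite -mulrDl (_ : kappa + (8 + K0) * kappa = (9 + K0) * kappa)//; ring.
Qed.

End small_jumps.

(** * Characteristic functions of the two processes *)

Section symmetric_exponent.
Context {R : realType}.
Notation mu := (@lebesgue_measure R).
Notation Rp := (`]0%R, +oo[%classic : set R).
Variables (F : {measure set R -> \bar R}) (rho : R -> R).
Hypothesis mrho : measurable_fun setT rho.
Hypothesis rho0 : forall z, 0 <= rho z.
Hypothesis rho_even : forall z, rho (- z) = rho z.
Hypothesis FE : forall A : set R, measurable A -> F A = (\int[mu]_(z in A) (rho z)%:E)%E.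

Let density (f : R -> \bar R) : measurable_fun setT f -> (forall x, (0 <= f x)%E) ->
  (\int[F]_z f z = \int[mu]_z (f z * (rho z)%:E))%E.
Proof. exact: (ge0_expectation_density (@measurable_id _ _ setT) mrho rho0 FE). Qed.

(** The identity also holds when the integral diverges, as both sides are then 0 by the
convention on integrals with infinite value. *)
Lemma Re_levy_khintchine_even u : complex.Re (levy_khintchine_exponent F u) =
  - (2 * \int[mu]_(z in Rp) (rho z * (1 - cos (u * z)))).
Proof.
rewrite /levy_khintchine_exponent /cintegral /=.
transitivity (fine (\int[F]_z (- (1 - cos (u * z))%:E))%E).
  congr fine; apply: eq_integral => z _ /=.
  by rewrite expR0 mul1r subr0 opprB.
have c0 z : (0 <= (1 - cos (u * z))%:E)%E by rewrite lee_fin onem_cos_ge0.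
have mc : measurable_fun setT (fun z : R => (1 - cos (u * z))%:E).
  by apply/measurable_EFinP; apply: measurable_funB => //; exact: measurable_cosM.
rewrite integral_ge0N; last by move=> z _; exact: c0.
rewrite (density mc c0).
have -> : (\int[mu]_z ((1 - cos (u * z))%:E * (rho z)%:E))%E =
    (\int[mu]_z (rho z * (1 - cos (u * z)))%:E)%E.
  by apply: eq_integral => z _; rewrite -EFinM mulrC.
rewrite (@ge0_integral_even R (fun z => (rho z * (1 - cos (u * z)))%:E)).
- rewrite fineN; congr (- _); rewrite /Rintegral; case: (integral _ _ _) => //=.
    by rewrite gt0_muley ?lte_fin// mulr0.
  by rewrite gt0_muleNy ?lte_fin// mulr0.
- by apply/measurable_EFinP; apply: measurable_funM => //; apply: measurable_funB => //; exact: measurable_cosM.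
- by move=> z; rewrite lee_fin mulr_ge0// onem_cos_ge0.
- by move=> z; rewrite rho_even mulrN cosN.
Qed.

(** The integrand is odd, so its positive and negative parts have the same integral,
finite or not. *)
Lemma Im_levy_khintchine_even u : complex.Im (levy_khintchine_exponent F u) = 0.
Proof.
rewrite /levy_khintchine_exponent /cintegral /=.
set h := fun z : R => expR 0 * sin (u * z) - 0 - u * z * \1_([set y : R | `|y| <= 1]) z.
have mh : measurable_fun setT h.
  apply: measurable_funB.
    apply: measurable_funB => //; apply: measurable_funM => //.
    exact: measurable_sinM.
  apply: measurable_funM; first exact: measurable_funM.
  apply: measurable_indic; rewrite -[X in measurable X]setTI.
  have mn : measurable_fun setT (fun y : R => `|y|) by exact: normr_measurable.
  have := mn measurableT _ (measurable_itv `]-oo, 1%R]).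
  by congr (measurable (_ `&` _)); apply/seteqP; split => y /=; rewrite in_itv.
have hN z : h (- z) = - h z.
  rewrite /h !indicE mulrN sinN !subr0.
  have -> : (- z \in [set y : R | `|y| <= 1]) = (z \in [set y : R | `|y| <= 1]).
    by apply/idP/idP => /set_mem /= zz; apply/mem_set => /=; rewrite normrN in zz *.
  by ring.
rewrite /Rintegral (_ : (\int[F]_x _)%E = (\int[F]_x (EFin \o h) x)%E); last by apply: eq_integral.
rewrite integralE.
suff -> : (\int[F]_x (EFin \o h)^\+ x = \int[F]_x (EFin \o h)^\- x)%E.
  by case: (integral _ _ _) => //= r; rewrite subrr.
have mE : measurable_fun setT (EFin \o h) by exact/measurable_EFinP.
have mp := measurable_funepos mE; have mn := measurable_funeneg mE.
rewrite (density mp)//.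
rewrite (density mn)//.
rewrite ge0_integral_opp.
- apply: eq_integral => z _; rewrite rho_even; congr (_ * _)%E.
  by rewrite funeposE funenegE /= hN EFinN.
- by apply: emeasurable_funM => //; exact/measurable_EFinP.
- by move=> z; rewrite mule_ge0// lee_fin.
Qed.

End symmetric_exponent.

Section real_charfun.
Context {R : realType} d (T : measurableType d) (P : probability T R).

Lemma charfun_real (X : T -> R) u (r : R) : charfun P X u = r%:C%C ->
  \int[P]_w cos (u * X w) = r /\ \int[P]_w sin (u * X w) = 0.
Proof.
rewrite /charfun /cintegral => -[h1 h2]; split.
  by rewrite -h1; apply: eq_Rintegral => w _ /=; rewrite expR0 mul1r.
by rewrite -[RHS]h2; apply: eq_Rintegral => w _ /=; rewrite expR0 mul1r.
Qed.

Lemma charfun_pure_jump_even (F : {measure set R -> \bar R}) (rho : R -> R) X t u :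
  measurable_fun setT rho -> (forall z, 0 <= rho z) -> (forall z, rho (- z) = rho z) ->
  (forall A : set R, measurable A ->
    F A = (\int[@lebesgue_measure R]_(z in A) (rho z)%:E)%E) ->
  charfun P X u = cexp (t%:C%C * levy_khintchine_exponent F u) ->
  let psi := 2 * \int[@lebesgue_measure R]_(z in `]0%R, +oo[%classic) (rho z * (1 - cos (u * z))) in
  \int[P]_w cos (u * X w) = expR (- (t * psi)) /\ \int[P]_w sin (u * X w) = 0.
Proof.
move=> mrho rho0 rhoN FE; have := Re_levy_khintchine_even mrho rho0 rhoN FE u.
have := Im_levy_khintchine_even mrho rho0 rhoN FE u.
case: (levy_khintchine_exponent F u) => a b /= -> -> cX; apply: charfun_real.
rewrite cX /cexp /= !mul0r !mulr0 !subr0 !addr0 cos0 sin0 mulr1 mulr0.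
by rewrite mulrN.
Qed.

End real_charfun.

Section charfun_rescaled.
Context {R : realType}.
Notation mu := (@lebesgue_measure R).
Notation Rp := (`]0%R, +oo[%classic : set R).

Definition rescaled_levy_density (alpha : R) (tau : R -> R) (a z : R) :=
  stable_const alpha * tau (z / a) * z `^ (- 1 - alpha).

Lemma measurable_rescaled_levy_density alpha tau a : measurable_fun setT tau ->
  measurable_fun setT (rescaled_levy_density alpha tau a).
Proof.
move=> mtau; apply: measurable_funM => //; apply: measurable_funM => //.
by apply: measurableT_comp => //; exact: measurable_funM.
Qed.

Lemma integrable_rescaled_levy_density (alpha : R) (tau : R -> R) M a u : 0 < alpha < 2 -> 
  measurable_fun setT tau -> (forall z, `|tau z| <= M) ->
  mu.-integrable Rp
    (EFin \o (fun z => rescaled_levy_density alpha tau a z * (1 - cos (u * z)))).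
Proof.
move=> a02 mtau tauM.
apply: (@le_integrable_fin _ _ R mu Rp _
  (fun z => stable_const alpha * M * (z `^ (- 1 - alpha) * (1 - cos (u * z)))) measurable_Rp).
- apply: measurable_funTS; apply: measurable_funM; first exact: measurable_rescaled_levy_density.
  by apply: measurable_funB => //; exact: measurable_cosM.
- exact: (integrableZl measurable_Rp _ (integrable_levy u a02)).
- move=> z _; rewrite /rescaled_levy_density 2!normrM (ger0_norm (onem_cos_ge0 _)).
  rewrite (ger0_norm (powR_ge0 _ _)) [leRHS]mulrA ler_wpM2r ?onem_cos_ge0//.
  rewrite ler_wpM2r ?powR_ge0// normrM (gtr0_norm (stable_const_gt0 a02)).
  by rewrite ler_wpM2l// ltW// stable_const_gt0.
Qed.

Lemma measurable_levy_density (alpha : R) tau : measurable_fun setT tau ->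
  measurable_fun setT (levy_density alpha tau).
Proof.
move=> mtau; apply: measurable_funM; last first.
  by apply: measurable_indic; exact: measurableC.
apply: measurable_funM; first exact: measurable_funM.
rewrite (_ : (fun z : R => _) = (fun z : R => `|z| `^ (- (alpha + 1)))); last first.
  by apply/funext => z; rewrite powRN.
exact: (@measurableT_comp _ _ _ _ _ _ (fun x : R => x `^ (- (alpha + 1)))).
Qed.

Lemma levy_density_pos (alpha : R) tau z : 0 < z ->
  levy_density alpha tau z = stable_const alpha * tau z * z `^ (- 1 - alpha).
Proof.
move=> z0; rewrite /levy_density (gtr0_norm z0) indicE.
rewrite (_ : z \in [set~ 0]); last by apply/mem_set => /= z00; rewrite z00 ltxx in z0.
by rewrite mulr1 -powRN; congr (_ * _ `^ _); ring.
Qed.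

(** The change of variable z -> n^(1/alpha) z turns z^(-1-alpha) dz into n times itself,
which the time 1/n compensates: only the argument of tau keeps a trace of n. *)
Lemma charfun_rescaled d (T : measurableType d) (P : probability T R)
    (alpha : R) tau (L : R -> {RV P >-> R}) n u : 0 < alpha < 2 ->
  tau_condition tau -> locally_stable_process alpha tau L -> (0 < n)%N ->
  let a := n%:R `^ alpha^-1 in
  \int[P]_w cos (u * (a * L n%:R^-1 w)) = expR (- (2 * \int[mu]_(z in Rp)
    (rescaled_levy_density alpha tau a z * (1 - cos (u * z)))))
  /\ \int[P]_w sin (u * (a * L n%:R^-1 w)) = 0.
Proof.
move=> a02 [mtau tau0 [M tauM] tauN _] [F [FE [_ _ cf]]] n0 a.
have nR0 : 0 < n%:R :> R by rewrite ltr0n.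
have a0 : 0 < a by rewrite powR_gt0.
have al0 : 0 < alpha by case/andP : a02.
have cL := cf n%:R^-1 (u * a) (ltW (etrans (invr_gt0 _) nR0)).
have rho0 z : 0 <= levy_density alpha tau z.
  by rewrite !mulr_ge0 ?invr_ge0 ?powR_ge0// ltW// stable_const_gt0.
have rhoN z : levy_density alpha tau (- z) = levy_density alpha tau z.
  rewrite /levy_density tauN normrN !indicE; congr (_ * (nat_of_bool _)%:R).
  by apply/idP/idP => /set_mem /= zz; apply/mem_set => /= /eqP z0; apply: zz;
    apply/eqP; rewrite ?oppr_eq0// -oppr_eq0.
have [cosL sinL] := charfun_pure_jump_even (measurable_levy_density alpha mtau) rho0 rhoN FE cL.
split; last by rewrite -[RHS]sinL; apply: eq_Rintegral => w _; rewrite mulrA.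
rewrite (_ : \int[P]_w _ = \int[P]_w cos (u * a * L n%:R^-1 w)); last first.
  by apply: eq_Rintegral => w _; rewrite mulrA.
rewrite cosL; congr (expR (- _)); rewrite mulrCA; congr (2 * _).
have tauM' z : `|tau z| <= M by rewrite ger0_norm.
rewrite (Rintegral_Rp_scale a0 (integrable_rescaled_levy_density a u a02 mtau tauM')).
have an : n%:R^-1 = a * a `^ (- 1 - alpha).
  rewrite -{1}(powRr1 (ltW a0)) -powRD; last by rewrite (gt_eqF a0) implybT.
  rewrite addrA subrr add0r powRN /a -powRrM mulVf ?gt_eqF// powRr1//.
rewrite an -mulrA; congr (a * _).
rewrite -(RintegralZl _ measurable_Rp); last first.
  have := integrable_rescaled_levy_density 1 (u * a) a02 mtau tauM'.
  apply: eq_integrable => // z; rewrite inE /= in_itv/= andbT => z0.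
  by rewrite levy_density_pos// /rescaled_levy_density divr1.
apply: eq_Rintegral => z; rewrite inE /= in_itv/= andbT => z0.
rewrite levy_density_pos// /rescaled_levy_density (_ : a * z / a = z); last first.
  by rewrite mulrAC divff ?gt_eqF// mul1r.
by rewrite powRM ?(ltW a0) ?(ltW z0)// (mulrA u); ring.
Qed.

End charfun_rescaled.

(** * Distance between the jump densities *)

Section excess.
Context {R : realType}.
Notation mu := (@lebesgue_measure R).
Notation Rp := (`]0%R, +oo[%classic : set R).

Definition levy_excess (alpha : R) (tau : R -> R) (a z : R) :=
  stable_const alpha * (tau (z / a) - 1) * z `^ (- 1 - alpha).

(** The restrictions of f to z <= r and to z > r, extended by 0. *)
Definition jumps_below (r : R) (f : R -> R) z := if z <= r then f z else 0.
Definition jumps_above (r : R) (f : R -> R) z := if z <= r then 0 else f z.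

Lemma jumps_split r f z : f z = jumps_below r f z + jumps_above r f z.
Proof. by rewrite /jumps_below /jumps_above; case: ifP; rewrite ?addr0 ?add0r. Qed.

Lemma measurable_le_cst (r : R) : measurable_fun setT (fun z : R => z <= r).
Proof. exact: measurable_fun_ler. Qed.

Lemma measurable_jumps_below r f : measurable_fun setT f -> measurable_fun setT (jumps_below r f).
Proof. by move=> mf; apply: measurable_fun_ifT => //; exact: measurable_le_cst. Qed.

Lemma measurable_jumps_above r f : measurable_fun setT f -> measurable_fun setT (jumps_above r f).
Proof. by move=> mf; apply: measurable_fun_ifT => //; exact: measurable_le_cst. Qed.

Lemma measurable_powR_cst (s : R) : measurable_fun setT (fun z : R => z `^ s).
Proof. exact: measurable_powR. Qed.

(** Boundedness of tau makes the local bound |tau z - 1| <= K z global, at the cost of a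
larger constant. *)
Lemma tau_condition_bounds (tau : R -> R) : tau_condition tau -> exists M K : R,
  [/\ 0 < M, 0 < K, forall z, 0 < z -> `|tau z - 1| <= M
    & forall z, 0 < z -> `|tau z - 1| <= K * z].
Proof.
move=> [_ tau0 [M tauM] _ [eta [K [eta0 tauK]]]].
have M0 : 0 <= M := le_trans (tau0 0) (tauM 0).
have tM z : `|tau z - 1| <= M + 1.
  by rewrite ler_norml; have := tau0 z; have := tauM z; move=> *; apply/andP; split; lra.
exists (M + 1), (`|K| + (M + 1) / eta); split => //.
- by rewrite ltr_wpDl.
- by rewrite ltr_wpDl// divr_gt0// ltr_wpDl.
move=> z z0; rewrite mulrDl; have [ze|ze] := leP z eta.
  have := tauK z; rewrite (gtr0_norm z0) z0 ze => /(_ isT) h.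
  apply: (le_trans h); rewrite ler_wpDr//.
    by rewrite mulr_ge0 ?(ltW z0)// divr_ge0 ?(ltW eta0)// addr_ge0.
  by rewrite ler_wpM2r ?(ltW z0)// ler_norm.
apply: (le_trans (tM z)); rewrite ler_wpDl ?mulr_ge0 ?(ltW z0)//.
by rewrite -mulrA ler_peMr ?addr_ge0// mulrC ler_pdivlMr// mul1r ltW.
Qed.

Lemma measurable_levy_excess (alpha : R) tau a : measurable_fun setT tau ->
  measurable_fun setT (levy_excess alpha tau a).
Proof.
move=> mtau; apply: measurable_funM; last exact: measurable_powR_cst.
apply: measurable_funM => //; apply: measurable_funB => //.
by apply: measurableT_comp => //; exact: measurable_funM.
Qed.

Section bounds.
Variables (alpha : R) (tau : R -> R) (M K r : R).
Hypothesis a02 : 0 < alpha < 2.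
Hypothesis mtau : measurable_fun setT tau.
Hypotheses (M0 : 0 < M) (K0 : 0 < K) (r0 : 0 < r) (r1 : r <= 1) (Kr : K * r <= 2^-1).
Hypothesis tauM : forall z, 0 < z -> `|tau z - 1| <= M.
Hypothesis tauK : forall z, 0 < z -> `|tau z - 1| <= K * z.

Notation c := (stable_const alpha).
Let c0 : 0 < c. Proof. exact: stable_const_gt0. Qed.
Let a0 : 0 < alpha. Proof. by case/andP : a02. Qed.

Let excess_le (a z b : R) : 0 < a -> 0 < z -> `|tau (z / a) - 1| <= b ->
  `|levy_excess alpha tau a z| <= c * b * z `^ (- 1 - alpha).
Proof.
move=> a_0 z0 h; rewrite /levy_excess 2!normrM (gtr0_norm c0) (ger0_norm (powR_ge0 _ _)).
by rewrite ler_wpM2r ?powR_ge0// ler_wpM2l// ltW.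
Qed.

Let excess_M (a z : R) : 0 < a -> 0 < z -> `|levy_excess alpha tau a z| <= c * M * z `^ (- 1 - alpha).
Proof. by move=> a_0 z0; apply: excess_le => //; apply: tauM; rewrite divr_gt0. Qed.

Let excess_K (a z : R) : 0 < a -> 0 < z -> `|levy_excess alpha tau a z| <= c * (K * (z / a)) * z `^ (- 1 - alpha).
Proof. by move=> a_0 z0; apply: excess_le => //; apply: tauK; rewrite divr_gt0. Qed.

Let eqW (x y : R) : x = y -> x <= y. Proof. by move=> ->. Qed.

Let zpow (z s : R) : 0 < z -> z * z `^ (s - 1) = z `^ s.
Proof.
move=> z0; rewrite -{1}(powRr1 (ltW z0)) -powRD; last by rewrite (gt_eqF z0) implybT.
by rewrite addrC subrK.
Qed.

Lemma jumps_below_le (a z : R) : 1 <= a -> 0 < z ->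
  `|jumps_below r (levy_excess alpha tau a) z| <= c / 2 * z `^ (- 1 - alpha).
Proof.
move=> a1 z0; have a_0 : 0 < a by exact: lt_le_trans a1.
rewrite /jumps_below; case: ifPn => zr; last first.
  by rewrite normr0 mulr_ge0 ?powR_ge0// divr_ge0// ltW.
apply: (le_trans (excess_K a_0 z0)); rewrite ler_wpM2r ?powR_ge0// ler_wpM2l ?(ltW c0)//.
apply: le_trans Kr; rewrite ler_pM2l//; apply: le_trans zr.
by rewrite ler_pdivrMr// ler_peMr// ltW.
Qed.

Lemma jumps_below_gt1 f z : 1 < z -> jumps_below r f z = 0.
Proof. by move=> z1; rewrite /jumps_below leNgt (le_lt_trans r1). Qed.

Lemma second_moment_jumps_below : exists2 C, 0 <= C & forall a, 1 <= a ->
  2 * \int[mu]_(z in Rp) `|z ^+ 2 * jumps_below r (levy_excess alpha tau a) z| <= C / a.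
Proof.
pose f (z : R) := jumps_below 1 (fun z => z `^ (2 - alpha)) z.
have f0 z : 0 <= f z by rewrite /f /jumps_below; case: ifP => // _; exact: powR_ge0.
have mf : measurable_fun setT f by apply: measurable_jumps_below; exact: measurable_powR_cst.
have if_ : mu.-integrable Rp (EFin \o f).
  apply: (@integrable_Rp_powR R (3 - alpha) 1 1) => //.
  - by case/andP : a02; lra.
  - exact: measurable_funTS.
  - move=> z /andP[z0 z1]; rewrite ger0_norm// /f /jumps_below z1 mul1r.
    by rewrite (_ : 3 - alpha - 1 = 2 - alpha)//; ring.
  - move=> z; rewrite ger0_norm// mul1r le_eqVlt /f /jumps_below => /predU1P[<-|z1].
      by rewrite lexx !powR1.
    by rewrite (leNgt z 1) z1/= powR_ge0.
exists (2 * c * K * \int[mu]_(z in Rp) f z).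
  by rewrite mulr_ge0 ?Rintegral_ge0// !mulr_ge0// ltW.
move=> a a1; have a_0 : 0 < a by exact: lt_le_trans a1.
have bnd z : Rp z -> `|z ^+ 2 * jumps_below r (levy_excess alpha tau a) z| <= c * K / a * f z.
  rewrite /= in_itv/= andbT => z0; rewrite normrM (ger0_norm (sqr_ge0 z)) {1}/jumps_below.
  case: ifPn => zr.
    2: by rewrite normr0 mulr0 mulr_ge0 ?f0// divr_ge0 ?mulr_ge0// ltW.
  rewrite /f /jumps_below (le_trans zr r1) (le_trans (ler_wpM2l (sqr_ge0 z) (excess_K a_0 z0)))//.
  have -> : z `^ (2 - alpha) = z ^+ 2 * (z * z `^ (- alpha - 1)).
    rewrite zpow// -powR_mulrn ?(ltW z0)// -powRD//.
    by rewrite (gt_eqF z0) implybT.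
  by rewrite (_ : - 1 - alpha = - alpha - 1); [apply/eqW; field; exact: lt0r_neq0|ring].
have mg : measurable_fun Rp (fun z => z ^+ 2 * jumps_below r (levy_excess alpha tau a) z).
  apply: measurable_funTS; apply: measurable_funM; first exact: measurable_funX.
  by apply: measurable_jumps_below; exact: measurable_levy_excess.
have ig := @le_integrable_fin _ _ R mu Rp _ _ measurable_Rp mg
  (integrableZl measurable_Rp (c * K / a) if_) bnd.
have := @le_Rintegral _ _ R mu Rp _ _ measurable_Rp (integrable_norm ig)
  (integrableZl measurable_Rp (c * K / a) if_) bnd.
rewrite (RintegralZl _ measurable_Rp if_) => h.
rewrite [leRHS](_ : _ = 2 * (c * K / a * \int[mu]_(z in Rp) f z)); last by ring.
by rewrite ler_pM2l.
Qed.

Notation big a := (jumps_above r (levy_excess alpha tau a)).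

Let mbig a : measurable_fun Rp (big a).
Proof.
by apply: measurable_funTS; apply: measurable_jumps_above; exact: measurable_levy_excess.
Qed.

Lemma jumps_above_dominated a g : mu.-integrable Rp (EFin \o g) -> (forall z, 0 < z -> `|big a z| <= g z) ->
  mu.-integrable Rp (EFin \o big a) /\ \int[mu]_(z in Rp) `|big a z| <= \int[mu]_(z in Rp) g z.
Proof.
move=> ig bg; have bg' z : Rp z -> `|big a z| <= g z by rewrite /= in_itv/= andbT; exact: bg.
have ib := @le_integrable_fin _ _ R mu Rp _ _ measurable_Rp (@mbig a) ig bg'.
by split=> //; exact: (@le_Rintegral _ _ R mu Rp _ _ measurable_Rp (integrable_norm ib) ig bg').
Qed.

(** For alpha < 1 the majorant min (M, K t) t^(-1-alpha) is integrable on the whole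
half-line, and scaling by a produces the factor a^(-alpha), which will be 1/n. *)
Lemma jumps_above_rate_lt1 : alpha < 1 -> exists2 C, 0 <= C & forall a, 1 <= a ->
  mu.-integrable Rp (EFin \o big a) /\ \int[mu]_(z in Rp) `|big a z| <= C * a `^ (- alpha).
Proof.
move=> al1; pose g (t : R) := Num.min M (K * t) * t `^ (- 1 - alpha).
have g0 t : 0 < t -> 0 <= g t.
  by move=> t0; rewrite mulr_ge0 ?powR_ge0// le_min !(ltW, mulr_gt0).
have mg : measurable_fun setT g.
  apply: measurable_funM; last exact: measurable_powR_cst.
  by apply: measurable_minr => //; exact: measurable_funM.
have ig : mu.-integrable Rp (EFin \o g).
  apply: (@integrable_Rp_powR R (1 - alpha) alpha (M + K)) => //.
  - by rewrite subr_gt0.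
  - exact: measurable_funTS.
  - move=> z /andP[z0 z1]; rewrite ger0_norm ?g0//.
    apply: (@le_trans _ _ (K * z * z `^ (- 1 - alpha))).
      by rewrite ler_wpM2r ?powR_ge0// ge_min lexx orbT.
    rewrite -mulrA (_ : - 1 - alpha = - alpha - 1); last by ring.
    rewrite zpow// (_ : 1 - alpha - 1 = - alpha); last by ring.
    by rewrite ler_wpM2r ?powR_ge0// lerDr ltW.
  - move=> z z1; have z0 : 0 < z by exact: lt_le_trans z1.
    rewrite ger0_norm ?g0// ler_wpM2r ?powR_ge0// ge_min; apply/orP; left.
    by rewrite lerDl ltW.
exists (c * \int[mu]_(z in Rp) g z).
  by rewrite mulr_ge0 ?(ltW c0)// Rintegral_ge0// => z; rewrite /= in_itv/= andbT; exact: g0.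
move=> a a1; have a_0 : 0 < a by exact: lt_le_trans a1.
pose h z := c * Num.min M (K * (z / a)) * z `^ (- 1 - alpha).
have bh z : 0 < z -> `|big a z| <= h z.
  move=> z0; have za : 0 < z / a by rewrite divr_gt0.
  rewrite /jumps_above; case: ifPn => _.
    rewrite normr0 mulr_ge0 ?powR_ge0// mulr_ge0 ?(ltW c0)// le_min (ltW M0)/=.
    by rewrite mulr_ge0// ltW.
  by apply: excess_le => //; rewrite le_min tauM ?tauK.
have mh : measurable_fun setT h.
  apply: measurable_funM; last exact: measurable_powR_cst.
  apply: measurable_funM => //; apply: measurable_minr => //.
  by apply: measurable_funM => //; exact: measurable_funM.
have ih : mu.-integrable Rp (EFin \o h).
  apply: (@le_integrable_fin _ _ R mu Rp _ (fun z => c * g z) measurable_Rp).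
  - exact: measurable_funTS.
  - exact: (integrableZl measurable_Rp c ig).
  - move=> z; rewrite /= in_itv/= andbT => z0; have za : z / a <= z.
      by rewrite ler_pdivrMr// ler_peMr// ltW.
    have m0 : 0 <= Num.min M (K * (z / a)).
      by rewrite le_min (ltW M0)/= mulr_ge0 ?divr_ge0// ltW.
    rewrite ger0_norm; last by rewrite mulr_ge0 ?powR_ge0// mulr_ge0// ltW.
    rewrite /g mulrA ler_wpM2r ?powR_ge0// ler_wpM2l ?(ltW c0)//.
    rewrite le_min !ge_min lexx/=; apply/orP; right.
    by rewrite ler_pM2l.
have [ib le_b] := jumps_above_dominated ih bh; split=> //; apply: (le_trans le_b).
rewrite (Rintegral_Rp_scale a_0 ih).
rewrite (_ : \int[mu]_(z in Rp) h (a * z) = \int[mu]_(z in Rp) (c * a `^ (- 1 - alpha) * g z)); last first.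
  apply: eq_Rintegral => z; rewrite inE /= in_itv/= andbT => z0.
  rewrite /h (_ : a * z / a = z); last by rewrite mulrAC divff ?mul1r// gt_eqF.
  by rewrite powRM ?(ltW a_0) ?(ltW z0)// /g; ring.
rewrite (RintegralZl _ measurable_Rp ig) -(zpow (- alpha) a_0).
by rewrite (_ : - 1 - alpha = - alpha - 1); [apply/eqW; ring|ring].
Qed.

(** For alpha > 1 the bound K z / a alone is enough, as z^(-alpha) is integrable at
infinity. *)
Lemma jumps_above_rate_gt1 : 1 < alpha -> exists2 C, 0 <= C & forall a, 1 <= a ->
  mu.-integrable Rp (EFin \o big a) /\ \int[mu]_(z in Rp) `|big a z| <= C / a.
Proof.
move=> al1; pose g (z : R) := jumps_above r (fun z => z `^ (- alpha)) z.
have g0 z : 0 <= g z by rewrite /g /jumps_above; case: ifP => // _; exact: powR_ge0.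
have mg : measurable_fun setT g by apply: measurable_jumps_above; exact: measurable_powR_cst.
have ig : mu.-integrable Rp (EFin \o g).
  apply: (@integrable_Rp_powR R 1 (alpha - 1) (r `^ (- alpha) + 1)) => //.
  - by rewrite subr_gt0.
  - exact: measurable_funTS.
  - move=> z /andP[z0 z1]; rewrite ger0_norm// subrr powRr0 mulr1 /g /jumps_above.
    case: ifPn => [_|]; first by rewrite addr_ge0 ?powR_ge0.
    rewrite -ltNge => rz; rewrite ler_wpDr// !powRN lef_pV2 ?posrE ?powR_gt0//.
    by apply: ge0_ler_powR; rewrite ?nnegrE ?(ltW a0) ?(ltW r0) ?(ltW z0) ?(ltW rz).
  - move=> z z1; rewrite ger0_norm// (_ : - 1 - (alpha - 1) = - alpha); last by ring.
    rewrite /g /jumps_above; case: ifP => _; first by rewrite mulr_ge0 ?addr_ge0 ?powR_ge0.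
    by rewrite ler_peMl ?powR_ge0// lerDr powR_ge0.
exists (c * K * \int[mu]_(z in Rp) g z).
  by rewrite !mulr_ge0 ?(ltW c0) ?(ltW K0)// Rintegral_ge0.
move=> a a1; have a_0 : 0 < a by exact: lt_le_trans a1.
have bg z : 0 < z -> `|big a z| <= c * K / a * g z.
  move=> z0; rewrite /g /jumps_above; case: ifPn => _; first by rewrite normr0 mulr0.
  apply: (le_trans (excess_K a_0 z0)); rewrite -(zpow (- alpha) z0).
  by rewrite (_ : - 1 - alpha = - alpha - 1); [apply/eqW; field; exact: lt0r_neq0|ring].
have [ib le_b] := jumps_above_dominated (integrableZl measurable_Rp (c * K / a) ig) bg.
split=> //; apply: (le_trans le_b); rewrite (RintegralZl _ measurable_Rp ig).
by apply/eqW; ring.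
Qed.

(** For alpha = 1 neither bound suffices and min (M, K z / a) z^(-2) is compared with
1 / (z (z + a)); as z >= (z + r) / 2 for z > r, the cutoff can be replaced by the shift
r, which gives a kernel with an explicit primitive. *)
Lemma jumps_above_le1 (a z : R) : alpha = 1 -> 1 <= a -> 0 < z ->
  `|big a z| <= 4 * c * (M + K) * ((z + r) * (z + a))^-1.
Proof.
move=> al1 a1 z0; have a_0 : 0 < a by exact: lt_le_trans a1.
have p0 : 0 < (z + r) * (z + a) by rewrite mulr_gt0 ?addr_gt0.
have MK0 : 0 < M + K by rewrite addr_gt0.
rewrite /jumps_above; case: ifPn => [_|].
  by rewrite normr0 mulr_ge0 ?invr_ge0 ?(ltW p0)// !mulr_ge0// ltW.
rewrite -ltNge => rz.
have zE : z `^ (- 1 - alpha) = (z * z)^-1.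
  by rewrite al1 (_ : - 1 - 1 = - 2%:R); [rewrite powRN powR_mulrn ?(ltW z0)// expr2|ring].
have key B q : 0 <= B -> B <= M + K -> 0 < q -> (z + r) * (z + a) <= 4 * q ->
    c * (B / q) <= 4 * c * (M + K) / ((z + r) * (z + a)).
  move=> B0 BM q0 pq.
  rewrite [leRHS](_ : _ = c * ((M + K) * (4 / ((z + r) * (z + a))))); last by ring.
  rewrite ler_pM2l//; apply: ler_pM => //; first by rewrite invr_ge0 ltW.
  by rewrite ler_pdivlMr// mulrC ler_pdivrMr.
have [za|az] := leP z a.
  apply: (le_trans (excess_K a_0 z0)); rewrite zE.
  rewrite (_ : c * (K * (z / a)) / (z * z) = c * (K * (z * a)^-1)); last first.
    by field; rewrite !gt_eqF.
  apply: key; [exact: ltW|by rewrite lerDr ltW|exact: mulr_gt0|by nra].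
apply: (le_trans (excess_M a_0 z0)); rewrite zE -mulrA; apply: key => //.
- exact: ltW.
- by rewrite lerDl ltW.
- exact: mulr_gt0.
- by nra.
Qed.

End bounds.

End excess.

Section log_kernel.
Context {R : realType}.
Notation mu := (@lebesgue_measure R).
Notation Rp := (`]0%R, +oo[%classic : set R).
Variables (r b : R).
Hypothesis r0 : 0 < r.
Hypothesis rb : r < b.

Let b0 : 0 < b. Proof. exact: lt_trans rb. Qed.
Let f (z : R) := ((z + r) * (z + b))^-1.
Let F (z : R) := (b - r)^-1 * (ln (z + r) - ln (z + b)).

Let dF (z : R) : 0 <= z -> is_derive z 1 F (f z).
Proof.
move=> z0; have zr : 0 < z + r by rewrite ltr_wpDl.
have zb : 0 < z + b by rewrite ltr_wpDl.
have h := is_derive1Ml (b - r)^-1 (is_derive1B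
  (@is_derive1O _ (@ln R) (fun z => z + r) z _ _ (is_derive1_ln zr) (is_derive1D (is_derive1I z) (is_derive1C r z)))
  (@is_derive1O _ (@ln R) (fun z => z + b) z _ _ (is_derive1_ln zb) (is_derive1D (is_derive1I z) (is_derive1C b z)))).
by apply: (is_derive_eqr h); rewrite /f; field; rewrite !gt_eqF// subr_gt0.
Qed.

Let cf (z : R) : 0 < z -> {for z, continuous f}.
Proof.
move=> z0; have zr : 0 < z + r by rewrite addr_gt0.
have zb : 0 < z + b by rewrite addr_gt0.
apply: continuousV; first by rewrite gt_eqF// mulr_gt0.
have h := is_derive1M (is_derive1D (is_derive1I z) (is_derive1C r z))
  (is_derive1D (is_derive1I z) (is_derive1C b z)).
exact: is_derive_continuous h.
Qed.

Let F_le (z : R) : 0 < z -> `|F z| <= z^-1.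
Proof.
move=> z0; have zr : 0 < z + r by rewrite addr_gt0.
have zb : 0 < z + b by rewrite addr_gt0.
have br : 0 < b - r by rewrite subr_gt0.
rewrite /F normrM gtr0_norm ?invr_gt0// ler0_norm; last first.
  by rewrite subr_le0 ler_ln ?posrE// lerD2l ltW.
rewrite opprB -ln_div ?posrE// mulrC ler_pdivrMr//.
have -> : (z + b) / (z + r) = 1 + (b - r) / (z + r) by field; rewrite gt_eqF.
apply: (@le_trans _ _ ((b - r) / (z + r))).
  by apply: le_ln1Dx; apply: (lt_trans (ltrN10 R)); rewrite divr_gt0.
by rewrite mulrC ler_wpM2r ?(ltW br)// lef_pV2 ?posrE// lerDl ltW.
Qed.

Lemma integrable_log_kernel : mu.-integrable Rp (EFin \o (fun z => ((z + r) * (z + b))^-1)).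
Proof.
apply: (@integrable_Rp_powR R 1 1 (1 + (r * b)^-1)) => //.
- apply: measurable_fun_Rp; exact: cf.
- move=> z /andP[z0 z1]; rewrite subrr powRr0 mulr1.
  rewrite ger0_norm ?invr_ge0 ?mulr_ge0 ?addr_ge0 ?(ltW z0) ?(ltW r0) ?(ltW b0)//.
  apply: (@le_trans _ _ (r * b)^-1); last by rewrite lerDr.
  rewrite lef_pV2 ?posrE ?mulr_gt0 ?addr_gt0// ler_pM ?(ltW r0) ?(ltW b0)// lerDr; exact: ltW.
- move=> z z1; have z0 : 0 < z by exact: lt_le_trans z1.
  rewrite ger0_norm ?invr_ge0 ?mulr_ge0 ?addr_ge0 ?(ltW z0) ?(ltW r0) ?(ltW b0)//.
  rewrite (_ : - 1 - 1 = - 2%:R); last by ring.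
  rewrite powRN powR_mulrn ?(ltW z0)//; apply: (@le_trans _ _ (z ^+ 2)^-1); last first.
    by rewrite ler_peMl ?invr_ge0 ?sqr_ge0// lerDl invr_ge0 mulr_ge0// ltW.
  rewrite lef_pV2 ?posrE ?exprn_gt0 ?mulr_gt0 ?addr_gt0// expr2 ler_pM ?(ltW z0)// lerDl; exact: ltW.
Qed.

(** This is the source of the logarithm for alpha = 1. *)
Lemma integral_log_kernel : \int[mu]_(z in Rp) ((z + r) * (z + b))^-1 = ln (b / r) / (b - r).
Proof.
transitivity (0 - (b - r)^-1 * (ln r - ln b)); last by rewrite ln_div ?posrE//; ring.
apply: (@Rintegral_FTC_Rp _ f F _ 0 integrable_log_kernel cf).
- by move=> z /ltW; exact: dF.
- rewrite (_ : _ * _ = F 0); last by rewrite /F !add0r.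
  by apply: cvg_at_right_filter; exact: is_derive_continuous (dF (lexx 0)).
- apply: (@cvg_tail_powR _ 1 1) => // z z1; have z0 : 0 < z by exact: lt_le_trans z1.
  by rewrite mul1r powRN powRr1 ?(ltW z0)// F_le.
Qed.

End log_kernel.

Section rates.
Context {R : realType}.
Notation mu := (@lebesgue_measure R).
Notation Rp := (`]0%R, +oo[%classic : set R).

Lemma ln2_gt0 : 0 < ln (2 : R). Proof. by rewrite ln_gt0// ltr1n. Qed.

Lemma ln2_le (n : nat) : (2 <= n)%N -> ln (2 : R) <= ln n%:R.
Proof. by move=> n2; rewrite ler_ln ?posrE ?ltr0n ?ler_nat// (leq_trans _ n2). Qed.

Lemma powR_inv_ge1 (alpha : R) (n : nat) : 0 < alpha -> (1 <= n)%N -> 1 <= n%:R `^ alpha^-1.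
Proof. by move=> a0 n1; rewrite -[leLHS](powRr0 n%:R) ler_powR ?ler1n// invr_ge0 ltW. Qed.

Lemma tv_rate_ge0 (alpha : R) n : (1 <= n)%N -> 0 <= tv_rate alpha n.
Proof.
move=> n1; rewrite /tv_rate; case: ifP => _; first by rewrite invr_ge0.
case: ifP => _; last by rewrite invr_ge0 powR_ge0.
by rewrite divr_ge0// ln_ge0// ler1n.
Qed.

Lemma tv_rate_le1 (alpha : R) n : 0 < alpha -> (1 <= n)%N -> tv_rate alpha n <= 1.
Proof.
move=> a0 n1; have n0 : 0 < n%:R :> R by rewrite ltr0n.
rewrite /tv_rate; case: ifP => _; first by rewrite invf_le1// ler1n.
case: ifP => _; last by rewrite invf_le1 ?powR_inv_ge1// powR_gt0.
rewrite ler_pdivrMr// mul1r -[X in ln X](subrK 1) addrC.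
apply: (le_trans (le_ln1Dx _)); last by rewrite lerBlDr lerDl.
by rewrite ltrBrDr addNr.
Qed.

(** The second moment of the small jumps is of order n^(-1/alpha), hence of the order of
the rate at most; for alpha = 1 this uses ln n >= ln 2. *)
Lemma invr_scale_le_tv_rate (alpha : R) n : 0 < alpha -> (2 <= n)%N ->
  (n%:R `^ alpha^-1)^-1 <= (1 + (ln 2)^-1) * tv_rate alpha n.
Proof.
move=> a0 n2; have n1 : (1 <= n)%N by exact: leq_trans n2.
have n0 : 0 < n%:R :> R by rewrite ltr0n.
have l2 := ln2_gt0; have li : 0 < (ln 2 : R)^-1 by rewrite invr_gt0.
rewrite /tv_rate; case: ltP => [al1|al1].
  apply: (@le_trans _ _ n%:R^-1); last by rewrite ler_peMl ?invr_ge0// lerDl ltW.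
  rewrite lef_pV2 ?posrE ?powR_gt0// -{1}(powRr1 (ltW n0)) ler_powR ?ler1n//.
  by rewrite -[1]invr1 lef_pV2 ?posrE// ltW.
case: eqP => [->|_].
  rewrite invr1 powRr1 ?(ltW n0)// mulrA ler_peMl ?invr_ge0//.
  rewrite mulrDl mul1r; apply: (@le_trans _ _ ((ln 2)^-1 * ln n%:R)).
    by rewrite mulrC ler_pdivlMr// mul1r ln2_le.
  by rewrite lerDr ln_ge0// ler1n.
by rewrite ler_peMl ?invr_ge0 ?powR_ge0// lerDl ltW.
Qed.

(** The threshold r is chosen so that below it the two jump densities differ by at most
half of the stable one, uniformly in n; above it the two densities differ, in L1, by no more
than the claimed rate. *)
Lemma levy_excess_rate (alpha : R) (tau : R -> R) : 0 < alpha < 2 -> tau_condition tau ->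
  exists r C : R, 0 < C /\ forall n, (2 <= n)%N ->
  let delta := levy_excess alpha tau (n%:R `^ alpha^-1) in
  [/\ forall z, 1 < z -> jumps_below r delta z = 0,
      forall z, 0 < z -> `|jumps_below r delta z| <= stable_const alpha / 2 * z `^ (- 1 - alpha),
      2 * \int[mu]_(z in Rp) `|z ^+ 2 * jumps_below r delta z| <= C * tv_rate alpha n,
      mu.-integrable Rp (EFin \o jumps_above r delta) &
      \int[mu]_(z in Rp) `|jumps_above r delta z| <= C * tv_rate alpha n].
Proof.
move=> a02 ct; have [mtau _ _ _ _] := ct.
have [M [K [M0 K0 tauM tauK]]] := tau_condition_bounds ct.
have a0 : 0 < alpha by case/andP : a02.
(* Below r, |tau (z / a) - 1| <= K r <= 1/2 as a >= 1; the bound r <= 1 gives the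
   support in z <= 1. *)
pose r := Num.min 1 (2 * K)^-1.
have r0 : 0 < r by rewrite lt_min ltr01/= invr_gt0 mulr_gt0.
have r1 : r <= 1 by rewrite ge_min lexx.
have Kr : K * r <= 2^-1.
  rewrite -ler_pdivlMl// (_ : K^-1 * 2^-1 = (2 * K)^-1); last by rewrite invfM mulrC.
  by rewrite ge_min lexx orbT.
have c0 := stable_const_gt0 a02.
have [C1 C10 C1P] := second_moment_jumps_below a02 mtau K0 r1 tauK.
have [C2 C20 C2P] : exists2 C2, 0 <= C2 & forall n, (2 <= n)%N ->
    let delta := levy_excess alpha tau (n%:R `^ alpha^-1) in
    mu.-integrable Rp (EFin \o jumps_above r delta) /\
    \int[mu]_(z in Rp) `|jumps_above r delta z| <= C2 * tv_rate alpha n.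
  have [al1|al1|al1] := ltgtP alpha 1.
  - have [C C0 CP] := jumps_above_rate_lt1 r a02 mtau M0 K0 tauM tauK al1.
    exists C => // n n2; have n1 : (1 <= n)%N by exact: leq_trans n2.
    have := CP _ (powR_inv_ge1 a0 n1).
    rewrite /tv_rate al1 -powRrM mulrN mulVf ?gt_eqF// powRN powRr1//.
  - have [C C0 CP] := jumps_above_rate_gt1 a02 mtau K0 r0 tauK al1.
    exists C => // n n2; have n1 : (1 <= n)%N by exact: leq_trans n2.
    have := CP _ (powR_inv_ge1 a0 n1).
    by rewrite /tv_rate ltNge (ltW al1) (gt_eqF al1).
  have l2 := ln2_gt0.
  have lr : ln r <= 0 by exact: ln_le0.
  pose C := 4 * stable_const alpha * (M + K).
  have C0 : 0 < C by rewrite !mulr_gt0// addr_gt0.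
  exists (C * (2 * (1 - ln r / ln 2))).
    rewrite mulr_ge0 ?(ltW C0)// mulr_ge0// subr_ge0 (le_trans _ ler01)//.
    by rewrite pmulr_lle0 ?invr_gt0.
  move=> n n2; have n1 : (1 <= n)%N by exact: leq_trans n2.
  have b2 : 2 <= n%:R :> R by rewrite ler_nat.
  have lb := ln2_le n2.
  have -> : tv_rate alpha n = ln n%:R / n%:R by rewrite /tv_rate al1 ltxx eqxx.
  rewrite (_ : n%:R `^ alpha^-1 = n%:R); last by rewrite al1 invr1 powRr1// (le_trans _ b2).
  move: b2 lb; move: (n%:R : R) => b b2 lb.
  have rb : r < b by lra.
  have b1 : 1 <= b by lra.
  have bnd z (z0 : 0 < z) := jumps_above_le1 a02 M0 K0 r0 tauM tauK al1 b1 z0.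
  have ik := integrableZl measurable_Rp C (integrable_log_kernel r0 rb).
  have [i1 i2] := jumps_above_dominated mtau ik bnd; split => //.
  apply: (le_trans i2); rewrite (RintegralZl _ measurable_Rp (integrable_log_kernel r0 rb)).
  rewrite (integral_log_kernel r0 rb) -[leRHS]mulrA ler_pM2l// ln_div ?posrE//; last by lra.
  have b0 : 0 < b by lra.
  have lnb : 0 < ln b by lra.
  rewrite [leRHS](_ : _ = ((1 - ln r / ln 2) * ln b) * (2 / b)); last by ring.
  apply: ler_pM.
  - by lra.
  - by rewrite invr_ge0; lra.
  - have h : 1 <= ln b / ln 2 by rewrite ler_pdivlMr// mul1r.
    have h2 : - ln r <= - ln r * (ln b / ln 2) by rewrite ler_peMr// oppr_ge0.
    by rewrite mulrBl mul1r lerD2l (le_trans h2)// le_eqVlt; apply/orP; left; apply/eqP; ring.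
  - by rewrite ler_pdivlMr// ler_pdivrMl; lra.
exists r, (C1 * (1 + (ln 2)^-1) + C2 + 1); split.
  by rewrite ltr_wpDl// addr_ge0// mulr_ge0// addr_ge0// invr_ge0 ltW// ln2_gt0.
move=> n n2 delta; have n1 : (1 <= n)%N by exact: leq_trans n2.
have a1 := powR_inv_ge1 a0 n1.
have t0 := tv_rate_ge0 alpha n1.
have [i1 i2] := C2P _ n2.
split => //.
- by move=> z; exact: jumps_below_gt1.
- by move=> z z0; exact: (jumps_below_le a02 K0 Kr tauK).
- apply: (le_trans (C1P _ a1)); rewrite mulrDl mulrDl -mulrA.
  rewrite -addrA ler_wpDr//; first by rewrite addr_ge0 ?mulr_ge0.
  by rewrite ler_wpM2l// invr_scale_le_tv_rate.
- apply: (le_trans i2); rewrite ler_wpM2r//.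
  by rewrite addrAC ler_wpDl// addr_ge0// mulr_ge0// addr_ge0// invr_ge0 ltW// ln2_gt0.
Qed.

End rates.

(** * Distance between the densities *)

Section linearity.
Context {R : realType}.
Notation mu := (@lebesgue_measure R).
Notation Rp := (`]0%R, +oo[%classic : set R).

Lemma cosine_transformB (f g : R -> R) y : mu.-integrable Rp (EFin \o f) ->
  mu.-integrable Rp (EFin \o g) ->
  cosine_transform (fun u => f u - g u) y = cosine_transform f y - cosine_transform g y.
Proof.
move=> if_ ig; rewrite /cosine_transform -mulrBr; congr (_ * _).
rewrite -(RintegralB measurable_Rp (integrableM_cos y if_) (integrableM_cos y ig)).
by apply: eq_Rintegral => u _; rewrite mulrBl.
Qed.

Lemma eq_cosine_transform (f g : R -> R) y : (forall u, 0 < u -> f u = g u) ->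
  cosine_transform f y = cosine_transform g y.
Proof.
move=> fg; congr (_ * _); apply: eq_Rintegral => u; rewrite inE /= in_itv/= andbT => u0.
by rewrite fg.
Qed.

End linearity.

Section densities.
Context {R : realType} d (T : measurableType d) (P : probability T R).
Notation mu := (@lebesgue_measure R).
Notation Rp := (`]0%R, +oo[%classic : set R).

Lemma measurable_cos_transform (X : T -> R) : measurable_fun setT X ->
  measurable_fun setT (fun u : R => \int[P]_w cos (u * X w)).
Proof.
move=> mX.
have i1 : P.-integrable setT (EFin \o (fun=> 1 : R)) by exact: finite_measure_integrable_cst.
have mc : measurable_fun setT (fun z : R * T => cos (z.1 * X z.2)).
  apply: measurableT_comp; first exact: continuous_measurable_fun (@continuous_cos R).
  by apply: measurable_funM => //; exact: measurableT_comp.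
have := @measurable_kernel_integral _ _ R _ _ P setT measurableT (fun=> 1) (fun z => cos (z.1 * X z.2)) 1 i1 mc.
move=> /(_ (fun z => cos_max _)); congr (measurable_fun _ _).
by apply/funext => u; apply: eq_Rintegral => w _; rewrite mul1r.
Qed.

Variables (X Y : T -> R) (alpha : R) (d1 d2 : R -> R) (kappa K0 eps : R).
Hypotheses (mX : measurable_fun setT X) (mY : measurable_fun setT Y).
Hypothesis a02 : 0 < alpha < 2.
Notation c := (stable_const alpha).
Hypothesis md1 : measurable_fun Rp d1.
Hypothesis d1_small : forall z, 1 < z -> d1 z = 0.
Hypothesis d1_le : forall z, 0 < z -> `|d1 z| <= c / 2 * z `^ (- 1 - alpha).
Hypothesis d1_kappa : 2 * \int[mu]_(z in Rp) `|z ^+ 2 * d1 z| <= kappa.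
Hypothesis kappa_le : kappa <= K0.
Hypothesis id2 : mu.-integrable Rp (EFin \o d2).
Hypothesis d2_eps : \int[mu]_(z in Rp) `|d2 z| <= eps.
Let D1 u := 2 * \int[mu]_(z in Rp) (d1 z * (1 - cos (u * z))).
Let D2 u := 2 * \int[mu]_(z in Rp) (d2 z * (1 - cos (u * z))).
Hypothesis cosX : forall u, 0 < u ->
  \int[P]_w cos (u * X w) = expR (- (u `^ alpha + D1 u + D2 u)).
Hypothesis sinX : forall u, 0 < u -> \int[P]_w sin (u * X w) = 0.
Hypothesis cosY : forall u, 0 < u -> \int[P]_w cos (u * Y w) = expR (- (u `^ alpha)).
Hypothesis sinY : forall u, 0 < u -> \int[P]_w sin (u * Y w) = 0.

Let a0 : 0 < alpha. Proof. by case/andP : a02. Qed.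
Let phiX u := \int[P]_w cos (u * X w).
Let phiY u := expR (- (u `^ alpha)).
Let iG := integrable_stretched_weight a0.
Let phi1 u : 0 < u -> expR (- (u `^ alpha / 2)) <= stretched_weight alpha u.
Proof.
move=> u0; rewrite /stretched_weight ler_peMl ?expR_ge0//.
by apply: exprn_ege1; lra.
Qed.

Let iY : mu.-integrable Rp (EFin \o phiY).
Proof.
apply: (@le_integrable_fin _ _ R mu Rp _ (stretched_weight alpha) measurable_Rp) => //.
- apply: measurable_funTS; apply: measurableT_comp => //; exact: measurable_funN.
- move=> u; rewrite /= in_itv/= andbT => u0.
  rewrite ger0_norm ?expR_ge0//; apply: le_trans (phi1 u0).
  by rewrite ler_expR; have := powR_ge0 u alpha; lra.
Qed.

(** |D1| takes at most half of u^alpha and D2 is bounded, so the perturbed characteristic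
function still decays like e^(-u^alpha / 2). *)
Let iX : mu.-integrable Rp (EFin \o phiX).
Proof.
apply: (@le_integrable_fin _ _ R mu Rp _ (fun u => expR (4 * eps) * stretched_weight alpha u) measurable_Rp).
- by apply: measurable_funTS; exact: measurable_cos_transform.
- exact: (integrableZl measurable_Rp _ iG).
- move=> u; rewrite /= in_itv/= andbT => u0.
  rewrite /phiX cosX// ger0_norm ?expR_ge0//.
  apply: (@le_trans _ _ (expR (4 * eps) * expR (- (u `^ alpha / 2)))).
    have h1 := normr_exponent_small_jumps a02 md1 d1_small d1_le u0.
    have h2 := normr_levy_exponent_le id2 d2_eps u.
    rewrite -expRD ler_expR; move: h1 h2; rewrite -/(D1 u) -/(D2 u) !ler_norml.
    by move=> /andP[h1 _] /andP[h2 _]; lra.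
  by rewrite ler_wpM2l ?expR_ge0// phi1.
Qed.

Let p := cosine_transform phiX.
Let q := cosine_transform phiY.
Let cX u (u0 : 0 < u) : \int[P]_w cos (u * X w) = phiX u := erefl.

Let eD2 u : expR (D2 u) <= expR (4 * eps).
Proof. by rewrite ler_expR (le_trans (ler_norm _))// (normr_levy_exponent_le id2 d2_eps). Qed.

(** phiX - phiY = w - phiX (e^D2 - 1), where w = phiX e^D2 - phiY no longer involves the
jumps collected in D2. *)
Lemma L1_dist_densities : exists2 p : R -> R,
  [/\ measurable_fun setT p, forall y, 0 <= p y &
   forall A : set R, measurable A -> P (X @^-1` A) = (\int[mu]_(y in A) (p y)%:E)%E] &
  [/\ measurable_fun setT q, forall y, 0 <= q y,
   forall A : set R, measurable A -> P (Y @^-1` A) = (\int[mu]_(y in A) (q y)%:E)%E &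
  (\int[mu]_y `|p y - q y|%:E <=
    ((9 + K0) * kappa * \int[mu]_(u in Rp) stretched_weight alpha u
     + (expR (4 * eps) - 1))%:E)%E].
Proof.
have mp := measurable_cosine_transform iX.
have mq := measurable_cosine_transform iY.
have p0 := cosine_transform_ge0 mX iX cX sinX.
have q0 := cosine_transform_ge0 mY iY cosY sinY.
have lX := density_of_charfun mX iX cX sinX.
have lY := density_of_charfun mY iY cosY sinY.
exists p => //; split => //.
pose w u := expR (- u `^ alpha) * (expR (- D1 u) - 1).
pose v u := phiX u * (expR (D2 u) - 1).
have iv0 : mu.-integrable Rp (EFin \o (fun u => phiX u * expR (D2 u))).
  apply: (@integrableM_bounded _ _ R mu Rp _ _ (expR (4 * eps)) measurable_Rp iX).
    by apply: measurable_funTS; apply: measurableT_comp => //; exact: measurable_levy_exponent.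
  by move=> u _; rewrite ger0_norm ?expR_ge0.
have iv : mu.-integrable Rp (EFin \o v).
  apply: eq_integrable (integrableB measurable_Rp iv0 iX) => // u _ /=.
  by rewrite /v mulrBr mulr1.
have wE u : 0 < u -> phiX u * expR (D2 u) - phiY u = w u.
  move=> u0; rewrite /w mulrBr mulr1 -expRD /phiX cosX// -expRD; congr (expR _ - _).
  by rewrite -/(D1 u) -/(D2 u); ring.
have iw : mu.-integrable Rp (EFin \o w).
  apply: eq_integrable (integrableB measurable_Rp iv0 iY) => // u.
  by rewrite inE /= in_itv/= andbT => u0; rewrite -wE.
have pqE y : p y - q y = cosine_transform w y - cosine_transform v y.
  rewrite -(cosine_transformB y iw iv) -(cosine_transformB y iX iY).
  by apply: eq_cosine_transform => u u0; rewrite -wE// /v; ring.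
have n1 : (\int[mu]_y `|cosine_transform phiX y|%:E <= 1)%E.
  rewrite -(integral_density1 lX) le_eqVlt; apply/orP; left; apply/eqP.
  by apply: eq_integral => y _; rewrite ger0_norm.
have hw : (\int[mu]_y `|cosine_transform w y|%:E <= _)%E := integral_norm_cosine_transform_small_jumps a02 md1 d1_small d1_le d1_kappa kappa_le.
have hv : (\int[mu]_y `|cosine_transform v y|%:E <= _)%E := integral_norm_cosine_transform_expR id2 d2_eps iX n1.
move: (measurable_cosine_transform iw) (measurable_cosine_transform iv) pqE hw hv.
move: (cosine_transform w) (cosine_transform v) => W V mW mV pqE hw hv.
have mnW : measurable_fun setT (fun y => `|W y|%:E).
  by apply/measurable_EFinP; exact: measurableT_comp.
have mnV : measurable_fun setT (fun y => `|V y|%:E).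
  by apply/measurable_EFinP; exact: measurableT_comp.
apply: (@le_trans _ _ (\int[mu]_y (`|W y|%:E + `|V y|%:E))%E).
  apply: ge0_le_integral => //.
  - by apply/measurable_EFinP; apply: measurableT_comp => //; exact: (measurable_funB mp mq).
  - exact: (emeasurable_funD mnW mnV).
  - by move=> y _; rewrite -EFinD lee_fin pqE ler_normB.
by rewrite ge0_integralD// EFinD; exact: leeD hw hv.
Qed.

End densities.

Section total_variation.
Context {R : realType} d (T : measurableType d) (P : probability T R).
Notation mu := (@lebesgue_measure R).
Notation Rp := (`]0%R, +oo[%classic : set R).

Lemma charfun_stable (alpha : R) (S : R -> {RV P >-> R}) u : symmetric_stable_process alpha S -> 0 < u ->
  \int[P]_w cos (u * S 1 w) = expR (- (u `^ alpha)) /\ \int[P]_w sin (u * S 1 w) = 0.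
Proof. by move=> [_ /(_ u) cf] u0; apply: charfun_real; rewrite cf (gtr0_norm u0). Qed.

Lemma rescaled_exponent_split (alpha : R) tau r a u : 0 < alpha < 2 -> 0 < u ->
  tau_condition tau ->
  mu.-integrable Rp (EFin \o jumps_above r (levy_excess alpha tau a)) ->
  let delta := levy_excess alpha tau a in
  2 * \int[mu]_(z in Rp) (rescaled_levy_density alpha tau a z * (1 - cos (u * z))) =
  u `^ alpha + 2 * \int[mu]_(z in Rp) (jumps_below r delta z * (1 - cos (u * z)))
    + 2 * \int[mu]_(z in Rp) (jumps_above r delta z * (1 - cos (u * z))).
Proof.
move=> a02 u0 [mtau tau0 [M tauM] _ _] ia delta.
have iN := @integrable_rescaled_levy_density R alpha tau M a u a02 mtau
  (fun z => eq_ind_r (fun x => x <= M) (tauM z) (ger0_norm (tau0 z))).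
have NE z : rescaled_levy_density alpha tau a z = stable_const alpha * z `^ (- 1 - alpha)
    + (jumps_below r delta z + jumps_above r delta z).
  by rewrite -jumps_split /delta /levy_excess /rescaled_levy_density; ring.
have iL := integrableZl measurable_Rp (stable_const alpha) (integrable_levy u a02).
have iA : mu.-integrable Rp (EFin \o (fun z => jumps_above r delta z * (1 - cos (u * z)))).
  apply: (@integrableM_bounded _ _ R mu Rp _ _ 2 measurable_Rp ia).
    by apply: measurable_funTS; apply: measurable_funB => //; exact: measurable_cosM.
  by move=> z _; rewrite ger0_norm ?onem_cos_ge0 ?onem_cos_le2.
rewrite -(levy_integralE a02 (ltW u0)) -mulrA -!mulrDr; congr (2 * _).
rewrite -(RintegralZl _ measurable_Rp (integrable_levy u a02)).
have iB : mu.-integrable Rp (EFin \o (fun z => jumps_below r delta z * (1 - cos (u * z)))).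
  apply: eq_integrable (integrableB measurable_Rp (integrableB measurable_Rp iN iL) iA) => // z _ /=.
  by rewrite NE; congr EFin; ring.
rewrite -(RintegralD measurable_Rp iL iB).
have iLB := integrableD measurable_Rp iL iB.
rewrite -(RintegralD measurable_Rp iLB iA).
by apply: eq_Rintegral => z _; rewrite NE; ring.
Qed.

(** The density q of S_1 does not depend on n.  The exponential in the bound is
linearized because the rate is at most 1. *)
Lemma levy_L1_rate (alpha : R) (tau : R -> R) (L S : R -> {RV P >-> R}) :
  0 < alpha < 2 -> tau_condition tau -> locally_stable_process alpha tau L ->
  symmetric_stable_process alpha S ->
  exists q : R -> R, exists2 C : R, 0 < C & forall n, (2 <= n)%N -> exists2 p : R -> R,
  [/\ measurable_fun setT p, forall y, 0 <= p y &
   forall A : set R, measurable A ->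
     P ((fun w => n%:R `^ alpha^-1 * L n%:R^-1 w) @^-1` A) = (\int[mu]_(y in A) (p y)%:E)%E] &
  [/\ measurable_fun setT q, forall y, 0 <= q y,
   forall A : set R, measurable A -> P (S 1 @^-1` A) = (\int[mu]_(y in A) (q y)%:E)%E &
  (\int[mu]_y `|p y - q y|%:E <= (C * tv_rate alpha n)%:E)%E].
Proof.
move=> a02 ct hL hS; have a0 : 0 < alpha by case/andP : a02.
have [r [C0 [C00 CP]]] := levy_excess_rate a02 ct.
pose I := \int[mu]_(u in Rp) stretched_weight alpha u.
have I0 : 0 <= I.
  by apply: Rintegral_ge0 => u; rewrite /= in_itv/= andbT => /ltW; exact: stretched_weight_ge0.
pose C := (9 + C0) * C0 * I + 4 * C0 * expR (4 * C0).
have Cp : 0 < C.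
  apply: ltr_wpDl; last by rewrite !mulr_gt0// expR_gt0.
  by rewrite !mulr_ge0// ?addr_ge0// ltW.
exists (cosine_transform (fun u => expR (- (u `^ alpha)))); exists C => // n n2.
have n1 : (1 <= n)%N by exact: leq_trans n2.
have [h1 h2 h3 h4 h5] := CP n n2.
have t0 := tv_rate_ge0 alpha n1.
have t1 := tv_rate_le1 a0 n1.
have mX : measurable_fun setT (fun w => n%:R `^ alpha^-1 * L n%:R^-1 w) by exact: measurable_funM.
have md : measurable_fun setT (levy_excess alpha tau (n%:R `^ alpha^-1)).
  by case: ct => mtau *; exact: measurable_levy_excess.
have k1 : C0 * tv_rate alpha n <= C0 by rewrite ler_piMr// ltW.
have mS : measurable_fun setT (S 1 : T -> R) by [].
have [p hp [mq q0 lq hpq]] := L1_dist_densities mX mS a02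
  (measurable_funTS (measurable_jumps_below r md)) h1 h2 h3 k1 h4 h5
  (fun u u0 => etrans (charfun_rescaled u a02 ct hL n1).1
     (congr1 (fun x => expR (- x)) (rescaled_exponent_split a02 u0 ct h4)))
  (fun u u0 => (charfun_rescaled u a02 ct hL n1).2)
  (fun u u0 => (charfun_stable hS u0).1) (fun u u0 => (charfun_stable hS u0).2).
exists p => //; split => //; apply: (le_trans hpq); rewrite lee_fin -/I /C [leRHS]mulrDl.
apply: lerD; first by rewrite le_eqVlt; apply/orP; left; apply/eqP; ring.
have e0 : 0 <= 4 * (C0 * tv_rate alpha n) by rewrite !mulr_ge0// ltW.
have h := normr_expRB1 (4 * (C0 * tv_rate alpha n)); rewrite (ger0_norm e0) in h.
apply: (le_trans (ler_norm _)); apply: (le_trans h).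
rewrite [leRHS](_ : _ = 4 * (C0 * tv_rate alpha n) * expR (4 * C0)); last by ring.
by rewrite ler_wpM2l// ler_expR ler_pM2l.
Qed.

End total_variation.

(** * Moments of order below alpha *)

Section moments.
Context {R : realType} d (T : measurableType d) (P : probability T R).
Notation mu := (@lebesgue_measure R).
Notation Rp := (`]0%R, +oo[%classic : set R).

Lemma integrable_moment_kernel (alpha beta K : R) : 0 < beta -> beta < alpha -> 0 <= K ->
  mu.-integrable Rp (EFin \o (fun u => u `^ (- 1 - beta) * Num.min 2 (K * u `^ alpha))).
Proof.
move=> b0 ba K0; have m0 (u : R) : 0 <= Num.min 2 (K * u `^ alpha).
  by rewrite le_min mulr_ge0 ?powR_ge0// andbT.
apply: (@integrable_Rp_powR R (alpha - beta) beta (K + 2)) => //.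
- by rewrite subr_gt0.
- apply: measurable_funTS; apply: measurable_funM; first exact: measurable_powR.
  by apply: measurable_minr => //; apply: measurable_funM => //; exact: measurable_powR.
- move=> z /andP[z0 z1]; rewrite ger0_norm ?mulr_ge0 ?powR_ge0//.
  rewrite mulrC; apply: (@le_trans _ _ (K * z `^ alpha * z `^ (- 1 - beta))).
    by rewrite ler_wpM2r ?powR_ge0// ge_min lexx orbT.
  rewrite -mulrA -powRD; last by rewrite (gt_eqF z0) implybT.
  rewrite (_ : alpha + (- 1 - beta) = alpha - beta - 1); last by ring.
  by rewrite ler_wpM2r ?powR_ge0// lerDl.
- move=> z z1; rewrite ger0_norm ?mulr_ge0 ?powR_ge0// mulrC ler_wpM2r ?powR_ge0//.
  by rewrite ge_min lerDr K0.
Qed.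

(** Writing |x|^beta as an average of 1 - cos (u x) turns a bound on the real
characteristic function near 0 into a bound on the moment of order beta. *)
Lemma moment_le (alpha beta K : R) : 0 < beta -> beta < alpha -> alpha < 2 -> 0 <= K ->
  exists2 M, 0 <= M & forall X : T -> R, measurable_fun setT X ->
   (forall u, 0 < u -> 1 - \int[P]_w cos (u * X w) <= K * u `^ alpha) ->
   (\int[P]_w (`|X w| `^ beta)%:E <= M%:E)%E.
Proof.
move=> b0 ba a2 K0; have b02 : 0 < beta < 2 by rewrite b0 (lt_trans ba).
have c0 := stable_const_gt0 b02.
have ik := integrable_moment_kernel b0 ba K0.
pose I := \int[mu]_(u in Rp) (u `^ (- 1 - beta) * Num.min 2 (K * u `^ alpha)).
have I0 : 0 <= I.
  apply: Rintegral_ge0 => u _; rewrite mulr_ge0 ?powR_ge0// le_min mulr_ge0 ?powR_ge0//.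
  by rewrite andbT.
exists (2 * stable_const beta * I); first by rewrite mulr_ge0// mulr_ge0// ltW.
move=> X mX phi_le.
pose k (u : R) := u `^ (- 1 - beta).
have k0 u : 0 <= (k \_ Rp) u by rewrite patchE; case: ifP => // _; exact: powR_ge0.
pose H (z : T * R) : \bar R := ((k \_ Rp) z.2 * (1 - cos (X z.1 * z.2)))%:E.
have H0 z : (0 <= H z)%E by rewrite lee_fin mulr_ge0// onem_cos_ge0.
have mk : measurable_fun setT (k \_ Rp).
  by apply/(measurable_restrictT _ measurable_Rp); apply: measurable_funTS; exact: measurable_powR.
have mH : measurable_fun setT H.
  apply/measurable_EFinP; apply: measurable_funM; first exact: measurableT_comp.
  apply: measurable_funB => //; apply: measurableT_comp; first exact: continuous_measurable_fun (@continuous_cos R).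
  by apply: measurable_funM => //; exact: measurableT_comp.
have inner w : ((2 * stable_const beta)%:E * \int[mu]_u H (w, u) = (`|X w| `^ beta)%:E)%E.
  rewrite -(levy_integralE b02 (normr_ge0 (X w))) [RHS]EFinM; congr (_ * _)%E.
  rewrite /Rintegral fineK; last exact: (integrable_fin_num measurable_Rp (integrable_levy _ b02)).
  rewrite [RHS]integral_mkcond; apply: eq_integral => u _.
  rewrite /H/= !patchE; case: ifP => _; last by rewrite mul0r.
  by case: (ger0P (X w)) => // _; rewrite mulNr cosN.
have -> : (\int[P]_w (`|X w| `^ beta)%:E =
    (2 * stable_const beta)%:E * \int[P]_w \int[mu]_u H (w, u))%E.
  rewrite -ge0_integralZl//.
  - by apply: eq_integral => w _; rewrite inner.
  - exact: (@measurable_fun_fubini_tonelli_F _ _ _ _ _ mu H mH H0).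
  - by move=> w _; apply: integral_ge0.
  - by rewrite lee_fin mulr_ge0// ltW.
rewrite [leRHS]EFinM lee_wpmul2l ?lee_fin ?mulr_ge0 ?(ltW c0)//.
rewrite (@fubini_tonelli _ _ _ _ _ P mu H mH H0).
rewrite /I /Rintegral fineK; last exact: (integrable_fin_num measurable_Rp ik).
rewrite [leRHS]integral_mkcond; apply: ge0_le_integral => //.
- by move=> u _; apply: integral_ge0.
- exact: (@measurable_fun_fubini_tonelli_G _ _ _ _ _ P H mH H0).
- by case/(integrable_mkcond _ measurable_Rp)/integrableP : ik.
move=> u _; rewrite patchE; case: ifPn => [uR|uR]; last first.
  by rewrite integral0_eq// => w _; rewrite /H/= patchE (negbTE uR) mul0r.
have u0 : 0 < u by move: uR; rewrite inE /= in_itv/= andbT.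
have cst (x : R) : P.-integrable setT (EFin \o (fun=> x)) /\ \int[P]_w x = x.
  split; first exact: finite_measure_integrable_cst.
  by rewrite Rintegral_cst//= probability_setT/= mulr1.
have [i1 e1] := cst 1; have [i2 e2] := cst 2.
have mc : measurable_fun setT (fun w => cos (u * X w)).
  apply: measurableT_comp; first exact: continuous_measurable_fun (@continuous_cos R).
  exact: measurable_funM.
have ic : P.-integrable setT (EFin \o (fun w => cos (u * X w))).
  by apply: (@le_integrable_fin _ _ R P setT _ (fun=> 1) measurableT) => // w _; exact: cos_max.
have iB := integrableB measurableT i1 ic.
have eB : \int[P]_w (1 - cos (u * X w)) = 1 - \int[P]_w cos (u * X w).
  by rewrite (RintegralB measurableT i1 ic) e1.
have -> : (\int[P]_w H (w, u) = (k u * (1 - \int[P]_w cos (u * X w)))%:E)%E.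
  rewrite -eB EFinM /Rintegral [X in (_ * X)%E]fineK; last exact: (integrable_fin_num measurableT iB).
  rewrite -ge0_integralZl//.
  - by apply: eq_integral => w _; rewrite /H/= patchE uR -EFinM (mulrC (X w)).
  - by case/integrableP : iB.
  - by rewrite lee_fin powR_ge0.
rewrite lee_fin ler_wpM2l ?powR_ge0// le_min phi_le// andbT -eB -[leRHS]e2.
apply: (@le_Rintegral _ _ R P setT _ _ measurableT iB i2) => w _.
exact: onem_cos_le2.
Qed.

End moments.

(** * Independence of the Gaussian variable *)

Section independence.
Context {R : realType} d (T : measurableType d) (P : probability T R).
Variables U V : {RV P >-> R}.
Hypothesis indUV : indep P U V.

Let UV (w : T) : R * R := (U w, V w).
Let mUV : measurable_fun setT UV. Proof. exact: measurable_fun_pair. Qed.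
Let law : {measure set (R * R) -> \bar R} :=
  measure_function_pushforward__canonical__measure_function_Measure P mUV.

(** Independence says that the law of (U, V) agrees with the product of the two laws on
rectangles, hence everywhere; the theorem of Tonelli then applies. *)
Lemma ge0_expectation_indep (f : R * R -> \bar R) : measurable_fun setT f ->
  (forall z, (0 <= f z)%E) ->
  (\int[P]_w f (U w, V w) = \int[P]_w \int[P]_v f (U w, V v))%E.
Proof.
move=> mf f0.
transitivity (\int[law]_z f z)%E.
  by rewrite (@ge0_integral_pushforward _ _ _ _ _ UV mUV P setT f).
transitivity (\int[(distribution P U \x distribution P V)%E]_z f z)%E.
  apply: eq_measure_integral => A mA _.
  apply/esym; exact: product_measure_unique.
rewrite fubini_tonelli1//.
have mF := @measurable_fun_fubini_tonelli_F _ _ _ _ _ (distribution P V) f mf f0.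
rewrite ge0_integral_distribution//; last first.
  by move=> x; apply: integral_ge0 => y _; exact: f0.
apply: eq_integral => w _ /=; rewrite /fubini_F ge0_integral_distribution//.
exact: measurableT_comp.
Qed.

(** The nonnegative case applied to h + M. *)
Lemma expectation_indep (h : R * R -> R) M : measurable_fun setT h ->
  (forall z, `|h z| <= M) ->
  \int[P]_w h (U w, V w) = \int[P]_w \int[P]_v h (U w, V v).
Proof.
move=> mh hM.
have M0 : 0 <= M by apply: le_trans (hM (0, 0)).
have hM0 z : 0 <= h z + M by have := hM z; rewrite ler_norml => /andP[]; lra.
have icst (x : R) : P.-integrable setT (EFin \o (fun=> x)) by exact: finite_measure_integrable_cst.
have bnd (k : T -> R) : measurable_fun setT k -> (forall w, `|k w| <= M) ->
    P.-integrable setT (EFin \o k) /\ \int[P]_w (k w + M) = \int[P]_w k w + M.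
  move=> mk kM.
  have ik : P.-integrable setT (EFin \o k).
    by apply: (@le_integrable_fin _ _ R P setT _ (fun=> M) measurableT).
  split=> //; rewrite (RintegralD measurableT ik (icst M)) Rintegral_cst//=.
  by rewrite probability_setT/= mulr1.
have mhw w : measurable_fun setT (fun v => h (U w, V v)).
  by apply: measurableT_comp => //; exact: measurable_fun_pair.
have [i1 e1] := bnd _ (measurableT_comp mh mUV) (fun w => hM _).
pose k w := \int[P]_v h (U w, V v).
have mk : measurable_fun setT k.
  have mb : measurable_fun setT (fun z : T * T => h (U z.1, V z.2)).
    by apply: measurableT_comp => //; apply: measurable_fun_pair; exact: measurableT_comp.
  have := @measurable_kernel_integral _ _ T T R P setT measurableT (fun=> 1) (fun z => h (U z.1, V z.2)) M (icst 1) mb.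
  move=> /(_ (fun z => hM _)); congr (measurable_fun _ _).
  by apply/funext => u; apply: eq_Rintegral => w _; rewrite mul1r.
have kM w : `|k w| <= M.
  have [iw _] := bnd _ (mhw w) (fun v => hM _).
  apply: (le_trans (le_normr_Rintegral measurableT iw)).
  have := @le_Rintegral _ _ R P setT _ _ measurableT (integrable_norm iw) (icst M) (fun v _ => hM _).
  by rewrite Rintegral_cst//= probability_setT/= mulr1.
have [i2 e2] := bnd _ mk kM.
apply: (addIr M); rewrite -e1 -e2 /Rintegral; congr fine.
rewrite (@ge0_expectation_indep (fun z => (h z + M)%:E)).
- apply: eq_integral => w _ /=.
  have [iw ew] := bnd _ (mhw w) (fun v => hM _).
  rewrite -ew /Rintegral fineK//.
  exact: (integrable_fin_num measurableT (integrableD measurableT iw (icst M))).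
- by apply/measurable_EFinP; exact: measurable_funD.
- by move=> z; rewrite lee_fin.
Qed.

End independence.

Section independent_perturbation.
Context {R : realType} d (T : measurableType d) (P : probability T R).

(** A bound valid for each fixed value of B survives integration over B. *)
Lemma normr_expectation_indepB (B X Y : {RV P >-> R}) (h k : R * R -> R) M e :
  indep P B X -> indep P B Y -> measurable_fun setT h -> measurable_fun setT k ->
  (forall z, `|h z| <= M) -> (forall z, `|k z| <= M) ->
  (forall b, `|\int[P]_w h (b, X w) - \int[P]_w k (b, Y w)| <= e) ->
  `|\int[P]_w h (B w, X w) - \int[P]_w k (B w, Y w)| <= e.
Proof.
move=> BX BY mh mk hM kM hk.
have icst (x : R) : P.-integrable setT (EFin \o (fun=> x)) by exact: finite_measure_integrable_cst.
have aux (f : R * R -> R) (Z : {RV P >-> R}) : measurable_fun setT f -> (forall z, `|f z| <= M) ->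
    P.-integrable setT (EFin \o (fun w => \int[P]_v f (B w, Z v))).
  move=> mf fM; apply: (@le_integrable_fin _ _ R P setT _ (fun=> M) measurableT) => //.
    have mb : measurable_fun setT (fun z : T * T => f (B z.1, Z z.2)).
      by apply: measurableT_comp => //; apply: measurable_fun_pair; exact: measurableT_comp.
    have := @measurable_kernel_integral _ _ T T R P setT measurableT (fun=> 1) (fun z => f (B z.1, Z z.2)) M (icst 1) mb.
    move=> /(_ (fun z => fM _)); congr (measurable_fun _ _).
    by apply/funext => u; apply: eq_Rintegral => w _; rewrite mul1r.
  move=> w _.
  have iw : P.-integrable setT (EFin \o (fun v => f (B w, Z v))).
    apply: (@le_integrable_fin _ _ R P setT _ (fun=> M) measurableT) => //.
    by apply: measurableT_comp => //; exact: measurable_fun_pair.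
  apply: (le_trans (le_normr_Rintegral measurableT iw)).
  have := @le_Rintegral _ _ R P setT _ _ measurableT (integrable_norm iw) (icst M) (fun v _ => fM _).
  by rewrite Rintegral_cst//= probability_setT/= mulr1.
rewrite (expectation_indep BX mh hM) (expectation_indep BY mk kM).
have i1 := aux _ X mh hM; have i2 := aux _ Y mk kM.
rewrite -(RintegralB measurableT i1 i2).
have i3 := integrableB measurableT i1 i2.
apply: (le_trans (le_normr_Rintegral measurableT i3)).
have := @le_Rintegral _ _ R P setT _ _ measurableT (integrable_norm i3) (icst e) (fun w _ => hk (B w)).
by rewrite Rintegral_cst//= probability_setT/= mulr1.
Qed.

End independent_perturbation.

(** * Uniform moments *)

Section moment_bounds.
Context {R : realType} d (T : measurableType d) (P : probability T R).
Notation mu := (@lebesgue_measure R).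
Notation Rp := (`]0%R, +oo[%classic : set R).

(** 1 - e^(-psi) <= psi, and psi_n u is at most a bound of tau times u^alpha, for every n. *)
Lemma levy_moments (alpha beta : R) (tau : R -> R) (L S : R -> {RV P >-> R}) :
  0 < alpha < 2 -> 0 < beta -> beta < alpha -> tau_condition tau ->
  locally_stable_process alpha tau L -> symmetric_stable_process alpha S ->
  exists2 M, 0 <= M &
   (forall n, (1 <= n)%N ->
      (\int[P]_w (`|(n%:R `^ alpha^-1 * L n%:R^-1 w)%R| `^ beta)%:E <= M%:E)%E) /\
   (\int[P]_w (`|S 1 w| `^ beta)%:E <= M%:E)%E.
Proof.
move=> a02 b0 ba ct hL hS; have /andP[a0 a2] := a02.
have [mtau tau0 [M tauM] _ _] := ct.
have M0 : 0 <= M := le_trans (tau0 0) (tauM 0).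
have K0 : 0 <= 1 + M by rewrite addr_ge0.
have [C C0 CP] := @moment_le R d T P alpha beta (1 + M) b0 ba a2 K0.
exists C => //; split=> [n n1|].
  apply: CP; first exact: measurable_funM.
  move=> u u0; rewrite (charfun_rescaled u a02 ct hL n1).1.
  set psi := 2 * _; apply: (@le_trans _ _ psi); first by have := expR_ge1Dx (- psi); lra.
  apply: (@le_trans _ _ (M * u `^ alpha)); last by rewrite ler_wpM2r ?powR_ge0// lerDr.
  rewrite -(levy_integralE a02 (ltW u0)) /psi.
  rewrite [leRHS](_ : _ = 2 * (M * stable_const alpha * \int[mu]_(z in Rp)
    (z `^ (- 1 - alpha) * (1 - cos (u * z))))); last by ring.
  rewrite ler_pM2l// -(RintegralZl _ measurable_Rp (integrable_levy u a02)).
  have tM z : `|tau z| <= M by rewrite ger0_norm.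
  apply: (@le_Rintegral _ _ R mu Rp _ _ measurable_Rp
    (integrable_rescaled_levy_density _ u a02 mtau tM)
    (integrableZl measurable_Rp _ (integrable_levy u a02))) => z _.
  rewrite [leRHS]mulrA ler_wpM2r ?onem_cos_ge0// /rescaled_levy_density ler_wpM2r ?powR_ge0//.
  by rewrite mulrC ler_wpM2r// ltW// stable_const_gt0.
apply: CP => // u u0; rewrite (charfun_stable hS u0).1.
apply: (@le_trans _ _ (1 * u `^ alpha)); last by rewrite ler_wpM2r ?powR_ge0// lerDl.
by have := expR_ge1Dx (- (u `^ alpha)); lra.
Qed.

(** stretched_weight 2 is (1 + u)^4 e^(-u^2 / 2), which dominates |u|^beta times the normal
density up to a constant. *)
Lemma gaussian_moment (beta : R) (B : {RV P >-> R}) : 0 < beta <= 4 -> standard_gaussian P B ->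
  exists2 M, 0 <= M & (\int[P]_w (`|B w| `^ beta)%:E <= M%:E)%E.
Proof.
move=> /andP[b0 b4] gB.
have i0 : 0 <= normal_peak (1 : R) by exact: normal_peak_ge0.
have iw := integrable_stretched_weight (ltr0Sn R 1).
exists (2 * (normal_peak 1 * \int[mu]_(y in Rp) stretched_weight 2 y)).
  rewrite mulr_ge0// mulr_ge0// Rintegral_ge0// => y; rewrite /= in_itv/= andbT => /ltW.
  exact: stretched_weight_ge0.
have p0 y : 0 <= normal_pdf 0 1 y :> R by exact: normal_pdf_ge0.
have mp := measurable_normal_pdf (0 : R) 1.
have mb : measurable_fun setT (fun y : R => (`|y| `^ beta)%:E).
  by apply/measurable_EFinP; exact: (@measurableT_comp _ _ _ _ _ _ (fun x : R => x `^ beta)).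
rewrite (@ge0_expectation_density R d T P B (normal_pdf 0 1) _ mp p0 gB (fun y => (`|y| `^ beta)%:E))//.
rewrite (@ge0_integral_even R (fun y => ((`|y| `^ beta)%:E * (normal_pdf 0 1 y)%:E)%E)).
- rewrite [leRHS]EFinM lee_wpmul2l//.
  have iw2 := integrableZl measurable_Rp (normal_peak 1) iw.
  rewrite -(RintegralZl _ measurable_Rp iw) /Rintegral fineK; last exact: (integrable_fin_num measurable_Rp iw2).
  apply: ge0_le_integral => //.
  + by move=> y _; rewrite mule_ge0// lee_fin.
  + apply: measurable_funTS; apply: emeasurable_funM => //; exact/measurable_EFinP.
  + by case/integrableP : iw2.
  move=> y; rewrite /= in_itv/= andbT => y0; rewrite -EFinM lee_fin normal_pdfE ?oner_eq0//.
  rewrite mulrCA ler_wpM2l// /normal_fun /stretched_weight subr0 expr1n (gtr0_norm y0).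
  rewrite powR_mulrn ?(ltW y0)// mulNr; apply: ler_pM => //.
    exact: powR_ge0.
  apply: (@le_trans _ _ ((1 + y) `^ beta)).
    by apply: ge0_ler_powR; rewrite ?nnegrE ?(ltW b0)//; lra.
  apply: (@le_trans _ _ ((1 + y) `^ 4)); first by rewrite ler_powR//; lra.
  by rewrite powR_mulrn//; lra.
- by apply: emeasurable_funM => //; exact/measurable_EFinP.
- by move=> y; rewrite mule_ge0// lee_fin.
- by move=> y; rewrite normrN !normal_pdfE ?oner_eq0// /normal_fun !subr0 sqrrN.
Qed.

End moment_bounds.

(** * Truncation of the test functions *)

Section truncation.
Context {R : realType} d (T : measurableType d) (P : probability T R).

Lemma ln_powR_le (p s : R) : 0 <= p -> 0 < s ->
  exists2 C, 0 < C & forall n : nat, (1 <= n)%N -> ln n%:R `^ p <= C * n%:R `^ s.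
Proof.
move=> p0 s0; have [M M0 MP] := powR_expR_le p0.
exists (M / s `^ p); first by rewrite divr_gt0// powR_gt0.
move=> n n1; have l0 : 0 <= ln (n%:R : R) by rewrite ln_ge0// ler1n.
have n0 : 0 < n%:R :> R by rewrite ltr0n.
have := MP (s * ln n%:R) (mulr_ge0 (ltW s0) l0).
rewrite powRM ?(ltW s0)// expRN ler_pdivrMr ?expR_gt0// => h.
rewrite (_ : n%:R `^ s = expR (s * ln n%:R)); last by rewrite /powR gt_eqF.
by rewrite mulrAC ler_pdivlMr ?powR_gt0// mulrC.
Qed.

Lemma powR_normD (beta a b : R) : 0 <= beta ->
  `|a + b| `^ beta <= 2 `^ beta * (`|a| `^ beta + `|b| `^ beta).
Proof.
move=> b0; apply: (@le_trans _ _ ((2 * Num.max `|a| `|b|) `^ beta)).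
  apply: ge0_ler_powR => //; rewrite ?nnegrE ?mulr_ge0// ?le_max ?normr_ge0//.
  apply: (le_trans (ler_normD _ _)); rewrite mulrDl mul1r lerD// le_max lexx ?orbT//.
rewrite powRM// ?le_max ?normr_ge0// ler_wpM2l ?powR_ge0//.
by rewrite /Num.max; case: ifP => _; rewrite ?lerDl ?lerDr powR_ge0.
Qed.

Lemma ge0_integrable_le (f : T -> R) (M : R) : measurable_fun setT f -> (forall w, 0 <= f w) ->
  (\int[P]_w (f w)%:E <= M%:E)%E ->
  P.-integrable setT (EFin \o f) /\ \int[P]_w f w <= M.
Proof.
move=> mf f0 fM.
have if_ : P.-integrable setT (EFin \o f).
  apply/integrableP; split; first exact/measurable_EFinP.
  apply: le_lt_trans (ltry M); apply: le_trans fM.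
  by under eq_integral do rewrite /= ger0_norm//.
split=> //; rewrite -lee_fin /Rintegral fineK//.
exact: (integrable_fin_num measurableT if_).
Qed.

Lemma moment_perturbation (B X : T -> R) (beta c Mc MB MX : R) :
  measurable_fun setT B -> measurable_fun setT X -> 0 <= beta -> `|c| <= Mc ->
  (\int[P]_w (`|B w| `^ beta)%:E <= MB%:E)%E -> (\int[P]_w (`|X w| `^ beta)%:E <= MX%:E)%E ->
  (\int[P]_w (`|(B w + c * X w)%R| `^ beta)%:E <= (2 `^ beta * (MB + Mc `^ beta * MX))%:E)%E.
Proof.
move=> mB mX b0 cM hB hX.
have mp (Y : T -> R) : measurable_fun setT Y -> measurable_fun setT (fun w => (`|Y w| `^ beta)%:E).
  move=> mY; apply/measurable_EFinP; apply: (@measurableT_comp _ _ _ _ _ _ (fun x : R => x `^ beta)) => //.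
  exact: measurableT_comp.
have iB0 : (0 <= \int[P]_w (`|B w| `^ beta)%:E)%E by apply: integral_ge0 => w _; rewrite lee_fin powR_ge0.
have iX0 : (0 <= \int[P]_w (`|X w| `^ beta)%:E)%E by apply: integral_ge0 => w _; rewrite lee_fin powR_ge0.
apply: (@le_trans _ _ (\int[P]_w ((2 `^ beta)%:E * ((`|B w| `^ beta)%:E + (Mc `^ beta)%:E * (`|X w| `^ beta)%:E)))%E).
  apply: ge0_le_integral => //.
  - apply: mp; apply: measurable_funD => //; exact: measurable_funM.
  - apply: emeasurable_funM => //; apply: emeasurable_funD; first exact: mp.
    by apply: emeasurable_funM => //; exact: mp.
  - move=> w _; rewrite (_ : (_ * _)%E = (2 `^ beta * (`|B w| `^ beta + Mc `^ beta * `|X w| `^ beta))%:E)//.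
    rewrite lee_fin; apply: (le_trans (powR_normD _ _ b0)).
    rewrite ler_wpM2l ?powR_ge0// lerD2l normrM powRM//.
    rewrite ler_wpM2r ?powR_ge0//; apply: ge0_ler_powR => //.
    by rewrite nnegrE (le_trans _ cM).
rewrite ge0_integralZl//.
- rewrite EFinM lee_wpmul2l ?lee_fin ?powR_ge0// ge0_integralD//.
  + rewrite EFinD leeD// ge0_integralZl//.
    * by rewrite EFinM lee_wpmul2l ?lee_fin ?powR_ge0.
    * exact: mp.
    * by rewrite lee_fin powR_ge0.
  + exact: mp.
  + by move=> w _; rewrite mule_ge0// lee_fin powR_ge0.
  + by apply: emeasurable_funM => //; exact: mp.
- apply: emeasurable_funD; first exact: mp.
  by apply: emeasurable_funM => //; exact: mp.
- by move=> w _; rewrite adde_ge0 ?mule_ge0// lee_fin powR_ge0.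
Qed.

Section split.
Variables (g : R -> R) (A r beta gamma M : R).
Hypotheses (mg : measurable_fun setT g) (A0 : 0 <= A) (r1 : 1 <= r).
Hypotheses (gamma0 : 0 <= gamma) (gamma_beta : gamma <= beta).
Hypothesis g_le : forall z, `|g z| <= A * (1 + `|z| `^ gamma).

Definition truncate (r : R) (f : R -> R) z := if `|z| <= r then f z else 0.

Lemma measurable_truncate f : measurable_fun setT f -> measurable_fun setT (truncate r f).
Proof.
move=> mf; apply: measurable_fun_ifT => //; apply: measurable_fun_ler => //.
Qed.

Lemma truncate_le z : `|truncate r g z| <= A * (1 + r `^ gamma).
Proof.
have r0 : 0 <= r by exact: le_trans r1.
rewrite /truncate; case: ifPn => zr; last by rewrite normr0 mulr_ge0 ?addr_ge0 ?powR_ge0.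
apply: (le_trans (g_le z)); rewrite ler_wpM2l// lerD2l.
by apply: ge0_ler_powR; rewrite ?nnegrE.
Qed.

(** Beyond r >= 1 the constant 1 is absorbed in |z|^gamma, and lowering the exponent from
beta to gamma gains r^(gamma - beta). *)
Lemma truncate_tail z : `|g z - truncate r g z| <= 2 * A * r `^ (gamma - beta) * `|z| `^ beta.
Proof.
rewrite /truncate; case: ifPn => [_|].
  by rewrite subrr normr0 !mulr_ge0 ?powR_ge0.
rewrite -ltNge subr0 => rz; have r0 : 0 < r by exact: lt_le_trans r1.
have z0 : 0 < `|z| by exact: lt_trans rz.
have z1 : 1 <= `|z| by rewrite (le_trans r1)// ltW.
apply: (le_trans (g_le z)).
rewrite (_ : 2 * A * _ * _ = A * (2 * (r `^ (gamma - beta) * `|z| `^ beta))); last by ring.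
rewrite ler_wpM2l//; apply: (@le_trans _ _ (2 * `|z| `^ gamma)).
  rewrite mulrDl mul1r lerD2r -(powRr0 `|z|) ler_powR//.
rewrite ler_pM2l// (_ : `|z| `^ gamma = `|z| `^ (gamma - beta) * `|z| `^ beta); last first.
  by rewrite -powRD ?subrK// (gt_eqF z0) implybT.
rewrite ler_wpM2r ?powR_ge0// -(opprB beta) !powRN lef_pV2 ?posrE ?powR_gt0//.
by apply: ge0_ler_powR; rewrite ?nnegrE ?subr_ge0 ?(ltW r0) ?(ltW z0) ?(ltW rz).
Qed.

Let expectation_split (Z : T -> R) : measurable_fun setT Z ->
  (\int[P]_w (`|Z w| `^ beta)%:E <= M%:E)%E ->
  exists e, [/\ (\int[P]_w (g (Z w))%:E = e%:E)%E &
    `|e - \int[P]_w truncate r g (Z w)| <= 2 * A * r `^ (gamma - beta) * M].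
Proof.
move=> mZ hZ.
have mZb : measurable_fun setT (fun w => `|Z w| `^ beta).
  apply: (@measurableT_comp _ _ _ _ _ _ (fun x : R => x `^ beta)) => //; exact: measurableT_comp.
have [iZ lZ] := ge0_integrable_le mZb (fun w => powR_ge0 _ _) hZ.
have iK := integrableZl measurableT (2 * A * r `^ (gamma - beta)) iZ.
have mt : measurable_fun setT (fun w => truncate r g (Z w)).
  by apply: measurableT_comp => //; exact: measurable_truncate.
have it : P.-integrable setT (EFin \o (fun w => truncate r g (Z w))).
  apply: (@le_integrable_fin _ _ R P setT _ (fun=> A * (1 + r `^ gamma)) measurableT) => //.
  - exact: finite_measure_integrable_cst.
  - by move=> w _; exact: truncate_le.
have ir : P.-integrable setT (EFin \o (fun w => g (Z w) - truncate r g (Z w))).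
  apply: (@le_integrable_fin _ _ R P setT _ _ measurableT _ iK).
  - by apply: measurable_funB => //; exact: measurableT_comp.
  - by move=> w _; exact: truncate_tail.
have ig : P.-integrable setT (EFin \o (fun w => g (Z w))).
  apply: eq_integrable (integrableD measurableT ir it) => // w _ /=.
  by congr EFin; rewrite subrK.
exists (\int[P]_w g (Z w)); split.
  by rewrite /Rintegral fineK//; exact: (integrable_fin_num measurableT ig).
rewrite -(RintegralB measurableT ig it).
apply: (le_trans (le_normr_Rintegral measurableT ir)).
apply: (@le_trans _ _ (\int[P]_w (2 * A * r `^ (gamma - beta) * `|Z w| `^ beta))).
  apply: (@le_Rintegral _ _ R P setT _ _ measurableT (integrable_norm ir) iK) => w _.
  exact: truncate_tail.
by rewrite (RintegralZl _ measurableT iZ) ler_wpM2l// !mulr_ge0 ?powR_ge0.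
Qed.

Lemma expectation_dist_truncate (Z W : T -> R) D :
  measurable_fun setT Z -> measurable_fun setT W ->
  (\int[P]_w (`|Z w| `^ beta)%:E <= M%:E)%E -> (\int[P]_w (`|W w| `^ beta)%:E <= M%:E)%E ->
  `|\int[P]_w truncate r g (Z w) - \int[P]_w truncate r g (W w)| <= D ->
  (`|\int[P]_w (g (Z w))%:E - \int[P]_w (g (W w))%:E| <=
    (D + 4 * (A * r `^ (gamma - beta) * M))%:E)%E.
Proof.
move=> mZ mW hZ hW hD.
have [e [-> he]] := expectation_split mZ hZ.
have [f [-> hf]] := expectation_split mW hW.
rewrite -EFinB/= lee_fin.
move: he hf hD; rewrite !ler_norml => /andP[h1 h2] /andP[h3 h4] /andP[h5 h6].
by apply/andP; split; lra.
Qed.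

End split.

End truncation.

(** * The bound for functions of polynomial growth *)

Section smoothed_rate.
Context {R : realType}.

(** Up to the factor 1 + ln n, the rate is at most n^(-2 eps) times the maximum on the right.  Of
the available n^(2 eps), the truncated function takes n^eps and the powers of ln n take
n^(eps/2). *)
Lemma smoothed_rate (alpha eps p : R) : 0 < eps -> 0 < p ->
  exists2 K, 0 < K & forall n : nat, (2 <= n)%N ->
  let m := Num.max ((n%:R `^ (1 - 2 * eps))^-1) ((n%:R `^ (alpha^-1 - 2 * eps))^-1) in
  ln n%:R `^ p * (1 + n%:R `^ eps) * tv_rate alpha n <= K * m /\
  ln n%:R `^ p * n%:R `^ (eps - (1 - eps / 2)) <= K * m.
Proof.
move=> e0 p0; have e20 : 0 < eps / 2 by rewrite divr_gt0.
have [Ca Ca0 CaP] := @ln_powR_le R p (eps / 2) (ltW p0) e20.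
have [Cb Cb0 CbP] := @ln_powR_le R (p + 1) (eps / 2) (addr_ge0 (ltW p0) ler01) e20.
exists (2 * (Ca + Cb)); first by rewrite mulr_gt0// addr_gt0.
move=> n n2 m; have n1 : (1 <= n)%N by exact: leq_trans n2.
have x1 : 1 <= n%:R :> R by rewrite ler1n.
have l0 : 0 < ln (n%:R : R) := lt_le_trans ln2_gt0 (ln2_le n2).
have la := CaP n n1; have lb := CbP n n1.
have rate_le : tv_rate alpha n * n%:R `^ (2 * eps) <= (1 + ln n%:R) * m.
  have x0 : 0 < n%:R :> R by rewrite ltr0n.
  have shift s : (n%:R `^ s)^-1 * n%:R `^ (2 * eps) = (n%:R `^ (s - 2 * eps))^-1 :> R.
    rewrite -!powRN -powRD; last by rewrite (gt_eqF x0) implybT.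
    by congr powR; ring.
  have m1 : (n%:R `^ (1 - 2 * eps))^-1 <= m by rewrite le_max lexx.
  have m2 : (n%:R `^ (alpha^-1 - 2 * eps))^-1 <= m by rewrite le_max lexx orbT.
  have m0 : 0 <= m by rewrite (le_trans _ m1)// invr_ge0 powR_ge0.
  have s1 := shift 1; rewrite powRr1 ?(ltW x0)// in s1.
  rewrite /tv_rate; case: ifP => _.
    by rewrite s1 (le_trans m1)// ler_peMl// lerDl ltW.
  case: ifP => _; last by rewrite shift (le_trans m2)// ler_peMl// lerDl ltW.
  by rewrite -mulrA s1; apply: ler_pM; rewrite ?invr_ge0 ?powR_ge0 ?lerDr ?(ltW l0).
have x0 : 0 < n%:R :> R by rewrite ltr0n.
have m1 : (n%:R `^ (1 - 2 * eps))^-1 <= m by rewrite le_max lexx.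
have m0 : 0 <= m by rewrite (le_trans _ m1)// invr_ge0 powR_ge0.
have powD (s t : R) : n%:R `^ s * n%:R `^ t = n%:R `^ (s + t).
  by rewrite powRD// (gt_eqF x0) implybT.
have ge1 (s : R) : 0 <= s -> 1 <= n%:R `^ s.
  by move=> s0; rewrite -[leLHS](powRr0 n%:R) ler_powR.
split.
  have y0 : 0 < n%:R `^ (2 * eps) :> R by rewrite powR_gt0.
  rewrite -(ler_pM2r y0) -[leLHS]mulrA.
  have lp : ln n%:R `^ p * (1 + ln n%:R) <= (Ca + Cb) * n%:R `^ (eps / 2).
    rewrite mulrDr mulr1 mulrDl lerD// (le_trans _ lb)//.
    rewrite powRD; last by rewrite (gt_eqF l0) implybT.
    by rewrite powRr1// ltW.
  apply: (@le_trans _ _ (ln n%:R `^ p * (2 * n%:R `^ eps) * ((1 + ln n%:R) * m))).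
    apply: ler_pM => //.
    - by apply: mulr_ge0; rewrite ?addr_ge0 ?powR_ge0.
    - by apply: mulr_ge0; rewrite ?powR_ge0 ?tv_rate_ge0.
    - by rewrite ler_wpM2l ?powR_ge0// mulrDl mul1r lerD2r ge1// ltW.
  rewrite [leLHS](_ : _ = 2 * n%:R `^ eps * m * (ln n%:R `^ p * (1 + ln n%:R))); last by ring.
  apply: (@le_trans _ _ (2 * n%:R `^ eps * m * ((Ca + Cb) * n%:R `^ (eps / 2)))).
    by rewrite ler_wpM2l// !mulr_ge0 ?powR_ge0.
  rewrite [leLHS](_ : _ = 2 * (Ca + Cb) * m * (n%:R `^ eps * n%:R `^ (eps / 2))); last by ring.
  rewrite powD ler_wpM2l//; first by rewrite !mulr_ge0// ltW// addr_gt0.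
  by rewrite ler_powR//; lra.
apply: (@le_trans _ _ (Ca * n%:R `^ (eps / 2) * n%:R `^ (eps - (1 - eps / 2)))).
  by rewrite ler_wpM2r ?powR_ge0.
rewrite -mulrA powD.
have -> : n%:R `^ (eps / 2 + (eps - (1 - eps / 2))) = (n%:R `^ (1 - 2 * eps))^-1 :> R.
  by rewrite -powRN; congr powR; field.
by apply: ler_pM; rewrite ?invr_ge0 ?powR_ge0 ?(ltW Ca0)//; lra.
Qed.

End smoothed_rate.

Theorem proposition3p1 (R : realType) (d : measure_display)
    (T : measurableType d) (P : probability T R)
    (alpha : R) (tau : R -> R) (L S : R -> {RV P >-> R})
    (halpha : 0 < alpha < 2) (htau : tau_condition tau)
    (hL : locally_stable_process alpha tau L)
    (hS : symmetric_stable_process alpha S) :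
  (exists C : R, 0 < C /\ forall n : nat, (2 <= n)%N ->
     (dTV P (fun w => n%:R `^ alpha^-1 * L n%:R^-1 w)%R (S 1%R)
        <= (C * tv_rate alpha n)%:E)%E)
  /\
  (forall (B : {RV P >-> R}),
     standard_gaussian P B ->
     (forall n : nat, (2 <= n)%N -> indep P B (L n%:R^-1)) ->
     indep P B (S 1) ->
   forall (p : R) (g : nat -> R -> R) (eps : R),
     0 < p ->
     (forall n : nat, (1 <= n)%N -> measurable_fun setT (g n)) ->
     0 < eps < 1 / 4 ->
     (exists C : R, 0 < C /\ forall (n : nat) (z : R), (1 <= n)%N ->
        `|g n z| <= C * (ln n%:R) `^ p * (1 + `|z| `^ (eps * alpha))) ->
   forall c : nat -> R,
     (exists M : R, forall n : nat, (1 <= n)%N -> `|c n| <= M) ->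
     exists C : R, 0 < C /\ forall n : nat, (2 <= n)%N ->
       (`| 'E_P[fun w => g n (B w + c n * n%:R `^ alpha^-1 * L n%:R^-1 w)%R]
           - 'E_P[fun w => g n (B w + c n * S 1%R w)%R] |
        <= (C * Num.max ((n%:R `^ (1 - 2 * eps))^-1)
                        ((n%:R `^ (alpha^-1 - 2 * eps))^-1))%:E)%E).
Proof.
have /andP[a0 a2] := halpha.
have [q [C1 C10 C1P]] := levy_L1_rate halpha htau hL hS.
have mX n : measurable_fun setT (fun w => n%:R `^ alpha^-1 * L n%:R^-1 w).
  exact: measurable_funM.
have mS : measurable_fun setT (S 1 : T -> R) by [].
split.
  exists C1; split => // n n2; have [p [mp p0 lp] [mq q0 lq pq]] := C1P n n2.
  exact: (dTV_density (mX n) mS mp mq p0 q0 lp lq pq).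
move=> B gB iBL iBS p g eps p0 mg /andP[e0 e4] [Cg [Cg0 gP]] c [Mc cP].
(* Any beta < alpha gives finite moments; alpha - beta = alpha eps / 2 costs only
   n^(eps/2) in the tail. *)
pose beta := alpha * (1 - eps / 2).
have b0 : 0 < beta by rewrite mulr_gt0//; lra.
have ba : beta < alpha by rewrite /beta gtr_pMr//; lra.
have b4 : 0 < beta <= 4 by rewrite b0/=; lra.
have gb : eps * alpha <= beta by rewrite /beta mulrC ler_pM2l//; lra.
have [MX MX0 [mXn mS1]] := levy_moments halpha b0 ba htau hL hS.
have [MB MB0 mB] := gaussian_moment b4 gB.
have Mc0 : 0 <= Mc := le_trans (normr_ge0 _) (cP 1%N isT).
have [M M0 ME] : exists2 M, 0 <= M & M = 2 `^ beta * (MB + Mc `^ beta * MX).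
  by eexists; last reflexivity; rewrite mulr_ge0 ?powR_ge0// addr_ge0// mulr_ge0// powR_ge0.
have [K K0 KP] := smoothed_rate alpha e0 p0.
exists (Cg * C1 * K + 4 * (Cg * M * K)); split.
  apply: ltr_pwDl; first by rewrite !mulr_gt0.
  by rewrite !mulr_ge0// ltW.
move=> n n2; have n1 : (1 <= n)%N by exact: leq_trans n2.
have n0 : 0 <= n%:R :> R by [].
set r := n%:R `^ alpha^-1.
have r1 : 1 <= r := powR_inv_ge1 a0 n1.
have [p_ [mp p_0 lp] [mq q0 lq pq]] := C1P n n2.
pose A := Cg * ln n%:R `^ p.
have A0 : 0 <= A by rewrite mulr_ge0 ?powR_ge0// ltW.
have g0 : 0 <= eps * alpha by rewrite mulr_ge0// ltW.
have gn_le z : `|g n z| <= A * (1 + `|z| `^ (eps * alpha)) := gP n z n1.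
have mtg : measurable_fun setT (truncate r (g n)) by apply: measurable_truncate; exact: mg.
have tg_le z := truncate_le A0 r1 g0 gn_le z.
have mZ : measurable_fun setT (fun w => B w + c n * r * L n%:R^-1 w).
  by apply: measurable_funD => //; exact: measurable_funM.
have mW : measurable_fun setT (fun w => B w + c n * S 1 w).
  by apply: measurable_funD => //; exact: measurable_funM.
have hZ : (\int[P]_w (`|(B w + c n * r * L n%:R^-1 w)%R| `^ beta)%:E <= M%:E)%E.
  rewrite ME; have := @moment_perturbation R d T P B (fun w => r * L n%:R^-1 w) beta (c n) Mc MB MX
    _ (mX n) (ltW b0) (cP n n1) mB (mXn n n1).
  move=> /(_ (measurable_funPT B)); congr (_ <= _)%E.
  by apply: eq_integral => w _; rewrite mulrA.
have hW : (\int[P]_w (`|(B w + c n * S 1 w)%R| `^ beta)%:E <= M%:E)%E.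
  by rewrite ME; exact: (moment_perturbation _ mS (ltW b0) (cP n n1) mB mS1).
have hD : `|\int[P]_w truncate r (g n) (B w + c n * r * L n%:R^-1 w)
          - \int[P]_w truncate r (g n) (B w + c n * S 1 w)|
    <= A * (1 + r `^ (eps * alpha)) * (C1 * tv_rate alpha n).
  have maff (a : R) : measurable_fun setT (fun z : R * R => truncate r (g n) (z.1 + a * z.2)).
    apply: measurableT_comp => //; apply: measurable_funD => //.
    exact: measurable_funM.
  apply: (@normr_expectation_indepB R d T P B (L n%:R^-1) (S 1)
    (fun z => truncate r (g n) (z.1 + c n * r * z.2))
    (fun z => truncate r (g n) (z.1 + c n * z.2))
    (A * (1 + r `^ (eps * alpha)))) => //; first exact: iBL.
  move=> b.
  have mh : measurable_fun setT (fun y : R => truncate r (g n) (b + c n * y)).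
    apply: measurableT_comp => //; apply: measurable_funD => //; exact: measurable_funM.
  have := expectation_dist (mX n) mS mp mq p_0 q0 lp lq pq mh (fun y => tg_le _).
  congr (`|_ - _| <= _); apply: eq_Rintegral => w _.
  by rewrite mulrA.
have := expectation_dist_truncate (mg n n1) A0 r1 g0 gb gn_le mZ mW hZ hW hD.
rewrite unlock => /le_trans; apply; rewrite lee_fin.
have [k1 k2] := KP n n2; set m := Num.max _ _ in k1 k2 *.
have e1 : r `^ (eps * alpha) = n%:R `^ eps.
  by rewrite /r -powRrM mulrCA mulVf ?gt_eqF// mulr1.
have e2 : r `^ (eps * alpha - beta) = n%:R `^ (eps - (1 - eps / 2)).
  by rewrite /r -powRrM; congr powR; rewrite /beta; field; rewrite gt_eqF.
rewrite e1 e2 [leRHS]mulrDl; apply: lerD.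
  rewrite [leLHS](_ : _ = Cg * C1 * (ln n%:R `^ p * (1 + n%:R `^ eps) * tv_rate alpha n)); last by rewrite /A; ring.
  by rewrite -[leRHS]mulrA ler_wpM2l// mulr_ge0// ltW.
rewrite [leLHS](_ : _ = 4 * (Cg * M) * (ln n%:R `^ p * n%:R `^ (eps - (1 - eps / 2)))); last by rewrite /A; ring.
rewrite [leRHS](_ : _ = 4 * (Cg * M) * (K * m)); last by ring.
by rewrite ler_wpM2l// !mulr_ge0// ltW.
Qed.
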